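(* Let $n$ be a nonnegative integer, suppose $bcd=a^2q$ and $de=aq^{n+1}$, and let $\sigma\in\{0,1,2\}$ be determined by $n+\sigma\equiv 0\pmod 3$. Write \[ S=\sum_{k=0}^n \frac{E(aq^{4k})}{E(a)} \frac{(b,c;q^3,p)_k}{(aq/b,aq/c;q,p)_k} \frac{(d;q,p)_{2k}}{(aq/d;q,p)_{2k}} \frac{(e,q^{-n};q,p)_k}{(aq^3/e,aq^{n+3};q^3,p)_k}\, q^k , \] and, with $M=(n+\sigma)/3$, \begin{align*} f_n&=\frac{(aq^{3-\sigma},aq^{3-\sigma}/bc,aq^{3-\sigma}/bd,aq^{3-\sigma}/cd;q^3,p)_{M}} {(aq^{3-\sigma}/b,aq^{3-\sigma}/c,aq^{3-\sigma}/d,aq^{3-\sigma}/bcd;q^3,p)_{M}}, \\ g_n&=\frac{(aq^{3-\sigma},aq^{3-\sigma}/bc,aq^{2-\sigma}/bd,aq^{2-\sigma}/cd;q^3,p)_{M}} {(aq^{3-\sigma}/b,aq^{3-\sigma}/c,aq^{2-\sigma}/d,aq^{2-\sigma}/bcd;q^3,p)_{M}}, \\ h_n&=\frac{E(aq^\sigma)E(aq^\sigma/bc)E(aq/bd)E(aq/cd)} {E(aq^\sigma/b)E(aq^\sigma/c)E(aq/d)E(aq/bcd)} \frac{(aq^{3-\sigma},aq^{3-\sigma}/bc,aq^{1-\sigma}/bd,aq^{1-\sigma}/cd;q^3,p)_{M}} {(aq^{3-\sigma}/b,aq^{3-\sigma}/c,aq^{1-\sigma}/d,aq^{1-\sigma}/bcd;q^3,p)_{M}}.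 \end{align*} Then \begin{itemize} \item if $n\not\equiv 2\pmod 3$: $S=f_n\,{_{10}\omega_9}(a^2/deq;a/dq,a/e,b,c,d,q^{1-n},q^{-n};q^3,p)$; \item if $n\not\equiv 1\pmod 3$: $S=g_n\,{_{10}\omega_9}(a^2/de;a/d,a/e,b,c,dq,q^{2-n},q^{-n};q^3,p)$; \item if $n\not\equiv 0\pmod 3$: $S=h_n\,{_{10}\omega_9}(a^2q/de;aq/d,a/e,b,c,dq^2,q^{2-n},q^{1-n};q^3,p)$. \end{itemize}
   Context: Let $p$ be a complex number with $|p|<1$, $q$ a nonzero complex number, and all parameters generic so that no denominator vanishes. For nonzero $x$, $E(x)=E(x;p)=\prod_{k\ge 0}(1-xp^k)(1-p^{k+1}/x)$. For a nonzero base $Q$ and integer $m$, $(a;Q,p)_m=\prod_{k=0}^{m-1}E(aQ^k)$ if $m>0$, $=1$ if $m=0$, and $=1/\prod_{k=0}^{-m-1}E(aQ^{m+k})$ if $m<0$; $(a_1,\dots,a_s;Q,p)_m=\prod_{i=1}^s(a_i;Q,p)_m$. For parameters with $(a_4\cdots a_{r+1})^2=a_1^{r-3}Q^{r-5}$ and one of $a_4,\dots,a_{r+1}$ of the form $Q^{-N}$ ($N$ a nonnegative integer), \[{_{r+1}\omega_r}(a_1;a_4,\dots,a_{r+1};Q,p)=\sum_{k\ge 0}\frac{E(a_1Q^{2k})}{E(a_1)}\frac{(a_1,a_4,\dots,a_{r+1};Q,p)_k\,Q^k}{(Q,a_1Q/a_4,\dots,a_1Q/a_{r+1};Q,p)_k}\]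 (a terminating sum). *)

(* Defs.v *)
From Stdlib Require Import Reals ZArith List.
From Coquelicot Require Import Coquelicot.
Import ListNotations.
Open Scope C_scope.

Definition Cpowz (x : C) (z : Z) : C :=
  match z with
  | Z0 => RtoC 1
  | Zpos k => Cpow x (Pos.to_nat k)
  | Zneg k => Cinv (Cpow x (Pos.to_nat k))
  end.

Fixpoint Eprod (N : nat) (x p : C) : C :=
  match N with
  | O => RtoC 1
  | S N' => Eprod N' x p * ((RtoC 1 - x * Cpow p N') * (RtoC 1 - Cpow p (S N') / x))
  end.

(* E(x;p): the limit of the partial products (converges for |p|<1, x<>0) *)
Definition Eth (x p : C) : C :=
  @lim C_CompleteNormedModule (filtermap (fun N => Eprod N x p) eventually).

Fixpoint Eprod_shift (m : nat) (a Q p : C) : C :=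
  match m with
  | O => RtoC 1
  | S m' => Eprod_shift m' a Q p * Eth (a * Cpow Q m') p
  end.

Definition qpoch (a Q p : C) (m : Z) : C :=
  match m with
  | Z0 => RtoC 1
  | Zpos k => Eprod_shift (Pos.to_nat k) a Q p
  | Zneg k => Cinv (Eprod_shift (Pos.to_nat k) (a * Cpowz Q (Zneg k)) Q p)
  end.

Definition qpochs (l : list C) (Q p : C) (m : Z) : C :=
  fold_right (fun a acc => qpoch a Q p m * acc) (RtoC 1) l.

Fixpoint Csum (N : nat) (F : nat -> C) : C :=
  match N with
  | O => F O
  | S N' => Csum N' F + F N
  end.

Definition omega_term (a1 : C) (l : list C) (Q p : C) (k : nat) : C :=
  Eth (a1 * Cpow Q (2 * k)) p / Eth a1 p
  * qpochs (a1 :: l) Q p (Z.of_nat k) * Cpow Q k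
  / qpochs (Q :: map (fun ai => a1 * Q / ai) l) Q p (Z.of_nat k).

(* The terminating series r+1 omega r (a1; l; Q, p), where one of the
   parameters in l equals Q^{-N}: all terms with k > N vanish
   (they contain the factor E(1) = 0), so the series is the sum over k = 0..N. *)
Definition omega (N : nat) (a1 : C) (l : list C) (Q p : C) : C :=
  Csum N (omega_term a1 l Q p).

Definition omega_den_ok (N : nat) (a1 : C) (l : list C) (Q p : C) : Prop :=
  Eth a1 p <> RtoC 0 /\
  forall k : nat, (k <= N)%nat ->
    qpochs (Q :: map (fun ai => a1 * Q / ai) l) Q p (Z.of_nat k) <> RtoC 0.

Definition sigma3 (n : nat) : nat := (3 - n mod 3) mod 3.
Definition M3 (n : nat) : nat := ((n + sigma3 n) / 3)%nat.

Section Thm.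
Variables (p q a b c d e : C) (n : nat).

Let q3 := Cpow q 3.
Let qz (z : Z) := Cpowz q z.
Let s : Z := Z.of_nat (sigma3 n).
Let M : Z := Z.of_nat (M3 n).

Definition S_den (k : nat) : C :=
  Eth a p * qpochs [a * q / b; a * q / c] q p (Z.of_nat k)
  * qpoch (a * q / d) q p (Z.of_nat (2 * k))
  * qpochs [a * qz 3 / e; a * qz (Z.of_nat n + 3)] q3 p (Z.of_nat k).

Definition S_term (k : nat) : C :=
  Eth (a * Cpow q (4 * k)) p / Eth a p
  * qpochs [b; c] q3 p (Z.of_nat k) / qpochs [a * q / b; a * q / c] q p (Z.of_nat k)
  * qpoch d q p (Z.of_nat (2 * k)) / qpoch (a * q / d) q p (Z.of_nat (2 * k))
  * qpochs [e; qz (- Z.of_nat n)] q p (Z.of_nat k)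
  / qpochs [a * qz 3 / e; a * qz (Z.of_nat n + 3)] q3 p (Z.of_nat k)
  * Cpow q k.

Definition S_sum : C := Csum n S_term.

Definition f_num : C :=
  qpochs [a * qz (3 - s); a * qz (3 - s) / (b * c);
          a * qz (3 - s) / (b * d); a * qz (3 - s) / (c * d)] q3 p M.
Definition f_den : C :=
  qpochs [a * qz (3 - s) / b; a * qz (3 - s) / c;
          a * qz (3 - s) / d; a * qz (3 - s) / (b * c * d)] q3 p M.
Definition f_n : C := f_num / f_den.

Definition g_num : C :=
  qpochs [a * qz (3 - s); a * qz (3 - s) / (b * c);
          a * qz (2 - s) / (b * d); a * qz (2 - s) / (c * d)] q3 p M.
Definition g_den : C :=
  qpochs [a * qz (3 - s) / b; a * qz (3 - s) / c;
          a * qz (2 - s) / d; a * qz (2 - s) / (b * c * d)] q3 p M.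
Definition g_n : C := g_num / g_den.

Definition h_Enum : C :=
  Eth (a * qz s) p * Eth (a * qz s / (b * c)) p
  * Eth (a * q / (b * d)) p * Eth (a * q / (c * d)) p.
Definition h_Eden : C :=
  Eth (a * qz s / b) p * Eth (a * qz s / c) p
  * Eth (a * q / d) p * Eth (a * q / (b * c * d)) p.
Definition h_num : C :=
  qpochs [a * qz (3 - s); a * qz (3 - s) / (b * c);
          a * qz (1 - s) / (b * d); a * qz (1 - s) / (c * d)] q3 p M.
Definition h_den : C :=
  qpochs [a * qz (3 - s) / b; a * qz (3 - s) / c;
          a * qz (1 - s) / d; a * qz (1 - s) / (b * c * d)] q3 p M.
Definition h_n : C := h_Enum / h_Eden * (h_num / h_den).

Definition omega_f_a1 : C := a * a / (d * e * q).
Definition omega_f_l : list C :=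
  [a / (d * q); a / e; b; c; d; qz (1 - Z.of_nat n); qz (- Z.of_nat n)].
Definition omega_g_a1 : C := a * a / (d * e).
Definition omega_g_l : list C :=
  [a / d; a / e; b; c; d * q; qz (2 - Z.of_nat n); qz (- Z.of_nat n)].
Definition omega_h_a1 : C := a * a * q / (d * e).
Definition omega_h_l : list C :=
  [a * q / d; a / e; b; c; d * Cpow q 2; qz (2 - Z.of_nat n); qz (1 - Z.of_nat n)].

End Thm.

(* Main.v *)
(* Put x = exp u and s(u) = exp(-u/2) E(exp u). Then s is odd and satisfies Weierstrass' three-term relation;
   the latter holds because, by Jacobi's triple product, E(xy) E(x/y) is an antisymmetric kernel of rank two up to
   a monomial, so that its 4 x 4 Pfaffians vanish. In terms of s all monomial prefactors disappear.

   Shifting the summation index gives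
     S_n(a; b, c; d) = 1 + t_1 S_{n-1}(a q^4; b q^3, c q^3; d q^2).
   In each of the three 10-omega-9 series the first two parameters multiply to the leading one. A contiguous
   relation therefore connects the series of type f at n to the shifted one of type g at n - 1 (and g at n to
   h at n - 1) up to an 8-omega-7, whose Frenkel-Turaev sum is exactly the reciprocal of the prefactor. This is the
   recursion for S_n. The remaining equalities h = f (n = 1 mod 3) and h = g (n = 2 mod 3) follow from a second
   instance of the contiguous relation, which lowers n by 3. All this divides freely and so needs generic
   parameters; the general case follows by continuity, generic parameters being dense. *)

Require Import Defs.
From Stdlib Require Import Reals ZArith List Lia Lra Psatz.
From Stdlib Require Import Permutation ClassicalEpsilon Cantor.
From Coquelicot Require Import Coquelicot.
Import ListNotations.
Open Scope C_scope.

(** * Convergence of complex sequences and infinite products *)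

(** Each series contains two of q^(-n), q^(1-n), q^(2-n). In base q^3 it terminates at n/3 only if
    the one whose exponent is divisible by 3 is among them, which excludes one residue class for
    each type. Lowering q^(1-n) in f, or q^(2-n) in g, moves to the next type at n - 1; from h such
    a move would leave the three families. Hence h is compared with f or g at the same n, lowering a
    parameter with d instead, which keeps the type and drops n by 3. Logarithms are chosen for a, b,
    d, q alone; those of c and e are dictated by the two relations. So every argument of s is an
    integer combination of four logarithms, and genericity is the single condition that no
    nontrivial combination is a zero of s. The hypotheses only exclude zero denominators in the
    final formulas, whereas the recursion also divides by values that occur in intermediate series;
    this forces the passage to the limit. *)

Definition Ccv (u : nat -> C) (l : C) : Prop :=
  Un_cv (fun n => fst (u n)) (fst l) /\ Un_cv (fun n => snd (u n)) (snd l).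

Lemma Cmod_le_sum (z : C) : Cmod z <= Rabs (fst z) + Rabs (snd z).
Proof.
  replace z with (RtoC (fst z) + Ci * RtoC (snd z)) at 1.
  - eapply Rle_trans; [apply Cmod_triangle|].
    rewrite Cmod_mult, !Cmod_R, Cmod_Ci. lra.
  - destruct z as [a b]. unfold Ci, RtoC, Cmult, Cplus; simpl. f_equal; ring.
Qed.

Lemma Cmod_fst (z : C) : Rabs (fst z) <= Cmod z.
Proof. eapply Rle_trans; [apply Rmax_l | apply (Rmax_Cmod z)]. Qed.
Lemma Cmod_snd (z : C) : Rabs (snd z) <= Cmod z.
Proof. eapply Rle_trans; [apply Rmax_r | apply (Rmax_Cmod z)]. Qed.

Lemma Ccv_Cmod (u : nat -> C) (l : C) :
  Ccv u l <-> forall eps : R, 0 < eps -> exists N, forall n, (N <= n)%nat -> Cmod (u n - l) < eps.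
Proof.
  split.
  - intros [H1 H2] eps He.
    destruct (H1 (eps / 2)%R) as [N1 K1]; [lra|].
    destruct (H2 (eps / 2)%R) as [N2 K2]; [lra|].
    exists (max N1 N2). intros n Hn.
    assert (A1 := K1 n ltac:(lia)). assert (A2 := K2 n ltac:(lia)).
    unfold R_dist in *.
    eapply Rle_lt_trans; [apply Cmod_le_sum|]. simpl. unfold Rminus in *. lra.
  - intros H; split; intros eps He; destruct (H eps He) as [N K]; exists N; intros n Hn;
      specialize (K n Hn); unfold R_dist; eapply Rle_lt_trans; try apply K.
    + apply (Cmod_fst (u n - l)).
    + apply (Cmod_snd (u n - l)).
Qed.

Lemma Ccv_unique (u : nat -> C) (l l' : C) : Ccv u l -> Ccv u l' -> l = l'.
Proof.
  intros [H1 H2] [H3 H4]. apply injective_projections; eapply UL_sequence; eauto.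
Qed.

Lemma Ccv_ext (u v : nat -> C) (l : C) (N : nat) :
  (forall n, (N <= n)%nat -> u n = v n) -> Ccv u l -> Ccv v l.
Proof.
  rewrite !Ccv_Cmod. intros E H eps He. destruct (H eps He) as [M K].
  exists (max N M). intros n Hn. rewrite <- E by lia. apply K. lia.
Qed.

Lemma Un_cv_const (c : R) : Un_cv (fun _ => c) c.
Proof.
  intros eps He. exists 0%nat. intros. unfold R_dist. rewrite Rminus_diag, Rabs_R0. auto.
Qed.

Lemma Ccv_const (c : C) : Ccv (fun _ => c) c.
Proof. split; apply Un_cv_const. Qed.

Lemma Ccv_plus (u v : nat -> C) (l m : C) :
  Ccv u l -> Ccv v m -> Ccv (fun n => u n + v n) (l + m).
Proof. intros [H1 H2] [H3 H4]; split; simpl; apply CV_plus; auto. Qed.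

Lemma Ccv_opp (u : nat -> C) (l : C) : Ccv u l -> Ccv (fun n => - u n) (- l).
Proof. intros [H1 H2]; split; simpl; apply CV_opp; auto. Qed.

Lemma Ccv_minus (u v : nat -> C) (l m : C) :
  Ccv u l -> Ccv v m -> Ccv (fun n => u n - v n) (l - m).
Proof. intros H1 H2. apply Ccv_plus; auto using Ccv_opp. Qed.

Lemma Ccv_mult (u v : nat -> C) (l m : C) :
  Ccv u l -> Ccv v m -> Ccv (fun n => u n * v n) (l * m).
Proof.
  intros [H1 H2] [H3 H4]; split; simpl.
  - apply CV_minus; apply CV_mult; auto.
  - apply CV_plus; apply CV_mult; auto.
Qed.

Lemma Ccv_Cmod_cv (u : nat -> C) (l : C) : Ccv u l -> Un_cv (fun n => Cmod (u n)) (Cmod l).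
Proof.
  rewrite Ccv_Cmod. intros H eps He. destruct (H eps He) as [N K]. exists N. intros n Hn.
  unfold R_dist. eapply Rle_lt_trans; [|apply (K n); lia].
  assert (A := Cmod_triangle (u n - l) l). assert (B := Cmod_triangle (l - u n) (u n)).
  replace (u n - l + l) with (u n) in A by ring.
  replace (l - u n + u n) with l in B by ring.
  replace (l - u n) with (- (u n - l)) in B by ring. rewrite Cmod_opp in B.
  unfold Rabs. destruct (Rcase_abs _); lra.
Qed.

Lemma Ccv_inv (u : nat -> C) (l : C) : l <> 0 -> Ccv u l -> Ccv (fun n => / u n) (/ l).
Proof.
  intros Hl [H1 H2].
  assert (D : Un_cv (fun n => / (fst (u n) ^ 2 + snd (u n) ^ 2))%R (/ (fst l ^ 2 + snd l ^ 2))%R).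
  { apply (continuity_seq (fun x => / x)%R (fun n => fst (u n) ^ 2 + snd (u n) ^ 2)%R).
    - apply (continuity_pt_inv (fun x => x) _ (derivable_continuous_pt _ _ (derivable_pt_id _))).
      intros E. apply Hl. apply injective_projections; simpl; nra.
    - simpl. apply CV_plus; apply CV_mult; auto; rewrite Rmult_1_r;
        eapply Un_cv_ext; eauto; intros; simpl; ring. }
  split; simpl; unfold Rdiv; apply CV_mult; auto; try (apply CV_opp; auto).
Qed.

Lemma Ccv_div (u v : nat -> C) (l m : C) :
  m <> 0 -> Ccv u l -> Ccv v m -> Ccv (fun n => u n / v n) (l / m).
Proof. intros Hm H1 H2. apply Ccv_mult; auto using Ccv_inv. Qed.

(** [lim] is total, so [Eth] has its intended value only once the filter is known to be Cauchy;
    convergence to [l] supplies this. *)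
Lemma Ccv_lim (u : nat -> C) (l : C) :
  Ccv u l -> @lim C_CompleteNormedModule (filtermap u eventually) = l.
Proof.
  intros H. set (F := filtermap u eventually).
  assert (PF : ProperFilter F) by (apply filtermap_proper_filter, eventually_filter).
  assert (HC : @cauchy C_CompleteNormedModule F).
  { intros eps. exists l. destruct H as [H1 H2].
    destruct (H1 eps (cond_pos eps)) as [N1 K1]. destruct (H2 eps (cond_pos eps)) as [N2 K2].
    exists (max N1 N2). intros n Hn. split; [apply K1 | apply K2]; lia. }
  assert (K := @complete_cauchy C_CompleteNormedModule F PF HC).
  set (m := @lim C_CompleteNormedModule F) in *.
  apply (Ccv_unique u); auto.
  split; intros eps He; destruct (K (mkposreal eps He)) as [N KN]; exists N; intros n Hn;
    destruct (KN n Hn); auto.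
Qed.

Lemma Ccv_cauchy (u : nat -> C) :
  (forall eps, 0 < eps -> exists N, forall n, (N <= n)%nat -> Cmod (u n - u N) < eps) ->
  exists l, Ccv u l.
Proof.
  intros H.
  assert (H' : forall eps, 0 < eps -> exists N, forall n m, (N <= n)%nat -> (N <= m)%nat ->
     Cmod (u n - u m) < eps).
  { intros eps He. destruct (H (eps / 2)%R) as [N K]; [lra|]. exists N. intros n m Hn Hm.
    replace (u n - u m) with ((u n - u N) + - (u m - u N)) by ring.
    eapply Rle_lt_trans; [apply Cmod_triangle|]. rewrite Cmod_opp.
    assert (A := K n Hn). assert (B := K m Hm). lra. }
  destruct (Rcomplete.R_complete (fun n => fst (u n))) as [a Ha].
  { intros eps He. destruct (H' eps He) as [N K]. exists N. intros n m Hn Hm.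
    eapply Rle_lt_trans; [apply (Cmod_fst (u n - u m)) | apply K; lia]. }
  destruct (Rcomplete.R_complete (fun n => snd (u n))) as [b Hb].
  { intros eps He. destruct (H' eps He) as [N K]. exists N. intros n m Hn Hm.
    eapply Rle_lt_trans; [apply (Cmod_snd (u n - u m)) | apply K; lia]. }
  exists (a, b). split; auto.
Qed.

(** * Infinite products with geometrically small deviations from 1 *)

Fixpoint Cprod (f : nat -> C) (N : nat) : C :=
  match N with O => 1 | S N' => Cprod f N' * f N' end.

Lemma Cprod_add (f : nat -> C) (N m : nat) :
  Cprod f (N + m) = Cprod f N * Cprod (fun i => f (N + i)%nat) m.
Proof.
  induction m as [|m IH]; simpl.
  - rewrite Nat.add_0_r. ring.
  - rewrite Nat.add_succ_r. simpl. rewrite IH. ring.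
Qed.

Lemma geom_le (r : R) (N m : nat) : 0 <= r < 1 -> r ^ N * ((1 - r ^ m) / (1 - r)) <= r ^ N / (1 - r).
Proof.
  intros Hr. unfold Rdiv. apply Rmult_le_compat_l; [apply pow_le; lra|].
  rewrite <- (Rmult_1_l (/ (1 - r))) at 2. apply Rmult_le_compat_r.
  - left. apply Rinv_0_lt_compat. lra.
  - assert (H := pow_le r m). lra.
Qed.

Section Product.
Variables (f : nat -> C) (B r : R).
Hypothesis r01 : 0 <= r < 1.
Hypothesis B0 : 0 <= B.
Hypothesis f_near_1 : forall k, Cmod (f k - 1) <= B * r ^ k.

(** Since 1 + a <= exp a, a product of factors within a_i of 1 is within exp(sum of the a_i) - 1 of
    1. The induction carries the finite geometric sum, which is bounded by the full one
    beforehand. *)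
Lemma Cprod_tail_bound (N m : nat) :
  Cmod (Cprod (fun i => f (N + i)%nat) m - 1) <= exp (B * / (1 - r) * r ^ N) - 1.
Proof.
  eapply Rle_trans with (exp (B * (r ^ N * ((1 - r ^ m) / (1 - r)))) - 1)%R.
  2:{ apply Rplus_le_compat_r.
      assert (L : B * (r ^ N * ((1 - r ^ m) / (1 - r))) <= B * / (1 - r) * r ^ N).
      { rewrite Rmult_assoc. apply Rmult_le_compat_l; auto. rewrite (Rmult_comm (/ _)).
        now apply geom_le. }
      destruct L as [L|L]; [left; now apply exp_increasing | rewrite L; lra]. }
  induction m as [|m IH].
  - simpl. replace (RtoC 1 - 1) with (RtoC 0) by ring. rewrite Cmod_0.
    replace (B * (r ^ N * ((1 - 1) / (1 - r))))%R with 0%R by (field; lra).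
    rewrite exp_0. lra.
  - cbn [Cprod].
    set (Sm := (B * (r ^ N * ((1 - r ^ m) / (1 - r))))%R) in *.
    set (a := (B * r ^ (N + m))%R).
    replace (B * (r ^ N * ((1 - r ^ S m) / (1 - r))))%R with (Sm + a)%R
      by (unfold Sm, a; rewrite pow_add; simpl; field; lra).
    assert (F := f_near_1 (N + m)). fold a in F.
    set (g := f (N + m)%nat) in *. set (T := Cprod _ m) in *.
    replace (T * g - 1) with ((T - 1) * (g - 1) + ((T - 1) + (g - 1))) by ring.
    eapply Rle_trans; [apply Cmod_triangle|]. rewrite Cmod_mult.
    assert (Tr := Cmod_triangle (T - 1) (g - 1)).
    assert (G1 := Cmod_ge_0 (T - 1)). assert (G2 := Cmod_ge_0 (g - 1)).
    rewrite exp_plus.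
    assert (A : 1 + a <= exp a) by (apply exp_ineq1_le).
    assert (E1 : 0 < exp Sm) by apply exp_pos.
    assert (M1 : Cmod (T - 1) * Cmod (g - 1) <= (exp Sm - 1) * a).
    { apply Rmult_le_compat; auto. }
    nra.
Qed.

Lemma Cprod_bound (N : nat) : Cmod (Cprod f N) <= exp (B * / (1 - r)).
Proof.
  assert (H := Cprod_tail_bound 0 N). simpl in H. rewrite Rmult_1_r in H.
  replace (Cprod f N) with ((Cprod (fun i => f i) N - 1) + 1) by (change (fun i => f i) with f; ring).
  eapply Rle_trans; [apply Cmod_triangle|]. rewrite Cmod_1. lra.
Qed.

Lemma Cprod_cauchy (N m : nat) :
  Cmod (Cprod f (N + m) - Cprod f N) <= Cmod (Cprod f N) * (exp (B * / (1 - r) * r ^ N) - 1).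
Proof.
  rewrite Cprod_add.
  replace (Cprod f N * Cprod (fun i => f (N + i)%nat) m - Cprod f N)
    with (Cprod f N * (Cprod (fun i => f (N + i)%nat) m - 1)) by ring.
  rewrite Cmod_mult. apply Rmult_le_compat_l; [apply Cmod_ge_0|]. apply Cprod_tail_bound.
Qed.

Lemma exp_small (c eps : R) : 0 < eps ->
  exists N, forall n, (N <= n)%nat -> exp (c * r ^ n) - 1 < eps.
Proof.
  intros He.
  assert (H : Un_cv (fun n => exp (c * r ^ n))%R (exp (c * 0))).
  { apply (continuity_seq exp (fun n => c * r ^ n)%R).
    - apply derivable_continuous_pt, derivable_pt_exp.
    - apply CV_mult; [apply Un_cv_const|].
      intros e Hpos. destruct (pow_lt_1_zero r ltac:(rewrite Rabs_right; lra) e Hpos) as [N K].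
      exists N. intros n Hn. unfold R_dist. rewrite Rminus_0_r. apply K. lia. }
  rewrite Rmult_0_r, exp_0 in H. destruct (H eps He) as [N K]. exists N. intros n Hn.
  specialize (K n Hn). unfold R_dist in K. apply Rabs_def2 in K. lra.
Qed.

Lemma exp_tail_pos (N : nat) : 0 <= exp (B * / (1 - r) * r ^ N) - 1.
Proof.
  assert (L := exp_ineq1_le (B * / (1 - r) * r ^ N)).
  assert (0 <= B * / (1 - r) * r ^ N).
  { repeat apply Rmult_le_pos; auto; [left; apply Rinv_0_lt_compat; lra | apply pow_le; lra]. }
  lra.
Qed.

Lemma Cprod_cv : exists l, Ccv (Cprod f) l.
Proof.
  apply Ccv_cauchy. intros eps He.
  set (D := exp (B * / (1 - r))).
  assert (D0 : 0 < D) by apply exp_pos.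
  destruct (exp_small (B * / (1 - r)) (eps / D)) as [N K].
  { now apply Rdiv_lt_0_compat. }
  exists N. intros n Hn. replace n with (N + (n - N))%nat by lia.
  eapply Rle_lt_trans; [apply Cprod_cauchy; auto|].
  assert (K1 := K N (Nat.le_refl N)). assert (P := Cprod_bound N). fold D in P.
  assert (H0 := exp_tail_pos N).
  apply Rle_lt_trans with (D * (exp (B * / (1 - r) * r ^ N) - 1))%R.
  - apply Rmult_le_compat_r; auto.
  - apply Rlt_le_trans with (D * (eps / D))%R; [apply Rmult_lt_compat_l; auto|].
    right. field. lra.
Qed.

Lemma Un_cv_le (u : nat -> R) (l b : R) (N : nat) :
  Un_cv u l -> (forall n, (N <= n)%nat -> u n <= b) -> l <= b.
Proof.
  intros H K. apply Rnot_lt_le. intros L. destruct (H (l - b)%R) as [M HM]; [lra|].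
  assert (A := HM (max N M) ltac:(lia)). assert (C := K (max N M) ltac:(lia)).
  unfold R_dist in A. apply Rabs_def2 in A. lra.
Qed.

(** The error is relative to the partial product; this is what carries non-vanishing from a partial
    product to the limit. *)
Lemma Cprod_approx (l : C) (N : nat) : Ccv (Cprod f) l ->
  Cmod (l - Cprod f N) <= Cmod (Cprod f N) * (exp (B * / (1 - r) * r ^ N) - 1).
Proof.
  intros Hl.
  assert (H := Ccv_Cmod_cv _ _ (Ccv_minus _ _ _ _ Hl (Ccv_const (Cprod f N)))).
  apply (Un_cv_le _ _ _ N H). intros n Hn. replace n with (N + (n - N))%nat by lia.
  apply Cprod_cauchy.
Qed.

Lemma Cprod_lim_neq0 (l : C) :
  (forall k, f k <> 0) -> Ccv (Cprod f) l -> l <> 0.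
Proof.
  intros Hf Hl E.
  (* With relative error below 1/2, a zero limit would force the modulus of the partial product to
     be at most half of itself. *)
  destruct (exp_small (B * / (1 - r)) (1 / 2)) as [N KN]; [lra|].
  specialize (KN N (Nat.le_refl N)).
  assert (P : 0 < Cmod (Cprod f N)).
  { apply Cmod_gt_0. clear KN. induction N as [|N IH]; simpl.
    - intros K; apply RtoC_inj in K; lra.
    - apply Cmult_neq_0; auto. }
  assert (A := Cprod_approx l N Hl). rewrite E in A.
  replace (0 - Cprod f N) with (- Cprod f N) in A by ring. rewrite Cmod_opp in A. nra.
Qed.
End Product.

(** * Convergence, continuity and zeros of E *)

Definition Efac (x p : C) (k : nat) : C := (1 - x * p ^ k) * (1 - p ^ (S k) / x).

Lemma Eprod_Cprod (N : nat) (x p : C) : Eprod N x p = Cprod (Efac x p) N.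
Proof. induction N as [|N IH]; simpl; [reflexivity | now rewrite IH]. Qed.

(** Expanding a factor of E minus 1 gives a term in x, a term in 1/x and their product, in which x
    cancels; the three summands dominate these, up to |p|^k. *)
Definition Ebd (x : C) : R := (Cmod x + Cmod (/ x) + 1)%R.

Lemma Ebd_pos (x : C) : 0 <= Ebd x.
Proof. unfold Ebd. assert (X0 := Cmod_ge_0 x). assert (Y0 := Cmod_ge_0 (/ x)). lra. Qed.

Lemma Efac_bound (x p : C) (k : nat) : Cmod p < 1 -> Cmod (Efac x p k - 1) <= Ebd x * Cmod p ^ k.
Proof.
  intros Hp. unfold Efac, Ebd.
  replace ((1 - x * p ^ k) * (1 - p ^ S k / x) - 1)
    with (- (x * p ^ k) + (- (p ^ S k * / x) + x * p ^ k * (p ^ S k * / x))) by (unfold Cdiv; ring).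
  assert (P0 := Cmod_ge_0 p). assert (X0 := Cmod_ge_0 x). assert (Y0 := Cmod_ge_0 (/ x)).
  assert (K0 := pow_le (Cmod p) k P0).
  assert (K1 : Cmod p ^ k <= 1).
  { rewrite <- (pow1 k). apply pow_incr. lra. }
  assert (XY : Cmod (x * p ^ k * (p ^ S k * / x)) <= Cmod p ^ k).
  { destruct (Ceq_dec x 0) as [->|Hx].
    - rewrite !Cmult_0_l, Cmod_0. auto.
    - replace (x * p ^ k * (p ^ S k * / x)) with (p ^ k * p ^ S k) by now field.
      rewrite Cmod_mult, !Cmod_pow. simpl.
      rewrite <- (Rmult_1_r (Cmod p ^ k)) at 3. apply Rmult_le_compat_l; auto. nra. }
  eapply Rle_trans; [apply Cmod_triangle|]. rewrite Cmod_opp, Cmod_mult, Cmod_pow.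
  assert (T := Cmod_triangle (- (p ^ S k * / x)) (x * p ^ k * (p ^ S k * / x))).
  rewrite Cmod_opp in T. rewrite (Cmod_mult (p ^ S k)), Cmod_pow in T. simpl in T.
  assert (Q : Cmod p * Cmod p ^ k * Cmod (/ x) <= Cmod p ^ k * Cmod (/ x)).
  { apply Rmult_le_compat_r; auto. nra. }
  simpl in *. nra.
Qed.

Lemma Efac_bound_le (x p : C) (B : R) (k : nat) :
  Cmod p < 1 -> Ebd x <= B -> Cmod (Efac x p k - 1) <= B * Cmod p ^ k.
Proof.
  intros Hp HB. eapply Rle_trans; [now apply Efac_bound|].
  apply Rmult_le_compat_r; auto. apply pow_le, Cmod_ge_0.
Qed.

Lemma Eth_cv (x p : C) : Cmod p < 1 -> Ccv (fun N => Eprod N x p) (Eth x p).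
Proof.
  intros Hp.
  destruct (Cprod_cv (Efac x p) (Ebd x) (Cmod p)) as [l Hl]; auto using Ebd_pos, Cmod_ge_0, Efac_bound.
  assert (Hl' : Ccv (fun N => Eprod N x p) l).
  { apply (Ccv_ext (Cprod (Efac x p)) _ _ 0); auto. intros. now rewrite Eprod_Cprod. }
  unfold Eth. now rewrite (Ccv_lim _ _ Hl').
Qed.

(** The estimates are uniform where [Ebd] is bounded, that is, away from 0 and infinity. Continuity
    of E and isolation of its zeros both rest on this. *)
Lemma Eth_approx_unif (N : nat) (x p : C) (B : R) : Cmod p < 1 -> Ebd x <= B ->
  Cmod (Eth x p - Eprod N x p)
  <= Cmod (Eprod N x p) * (exp (B * / (1 - Cmod p) * Cmod p ^ N) - 1) /\
  Cmod (Eprod N x p) <= exp (B * / (1 - Cmod p)) /\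
  0 <= exp (B * / (1 - Cmod p) * Cmod p ^ N) - 1.
Proof.
  intros Hp HB.
  assert (B0 : 0 <= B) by (eapply Rle_trans; [apply Ebd_pos | exact HB]).
  assert (r01 : 0 <= Cmod p < 1) by (split; auto using Cmod_ge_0).
  assert (F := fun k => Efac_bound_le x p B k Hp HB).
  rewrite Eprod_Cprod. split; [|split].
  - apply (Cprod_approx _ _ _ r01 B0 F).
    apply (Ccv_ext (fun N => Eprod N x p) _ _ 0); [intros; apply Eprod_Cprod | now apply Eth_cv].
  - now apply Cprod_bound.
  - now apply exp_tail_pos.
Qed.

Lemma Ccv_Eprod (N : nat) (p x : C) (u : nat -> C) :
  x <> 0 -> Ccv u x -> Ccv (fun n => Eprod N (u n) p) (Eprod N x p).
Proof.
  intros Hx H. induction N as [|N IH]; simpl; [apply Ccv_const|].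
  apply Ccv_mult; auto. apply Ccv_mult; apply Ccv_minus; try apply Ccv_const.
  - apply Ccv_mult; auto using Ccv_const.
  - apply Ccv_div; auto using Ccv_const.
Qed.

Lemma Ccv_Eth (p x : C) (u : nat -> C) :
  Cmod p < 1 -> x <> 0 -> Ccv u x -> Ccv (fun n => Eth (u n) p) (Eth x p).
Proof.
  intros Hp Hx Hu.
  set (B := (Ebd x + 2)%R).
  assert (HB : exists M, forall n, (M <= n)%nat -> Ebd (u n) <= B).
  { destruct (Ccv_Cmod_cv _ _ Hu 1 ltac:(lra)) as [M1 K1].
    destruct (Ccv_Cmod_cv _ _ (Ccv_inv _ _ Hx Hu) 1 ltac:(lra)) as [M2 K2].
    exists (max M1 M2). intros n Hn.
    assert (A1 := K1 n ltac:(lia)). assert (A2 := K2 n ltac:(lia)).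
    unfold R_dist in *. apply Rabs_def2 in A1. apply Rabs_def2 in A2. unfold B, Ebd. lra. }
  destruct HB as [M HB].
  apply Ccv_Cmod. intros eps He.
  set (D := exp (B * / (1 - Cmod p))).
  assert (D0 : 0 < D) by apply exp_pos.
  destruct (exp_small (Cmod p)  ltac:(split; auto using Cmod_ge_0) (B * / (1 - Cmod p)) (eps / 3 / D)) as [N KN].
  { apply Rdiv_lt_0_compat; lra. }
  specialize (KN N (Nat.le_refl N)).
  assert (near : forall y : C, Ebd y <= B -> Cmod (Eth y p - Eprod N y p) < eps / 3).
  { intros y Hy. destruct (Eth_approx_unif N y p B Hp Hy) as (A1 & A2 & A3). fold D in A2.
    eapply Rle_lt_trans; [apply A1|].
    apply Rle_lt_trans with (D * (exp (B * / (1 - Cmod p) * Cmod p ^ N) - 1))%R.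
    - apply Rmult_le_compat_r; auto.
    - apply Rlt_le_trans with (D * (eps / 3 / D))%R; [apply Rmult_lt_compat_l; auto|].
      right. field. lra. }
  assert (HE := Ccv_Eprod N p x u Hx Hu). rewrite Ccv_Cmod in HE.
  destruct (HE (eps / 3)%R ltac:(lra)) as [M' KM].
  exists (max M M'). intros n Hn.
  replace (Eth (u n) p - Eth x p) with
    ((Eth (u n) p - Eprod N (u n) p) + ((Eprod N (u n) p - Eprod N x p) + - (Eth x p - Eprod N x p))) by ring.
  eapply Rle_lt_trans; [apply Cmod_triangle|].
  assert (T := Cmod_triangle (Eprod N (u n) p - Eprod N x p) (- (Eth x p - Eprod N x p))).
  rewrite Cmod_opp in T.
  assert (Q1 := near (u n) (HB n ltac:(lia))).
  assert (Q2 := near x ltac:(unfold B; lra)).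
  assert (Q3 := KM n ltac:(lia)). lra.
Qed.

(** Each factor is affine in y or in 1/y and has at most one zero; if that zero is not x, the radius
    keeps y away from it. *)
Lemma Eprod_isolated (N : nat) (p x : C) : Cmod p < 1 -> x <> 0 ->
  exists rho, 0 < rho /\ forall y : C, y <> 0 -> y <> x -> Cmod (y - x) < rho -> Eprod N y p <> 0.
Proof.
  intros Hp Hx. induction N as [|N (rho & R0 & IH)].
  - exists 1%R. split; [lra|]. intros y _ _ _ E. simpl in E. apply RtoC_inj in E. lra.
  - assert (F1 : exists r1, 0 < r1 /\ forall y : C, y <> x -> Cmod (y - x) < r1 -> 1 - y * p ^ N <> 0).
    { destruct (Ceq_dec (1 - x * p ^ N) 0) as [E|E].
      - exists 1%R. split; [lra|]. intros y Hy _ E'. apply Hy.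
        assert (P : p ^ N <> 0).
        { intros P. rewrite P in E. replace (1 - x * 0) with (RtoC 1) in E by ring.
          apply RtoC_inj in E. lra. }
        transitivity ((1 - (1 - y * p ^ N)) / p ^ N); [now field|].
        rewrite E', <- E. now field.
      (* At a zero y one has 1 - x p^N = (y - x) p^N, of modulus at most |y - x|. *)
      - exists (Cmod (1 - x * p ^ N)). split; [now apply Cmod_gt_0|].
        intros y _ Hr E'.
        assert (Q : 1 - x * p ^ N = (y - x) * p ^ N).
        { transitivity ((1 - y * p ^ N) + (y - x) * p ^ N); [ring | rewrite E'; ring]. }
        rewrite Q, Cmod_mult, Cmod_pow in Hr.
        assert (P1 : Cmod p ^ N <= 1).
        { rewrite <- (pow1 N). apply pow_incr. split; [apply Cmod_ge_0 | lra]. }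
        assert (G := Cmod_ge_0 (y - x)). nra. }
    assert (F2 : exists r2, 0 < r2 /\ forall y : C, y <> 0 -> y <> x -> Cmod (y - x) < r2 -> 1 - p ^ S N / y <> 0).
    { assert (yq : forall y : C, y <> 0 -> 1 - p ^ S N / y = 0 -> y = p ^ S N).
      { intros y Hy E. transitivity ((1 - p ^ S N / y) * y + p ^ S N); [now field | rewrite E; ring]. }
      destruct (Ceq_dec x (p ^ S N)) as [E|E].
      - exists 1%R. split; [lra|]. intros y H0 Hy _ E'. apply Hy. rewrite E. auto.
      - exists (Cmod (p ^ S N - x)). split.
        + apply Cmod_gt_0. intros K. apply E. symmetry.
          transitivity (p ^ S N - x + x); [ring | rewrite K; ring].
        + intros y H0 _ Hr E'. rewrite (yq y H0 E') in Hr. lra. }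
    destruct F1 as (r1 & R1 & F1). destruct F2 as (r2 & R2 & F2).
    exists (Rmin rho (Rmin r1 r2)). split; [repeat apply Rmin_pos; auto|].
    intros y H0 Hy Hr. simpl.
    assert (L1 := Rmin_l rho (Rmin r1 r2)). assert (L2 := Rmin_r rho (Rmin r1 r2)).
    assert (L3 := Rmin_l r1 r2). assert (L4 := Rmin_r r1 r2).
    repeat apply Cmult_neq_0.
    + apply IH; auto; lra.
    + apply F1; auto; lra.
    + apply F2; auto; lra.
Qed.

(** Where a partial product has relative error below 1/2, E can vanish only if that partial product
    does. *)
Lemma Eth_isolated (p x : C) : Cmod p < 1 -> x <> 0 ->
  exists rho, 0 < rho /\ forall y : C, y <> 0 -> y <> x -> Cmod (y - x) < rho -> Eth y p <> 0.
Proof.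
  intros Hp Hx.
  assert (X0 : 0 < Cmod x) by now apply Cmod_gt_0.
  (* This bounds [Ebd] on the disc |y - x| < |x| / 2, where |y| <= 2 |x| and |1/y| <= 2 / |x|. *)
  set (B := (2 * Cmod x + 2 * / Cmod x + 1)%R).
  destruct (exp_small (Cmod p) ltac:(split; auto using Cmod_ge_0) (B * / (1 - Cmod p)) (1 / 2)) as [N KN].
  { lra. }
  specialize (KN N (Nat.le_refl N)).
  destruct (Eprod_isolated N p x Hp Hx) as (rho & R0 & H).
  exists (Rmin rho (Cmod x / 2)). split; [apply Rmin_pos; lra|].
  intros y H0 Hy Hr E.
  assert (L1 := Rmin_l rho (Cmod x / 2)). assert (L2 := Rmin_r rho (Cmod x / 2)).
  assert (P := H y H0 Hy ltac:(lra)). apply Cmod_gt_0 in P.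
  assert (HB : Ebd y <= B).
  { assert (T1 := Cmod_triangle (y - x) x). replace (y - x + x) with y in T1 by ring.
    assert (T2 := Cmod_triangle (- (y - x)) y). replace (- (y - x) + y) with x in T2 by ring.
    rewrite Cmod_opp in T2.
    assert (I : Cmod (/ y) <= 2 * / Cmod x).
    { rewrite Cmod_inv by auto.
      replace (2 * / Cmod x)%R with (/ (Cmod x / 2))%R by (field; lra).
      apply Rinv_le_contravar; lra. }
    unfold Ebd, B. lra. }
  destruct (Eth_approx_unif N y p B Hp HB) as (A1 & _ & A3).
  rewrite E in A1. replace (0 - Eprod N y p) with (- Eprod N y p) in A1 by ring.
  rewrite Cmod_opp in A1. nra.
Qed.

Lemma p_pow_cv (p : C) : Cmod p < 1 -> Ccv (fun N => p ^ N) 0.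
Proof.
  intros Hp. apply Ccv_Cmod. intros eps He.
  destruct (pow_lt_1_zero (Cmod p)) with (y := eps) as [N K]; auto.
  { rewrite Rabs_right; auto. apply Rle_ge, Cmod_ge_0. }
  exists N. intros n Hn. replace (p ^ n - 0) with (p ^ n) by ring.
  rewrite Cmod_pow. eapply Rle_lt_trans; [apply Rle_abs | apply K; lia].
Qed.

Lemma Eth_inv (p x : C) : Cmod p < 1 -> x <> 0 -> x * Eth (/ x) p = - Eth x p.
Proof.
  intros Hp Hx.
  (* E(1/x) pairs the factors of E(x) with one index shifted by 1. The extra factors on both sides
     repair the truncation and tend to 1. *)
  assert (K : forall N, Eprod N (/ x) p * (1 - p ^ N * / x) * x = - (Eprod N x p * (1 - x * p ^ N))).
  { induction N as [|N IH]; simpl.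
    - field. auto.
    - transitivity (Eprod N (/ x) p * (1 - p ^ N * / x) * x * ((1 - p * p ^ N * x) * (1 - p * p ^ N * / x))).
      + field. auto.
      + rewrite IH. field. auto. }
  assert (Pc := p_pow_cv p Hp).
  assert (L1 : Ccv (fun N => Eprod N (/ x) p * (1 - p ^ N * / x) * x) (Eth (/ x) p * (1 - 0 * / x) * x)).
  { apply Ccv_mult; [|apply Ccv_const]. apply Ccv_mult; [now apply Eth_cv|].
    apply Ccv_minus; [apply Ccv_const|]. apply Ccv_mult; [auto | apply Ccv_const]. }
  assert (L2 : Ccv (fun N => - (Eprod N x p * (1 - x * p ^ N))) (- (Eth x p * (1 - x * 0)))).
  { apply Ccv_opp, Ccv_mult; [now apply Eth_cv|].
    apply Ccv_minus; [apply Ccv_const|]. apply Ccv_mult; [apply Ccv_const | auto]. }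
  assert (L3 := Ccv_ext _ _ _ 0 (fun n _ => K n) L1).
  assert (E := Ccv_unique _ _ _ L3 L2).
  transitivity (Eth (/ x) p * (1 - 0 * / x) * x); [field; auto | rewrite E; ring].
Qed.

(** * Bilateral sums and the triple product *)

Fixpoint Zsum (f : Z -> C) (A : Z) (n : nat) : C :=
  match n with O => 0 | S m => Zsum f A m + f (A + Z.of_nat m)%Z end.

Fixpoint symsum (f : Z -> C) (N : nat) : C :=
  match N with
  | O => f 0%Z
  | S N' => symsum f N' + f (Z.of_nat N) + f (- Z.of_nat N)%Z
  end.

Lemma Zsum_ext (f g : Z -> C) (A : Z) (n : nat) :
  (forall k, (A <= k < A + Z.of_nat n)%Z -> f k = g k) -> Zsum f A n = Zsum g A n.
Proof.
  induction n as [|n IH]; intros H; simpl; auto.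
  rewrite IH, H; auto; try lia. intros; apply H; lia.
Qed.

Lemma Zsum_add (f : Z -> C) (A : Z) (n m : nat) :
  Zsum f A (n + m) = Zsum f A n + Zsum f (A + Z.of_nat n) m.
Proof.
  induction m as [|m IH]; simpl.
  - rewrite Nat.add_0_r. ring.
  - rewrite Nat.add_succ_r. simpl. rewrite IH.
    replace (A + Z.of_nat (n + m))%Z with (A + Z.of_nat n + Z.of_nat m)%Z by lia. ring.
Qed.

Lemma Zsum_l (f : Z -> C) (A : Z) (n : nat) : Zsum f A (S n) = f A + Zsum f (A + 1) n.
Proof.
  change (S n) with (1 + n)%nat. rewrite Zsum_add. simpl. rewrite Z.add_0_r. ring.
Qed.

Lemma Zsum_0 (f : Z -> C) (A : Z) (n : nat) :
  (forall k, (A <= k < A + Z.of_nat n)%Z -> f k = 0) -> Zsum f A n = 0.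
Proof.
  intros H. induction n as [|n IH]; simpl; auto.
  rewrite IH, H by (intros; try apply H; lia). ring.
Qed.

Lemma symsum_Isum (f : Z -> C) (N : nat) : symsum f N = Zsum f (- Z.of_nat N) (2 * N + 1).
Proof.
  induction N as [|N IH].
  - simpl. ring.
  - cbn [symsum]. rewrite IH.
    replace (2 * S N + 1)%nat with (S (S (2 * N + 1))) by lia.
    rewrite (Zsum_l f _ (S (2 * N + 1))).
    replace (- Z.of_nat (S N) + 1)%Z with (- Z.of_nat N)%Z by lia.
    cbn [Zsum].
    replace (- Z.of_nat N + Z.of_nat (2 * N + 1))%Z with (Z.of_nat (S N)) by lia. ring.
Qed.

Definition supported (f : Z -> C) (L : nat) : Prop := forall k, (Z.of_nat L < Z.abs k)%Z -> f k = 0.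

Lemma Zsum_supp (f : Z -> C) (L : nat) (A : Z) (n : nat) :
  supported f L -> (A <= - Z.of_nat L)%Z -> (Z.of_nat L < A + Z.of_nat n)%Z -> Zsum f A n = symsum f L.
Proof.
  intros H H1 H2. rewrite symsum_Isum.
  set (a := Z.to_nat (- Z.of_nat L - A)).
  replace n with (a + ((2 * L + 1) + (n - a - (2 * L + 1))))%nat by (unfold a; lia).
  rewrite Zsum_add, Zsum_add.
  replace (A + Z.of_nat a)%Z with (- Z.of_nat L)%Z by (unfold a; lia).
  rewrite (Zsum_0 f A), (Zsum_0 f (- Z.of_nat L + Z.of_nat (2 * L + 1))).
  - ring.
  - intros k Hk. apply H. lia.
  - intros k Hk. apply H. unfold a in *. lia.
Qed.

Lemma Zsum_shift (f : Z -> C) (s A : Z) (n : nat) :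
  Zsum (fun k => f (k + s)%Z) A n = Zsum f (A + s) n.
Proof.
  induction n as [|n IH]; simpl; auto. rewrite IH. do 2 f_equal. lia.
Qed.

Lemma Zsum_plus (f g : Z -> C) (A : Z) (n : nat) :
  Zsum (fun k => f k + g k) A n = Zsum f A n + Zsum g A n.
Proof. induction n as [|n IH]; simpl; [ring | rewrite IH; ring]. Qed.

Lemma Zsum_scal (f : Z -> C) (c : C) (A : Z) (n : nat) :
  Zsum (fun k => c * f k) A n = c * Zsum f A n.
Proof. induction n as [|n IH]; simpl; [ring | rewrite IH; ring]. Qed.

Lemma Zsum_swap (h : Z -> Z -> C) (A B : Z) (n m : nat) :
  Zsum (fun i => Zsum (fun j => h i j) B m) A n = Zsum (fun j => Zsum (fun i => h i j) A n) B m.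
Proof.
  induction n as [|n IH]; simpl.
  - rewrite Zsum_0; auto.
  - rewrite IH, <- Zsum_plus. reflexivity.
Qed.

Lemma symsum_ext (f g : Z -> C) (N : nat) :
  (forall k, (Z.abs k <= Z.of_nat N)%Z -> f k = g k) -> symsum f N = symsum g N.
Proof. intros H. rewrite !symsum_Isum. apply Zsum_ext. intros; apply H; lia. Qed.

Lemma symsum_scal (f : Z -> C) (c : C) (N : nat) : symsum (fun k => c * f k) N = c * symsum f N.
Proof. rewrite !symsum_Isum. apply Zsum_scal. Qed.

Lemma Zsum_pairs (f : Z -> C) (A : Z) (n : nat) :
  Zsum f (2 * A) (2 * n) = Zsum (fun u => f (2 * u)%Z + f (2 * u + 1)%Z) A n.
Proof.
  induction n as [|n IH]; [reflexivity|].
  replace (2 * S n)%nat with (S (S (2 * n))) by lia. cbn [Zsum]. rewrite IH.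
  replace (2 * A + Z.of_nat (S (2 * n)))%Z with (2 * (A + Z.of_nat n) + 1)%Z by lia.
  replace (2 * A + Z.of_nat (2 * n))%Z with (2 * (A + Z.of_nat n))%Z by lia. ring.
Qed.

(* Z^2 is the union of the lattices {(u+v, u-v)} and {(u+v+1, u-v)}. *)
Lemma symsum_rotate (h : Z -> Z -> C) (N : nat) :
  (forall m n, (Z.of_nat N < Z.abs m \/ Z.of_nat N < Z.abs n)%Z -> h m n = 0) ->
  symsum (fun m => symsum (fun n => h m n) N) N
  = symsum (fun u => symsum (fun v => h (u + v)%Z (u - v)%Z) N) N
    + symsum (fun u => symsum (fun v => h (u + v + 1)%Z (u - v)%Z) N) N.
Proof.
  intros H.
  set (M := Z.of_nat N).
  (* The second index is replaced by k = m + n. The window of 2 (2N + 1) values from -2N on contains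
     all such sums, and its even length lets [Zsum_pairs] separate k = 2u from k = 2u + 1. *)
  transitivity (symsum (fun m => Zsum (fun k => h m (k - m)%Z) (2 * - M) (2 * (2 * N + 1))) N).
  { apply symsum_ext. intros m Hm.
    rewrite <- (Zsum_supp (fun n => h m n) N (2 * - M + - m) (2 * (2 * N + 1))); try lia.
    - rewrite <- Zsum_shift. apply Zsum_ext. intros; f_equal; lia.
    - intros n Hn. apply H. auto. }
  rewrite symsum_Isum, Zsum_swap, Zsum_pairs, Zsum_plus.
  rewrite !symsum_Isum. fold M. f_equal; apply Zsum_ext; intros u Hu.
  - transitivity (Zsum (fun v => h (u + v)%Z (u - v)%Z) (- M - u) (2 * N + 1)).
    + replace (- M - u)%Z with (- M + - u)%Z by lia. rewrite <- Zsum_shift.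
      apply Zsum_ext. intros; f_equal; lia.
    (* A window large enough to contain both the one centred at -u and the one centred at 0. *)
    + transitivity (Zsum (fun v => h (u + v)%Z (u - v)%Z) (- 3 * M) (6 * N + 1)).
      * set (a := Z.to_nat (2 * M - u)).
        replace (6 * N + 1)%nat with (a + ((2 * N + 1) + (4 * N - a)))%nat by (unfold a; lia).
        rewrite (Zsum_add _ (-3 * M)), (Zsum_add _ (-3 * M + Z.of_nat a)).
        rewrite (Zsum_0 _ (-3 * M)), (Zsum_0 _ (-3 * M + Z.of_nat a + Z.of_nat (2 * N + 1))).
        -- replace (-3 * M + Z.of_nat a)%Z with (- M - u)%Z by (unfold a; lia). ring.
        -- intros k Hk. apply H. unfold a in *. lia.
        -- intros k Hk. apply H. unfold a in *. lia.
      * apply Zsum_supp; try lia. intros k Hk. apply H. lia.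
  - transitivity (Zsum (fun v => h (u + v + 1)%Z (u - v)%Z) (- M - u - 1) (2 * N + 1)).
    + replace (- M - u - 1)%Z with (- M + (- u - 1))%Z by lia. rewrite <- Zsum_shift.
      apply Zsum_ext. intros; f_equal; lia.
    + transitivity (Zsum (fun v => h (u + v + 1)%Z (u - v)%Z) (- 3 * M - 1) (6 * N + 2)).
      * set (a := Z.to_nat (2 * M - u)).
        replace (6 * N + 2)%nat with (a + ((2 * N + 1) + (4 * N + 1 - a)))%nat by (unfold a; lia).
        rewrite (Zsum_add _ (-3 * M - 1)), (Zsum_add _ (-3 * M - 1 + Z.of_nat a)).
        rewrite (Zsum_0 _ (-3 * M - 1)), (Zsum_0 _ (-3 * M - 1 + Z.of_nat a + Z.of_nat (2 * N + 1))).
        -- replace (-3 * M - 1 + Z.of_nat a)%Z with (- M - u - 1)%Z by (unfold a; lia). ring.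
        -- intros k Hk. apply H. unfold a in *. lia.
        -- intros k Hk. apply H. unfold a in *. lia.
      * apply Zsum_supp; try lia. intros k Hk. apply H. lia.
Qed.

(** * Dominated convergence for bilateral sums *)

Section Tannery.
Variable B : R.
Hypothesis B0 : 0 <= B.

(** The bound is the exact two-sided geometric sum over L < |k| <= L + d; this form closes the
    induction on d. *)
Lemma symsum_tail (f : Z -> C) (L d : nat) :
  (forall k, Cmod (f k) <= B / 2 ^ Z.abs_nat k) ->
  Cmod (symsum f (L + d) - symsum f L) <= 2 * B / 2 ^ L - 2 * B / 2 ^ (L + d).
Proof.
  intros H. induction d as [|d IH].
  - rewrite Nat.add_0_r. replace (symsum f L - symsum f L) with (RtoC 0) by ring. rewrite Cmod_0. lra.
  - rewrite Nat.add_succ_r. cbn [symsum].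
    replace (symsum f (L + d) + f (Z.of_nat (S (L + d))) + f (- Z.of_nat (S (L + d)))%Z - symsum f L)
      with ((symsum f (L + d) - symsum f L) + (f (Z.of_nat (S (L + d))) + f (- Z.of_nat (S (L + d)))%Z)) by ring.
    eapply Rle_trans; [apply Cmod_triangle|].
    assert (T := Cmod_triangle (f (Z.of_nat (S (L + d)))) (f (- Z.of_nat (S (L + d)))%Z)).
    assert (H1 := H (Z.of_nat (S (L + d)))). assert (H2 := H (- Z.of_nat (S (L + d)))%Z).
    rewrite Zabs2Nat.id in H1. replace (Z.abs_nat (- Z.of_nat (S (L + d)))) with (S (L + d)) in H2 by lia.
    assert (E : (2 * B / 2 ^ (L + d) = 2 * (B / 2 ^ S (L + d)) + 2 * B / 2 ^ S (L + d))%R).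
    { simpl. field. apply pow_nonzero. lra. }
    rewrite E in IH. lra.
Qed.

Lemma symsum_tail_le (f : Z -> C) (L N : nat) : (L <= N)%nat ->
  (forall k, Cmod (f k) <= B / 2 ^ Z.abs_nat k) ->
  Cmod (symsum f N - symsum f L) <= 2 * B / 2 ^ L.
Proof.
  intros HL H. replace N with (L + (N - L))%nat by lia.
  eapply Rle_trans; [apply symsum_tail; auto|].
  assert (P : 0 < 2 ^ (L + (N - L))) by (apply pow_lt; lra).
  assert (0 <= 2 * B / 2 ^ (L + (N - L))).
  { apply Rmult_le_pos; [lra | left; now apply Rinv_0_lt_compat]. }
  lra.
Qed.

Lemma half_pow_small (eps : R) : 0 < eps -> exists L, 2 * B / 2 ^ L < eps.
Proof.
  intros He.
  destruct (pow_lt_1_zero (/ 2) ltac:(rewrite Rabs_right; lra) (eps / (2 * B + 1))) as [L K].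
  { apply Rdiv_lt_0_compat; lra. }
  exists L. specialize (K L (Nat.le_refl L)).
  rewrite Rabs_right in K by (apply Rle_ge, pow_le; lra).
  unfold Rdiv at 1. rewrite <- pow_inv.
  apply Rle_lt_trans with ((2 * B + 1) * (/ 2) ^ L)%R.
  - apply Rmult_le_compat_r; [apply pow_le|]; lra.
  - apply Rlt_le_trans with ((2 * B + 1) * (eps / (2 * B + 1)))%R.
    + apply Rmult_lt_compat_l; lra.
    + right. field. lra.
Qed.

Lemma symsum_cv (f : Z -> C) :
  (forall k, Cmod (f k) <= B / 2 ^ Z.abs_nat k) -> exists l, Ccv (symsum f) l.
Proof.
  intros H. apply Ccv_cauchy. intros eps He.
  destruct (half_pow_small eps He) as [L HL]. exists L. intros n Hn.
  eapply Rle_lt_trans; [apply symsum_tail_le; auto | auto].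
Qed.

Lemma Ccv_symsum (f : nat -> Z -> C) (g : Z -> C) (L : nat) :
  (forall k, Ccv (fun N => f N k) (g k)) -> Ccv (fun N => symsum (f N) L) (symsum g L).
Proof.
  intros H. induction L as [|L IH]; cbn [symsum]; auto.
  apply Ccv_plus; auto. apply Ccv_plus; auto.
Qed.

(** Split at a fixed L: beyond L all sums are small uniformly in N by the geometric majorant, and up
    to L there are only finitely many limits. *)
Lemma tannery (f : nat -> Z -> C) (g : Z -> C) (l : C) :
  (forall N k, Cmod (f N k) <= B / 2 ^ Z.abs_nat k) ->
  (forall k, Ccv (fun N => f N k) (g k)) ->
  Ccv (symsum g) l -> Ccv (fun N => symsum (f N) N) l.
Proof.
  intros Hf Hg Hl.
  assert (Hgb : forall k, Cmod (g k) <= B / 2 ^ Z.abs_nat k).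
  { intros k. apply (Un_cv_le _ _ _ 0 (Ccv_Cmod_cv _ _ (Hg k))). auto. }
  apply Ccv_Cmod. intros eps He.
  destruct (half_pow_small (eps / 4)) as [L HL]; [lra|].
  rewrite Ccv_Cmod in Hl. destruct (Hl (eps / 4)%R ltac:(lra)) as [N1 K1].
  assert (HZ := Ccv_symsum f g L Hg). rewrite Ccv_Cmod in HZ.
  destruct (HZ (eps / 4)%R ltac:(lra)) as [N2 K2].
  exists (max L (max N1 N2)). intros n Hn.
  replace (symsum (f n) n - l) with
    ((symsum (f n) n - symsum (f n) L) + ((symsum (f n) L - symsum g L) + (- (symsum g n - symsum g L) + (symsum g n - l)))) by ring.
  assert (A1 := symsum_tail_le (f n) L n ltac:(lia) (Hf n)).
  assert (A2 := symsum_tail_le g L n ltac:(lia) Hgb).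
  assert (A3 := K1 n ltac:(lia)). assert (A4 := K2 n ltac:(lia)).
  assert (T1 := Cmod_triangle (symsum (f n) n - symsum (f n) L) ((symsum (f n) L - symsum g L) + (- (symsum g n - symsum g L) + (symsum g n - l)))).
  assert (T2 := Cmod_triangle (symsum (f n) L - symsum g L) (- (symsum g n - symsum g L) + (symsum g n - l))).
  assert (T3 := Cmod_triangle (- (symsum g n - symsum g L)) (symsum g n - l)).
  rewrite Cmod_opp in T3. lra.
Qed.

Lemma symsum_bound (f : Z -> C) (N : nat) :
  (forall k, Cmod (f k) <= B / 2 ^ Z.abs_nat k) -> Cmod (symsum f N) <= 3 * B.
Proof.
  intros H. assert (T := symsum_tail_le f 0 N ltac:(lia) H).
  assert (H0 := H 0%Z). simpl in T, H0.
  replace (symsum f N) with ((symsum f N - f 0%Z) + f 0%Z) by ring.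
  eapply Rle_trans; [apply Cmod_triangle|]. unfold Rdiv in *. lra.
Qed.
End Tannery.

(** [tannery] is applied to the inner sum for fixed u and then to the outer one; [symsum_bound]
    bounds the inner sum uniformly in u and N. *)
Lemma tannery2 (K B : R) (g : nat -> Z -> Z -> C) (c : C) (al be : Z -> C) (la lb : C) :
  0 <= K -> 0 <= B ->
  (forall N u v, Cmod (g N u v) <= K) ->
  (forall u v, Ccv (fun N => g N u v) c) ->
  (forall k, Cmod (al k) <= B / 2 ^ Z.abs_nat k) ->
  (forall k, Cmod (be k) <= B / 2 ^ Z.abs_nat k) ->
  Ccv (symsum al) la -> Ccv (symsum be) lb ->
  Ccv (fun N => symsum (fun u => symsum (fun v => g N u v * (al u * be v)) N) N) (c * (la * lb)).
Proof.
  intros K0 B0 Hg Hc Ha Hb La Lb.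
  assert (inner : forall u, Ccv (fun N => symsum (fun v => g N u v * be v) N) (c * lb)).
  { intros u. apply (tannery (K * B) ltac:(apply Rmult_le_pos; auto) _ (fun v => c * be v)).
    - intros N k. rewrite Cmod_mult. unfold Rdiv. rewrite Rmult_assoc.
      apply Rmult_le_compat; auto using Cmod_ge_0.
    - intros k. apply Ccv_mult; auto using Ccv_const.
    - apply (Ccv_ext (fun N => c * symsum be N) _ _ 0).
      + intros. now rewrite symsum_scal.
      + apply Ccv_mult; auto using Ccv_const. }
  apply (Ccv_ext (fun N => symsum (fun u => al u * symsum (fun v => g N u v * be v) N) N) _ _ 0).
  { intros N _. apply symsum_ext. intros u _. rewrite <- symsum_scal. apply symsum_ext. intros; ring. }
  apply (tannery (B * (3 * (K * B)))
    ltac:(repeat apply Rmult_le_pos; auto; lra) _ (fun u => al u * (c * lb))).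
  - intros N u. rewrite Cmod_mult.
    replace (B * (3 * (K * B)) / 2 ^ Z.abs_nat u)%R with (B / 2 ^ Z.abs_nat u * (3 * (K * B)))%R
      by (unfold Rdiv; ring).
    apply Rmult_le_compat; auto using Cmod_ge_0.
    apply symsum_bound; [apply Rmult_le_pos; auto|].
    intros k. rewrite Cmod_mult. unfold Rdiv. rewrite Rmult_assoc.
    apply Rmult_le_compat; auto using Cmod_ge_0.
  - intros u. apply Ccv_mult; auto using Ccv_const.
  - apply (Ccv_ext (fun N => (c * lb) * symsum al N) _ _ 0).
    + intros N _. rewrite <- symsum_scal. apply symsum_ext. intros; ring.
    + replace (c * (la * lb)) with (c * lb * la) by ring.
      apply Ccv_mult; auto using Ccv_const.
Qed.

(** * Integer powers *)

Lemma C1_neq_0 : RtoC 1 <> 0.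
Proof. intros K. apply RtoC_inj in K. lra. Qed.

Lemma Cpowz_nat (x : C) (n : nat) : Cpowz x (Z.of_nat n) = x ^ n.
Proof.
  destruct n as [|n]; [reflexivity|].
  change (Cpowz x (Z.of_nat (S n))) with (x ^ Pos.to_nat (Pos.of_succ_nat n)).
  now rewrite SuccNat2Pos.id_succ.
Qed.

Lemma Cpowz_neg (x : C) (n : nat) : Cpowz x (- Z.of_nat n) = / x ^ n.
Proof.
  destruct n as [|n].
  - simpl. field.
  - change (Cpowz x (- Z.of_nat (S n))) with (/ x ^ Pos.to_nat (Pos.of_succ_nat n)).
    now rewrite SuccNat2Pos.id_succ.
Qed.

Lemma Z_nat_cases (k : Z) : exists n : nat, k = Z.of_nat n \/ k = (- Z.of_nat (S n))%Z.
Proof.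
  destruct (Z_lt_le_dec k 0).
  - exists (Z.to_nat (- k) - 1)%nat. right. lia.
  - exists (Z.to_nat k). left. lia.
Qed.

Lemma Cpowz_succ (x : C) (k : Z) : x <> 0 -> Cpowz x (k + 1) = x * Cpowz x k.
Proof.
  intros Hx. destruct (Z_nat_cases k) as [n [-> | ->]].
  - replace (Z.of_nat n + 1)%Z with (Z.of_nat (S n)) by lia. now rewrite !Cpowz_nat.
  - replace (- Z.of_nat (S n) + 1)%Z with (- Z.of_nat n)%Z by lia. rewrite !Cpowz_neg. simpl.
    field. split; auto using Cpow_nz.
Qed.

Lemma Cpowz_pred (x : C) (k : Z) : x <> 0 -> Cpowz x (k - 1) = Cpowz x k / x.
Proof.
  intros Hx. replace k with (k - 1 + 1)%Z at 2 by lia. rewrite Cpowz_succ by auto. now field.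
Qed.

Lemma Cpowz_nz (x : C) (k : Z) : x <> 0 -> Cpowz x k <> 0.
Proof.
  intros Hx. destruct (Z_nat_cases k) as [n [-> | ->]].
  - rewrite Cpowz_nat. now apply Cpow_nz.
  - rewrite Cpowz_neg. assert (H := Cpow_nz x (S n) Hx). intros E. apply C1_neq_0.
    transitivity (x ^ S n * / x ^ S n); [now field | rewrite E; ring].
Qed.

Lemma Cpowz_add (x : C) (k l : Z) : x <> 0 -> Cpowz x (k + l) = Cpowz x k * Cpowz x l.
Proof.
  intros Hx. revert l. apply Z.peano_ind.
  - rewrite Z.add_0_r. simpl. ring.
  - intros l IH. replace (k + Z.succ l)%Z with (k + l + 1)%Z by lia.
    replace (Z.succ l) with (l + 1)%Z by lia. rewrite !Cpowz_succ, IH by auto. ring.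
  - intros l IH. replace (k + Z.pred l)%Z with (k + l - 1)%Z by lia.
    replace (Z.pred l) with (l - 1)%Z by lia. rewrite !Cpowz_pred, IH by auto. now field.
Qed.

Lemma Cpowz_mul (x y : C) (k : Z) : x <> 0 -> y <> 0 -> Cpowz (x * y) k = Cpowz x k * Cpowz y k.
Proof.
  intros Hx Hy. destruct (Z_nat_cases k) as [n [-> | ->]].
  - now rewrite !Cpowz_nat, Cpow_mult_l.
  - rewrite !Cpowz_neg, Cpow_mult_l. field. split; now apply Cpow_nz.
Qed.

Lemma Cpowz_div (x y : C) (k : Z) : x <> 0 -> y <> 0 -> Cpowz (x / y) k = Cpowz x k / Cpowz y k.
Proof.
  intros Hx Hy. assert (Hk := Cpowz_nz y k Hy).
  assert (E : Cpowz (x / y) k * Cpowz y k = Cpowz x k).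
  { rewrite <- Cpowz_mul; auto.
    - f_equal. now field.
    - intros E. apply Hx. transitivity (x / y * y); [now field | rewrite E; ring]. }
  rewrite <- E. now field.
Qed.

(** * The finite form of the triple product *)

Definition tri (k : Z) : nat := Z.to_nat (k * (k - 1) / 2).

Lemma tri_spec (k : Z) : (2 * Z.of_nat (tri k) = k * (k - 1))%Z.
Proof.
  unfold tri.
  assert (H : exists m, (k * (k - 1) = m * 2)%Z).
  { destruct (Z.Even_or_Odd k) as [[m ->] | [m ->]].
    - exists (m * (2 * m - 1))%Z. ring.
    - exists ((2 * m + 1) * m)%Z. ring. }
  destruct H as [m Hm]. rewrite Hm, Z.div_mul by lia.
  assert (0 <= m)%Z by nia. lia.
Qed.

Definition sgn (k : Z) : C := if Z.even k then 1 else - (1).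

Lemma sgn_succ (k : Z) : sgn (k + 1) = - sgn k.
Proof.
  unfold sgn. rewrite Z.even_add. change (Z.even 1) with false.
  destruct (Z.even k); simpl; ring.
Qed.

Lemma sgn_pred (k : Z) : sgn (k - 1) = - sgn k.
Proof.
  unfold sgn. rewrite Z.even_sub. change (Z.even 1) with false.
  destruct (Z.even k); simpl; ring.
Qed.

Section Triple.
Variable p : C.
Hypothesis Hp : Cmod p < 1.

(** This is (p;p)_m; [gauss_coef N k] below is then the Gaussian binomial coefficient of 2N over N +
    k in base p. *)
Definition qfact (m : nat) : C := Cprod (fun i => 1 - p ^ S i) m.
(** The value 0 at negative arguments makes the coefficients vanish for |k| > N, so [theta_coef_rec]
    holds for all integers k. *)
Definition inv_qfact (z : Z) : C := if (z <? 0)%Z then 0 else / qfact (Z.to_nat z).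
Definition gauss_coef (N : nat) (k : Z) : C := qfact (2 * N) * inv_qfact (Z.of_nat N + k) * inv_qfact (Z.of_nat N - k).
Definition theta_coef (N : nat) (k : Z) : C := sgn k * p ^ tri k * gauss_coef N k.

Lemma one_minus_pow (i : nat) : 1 - p ^ S i <> 0.
Proof.
  intros E. assert (K : p ^ S i = 1) by (transitivity (1 - (1 - p ^ S i)); [ring | rewrite E; ring]).
  apply (f_equal Cmod) in K. rewrite Cmod_pow, Cmod_1 in K.
  assert (G := Cmod_ge_0 p).
  assert (L : Cmod p ^ S i <= Cmod p).
  { assert (Cmod p ^ i <= 1) by (rewrite <- (pow1 i); apply pow_incr; lra). simpl. nra. }
  lra.
Qed.

Lemma qfact_nz (m : nat) : qfact m <> 0.
Proof.
  unfold qfact. induction m as [|m IH]; cbn [Cprod]; [apply C1_neq_0|].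
  apply Cmult_neq_0; auto using one_minus_pow.
Qed.

Lemma inv_qfact_nat (m : nat) : inv_qfact (Z.of_nat m) = / qfact m.
Proof.
  unfold inv_qfact. destruct (Z.ltb_spec (Z.of_nat m) 0); [lia|]. now rewrite Nat2Z.id.
Qed.

Lemma inv_qfact_neg (z : Z) : (z < 0)%Z -> inv_qfact z = 0.
Proof. intros H. unfold inv_qfact. destruct (Z.ltb_spec z 0); [reflexivity | lia]. Qed.

Lemma gauss_coef_supp (N : nat) (k : Z) : (Z.of_nat N < Z.abs k)%Z -> gauss_coef N k = 0.
Proof.
  intros H. unfold gauss_coef. destruct (Z_lt_le_dec k 0).
  - rewrite (inv_qfact_neg (Z.of_nat N + k)) by lia. ring.
  - rewrite (inv_qfact_neg (Z.of_nat N - k)) by lia. ring.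
Qed.

Lemma theta_coef_supp (N : nat) (k : Z) : (Z.of_nat N < Z.abs k)%Z -> theta_coef N k = 0.
Proof. intros H. unfold theta_coef. rewrite gauss_coef_supp by auto. ring. Qed.

(** Comparison of coefficients of x^k when the next pair of factors, 1 + p^(2N+1) - p^N x - p^(N+1)
    / x, is multiplied in. *)
Lemma theta_coef_rec (N : nat) (k : Z) :
  theta_coef (S N) k = (1 + p ^ (2 * N + 1)) * theta_coef N k - p ^ N * theta_coef N (k - 1) - p ^ S N * theta_coef N (k + 1).
Proof.
  destruct (Z_lt_le_dec (Z.of_nat (S N)) (Z.abs k)) as [H|H].
  { rewrite !theta_coef_supp by lia. ring. }
  assert (Ha : exists a b : nat, Z.of_nat a = (Z.of_nat (S N) + k)%Z /\ Z.of_nat b = (Z.of_nat (S N) - k)%Z).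
  { exists (Z.to_nat (Z.of_nat (S N) + k)), (Z.to_nat (Z.of_nat (S N) - k)). lia. }
  destruct Ha as (a & b & Ha & Hb).
  assert (t0 := tri_spec k). assert (t1 := tri_spec (k - 1)). assert (t2 := tri_spec (k + 1)).
  assert (E1 : (N + tri (k - 1) = tri k + b)%nat) by nia.
  assert (E2 : (S N + tri (k + 1) = tri k + a)%nat) by nia.
  assert (F1 : p ^ N * p ^ tri (k - 1) = p ^ tri k * p ^ b) by (rewrite <- !Cpow_add_r; f_equal; lia).
  assert (F2 : p ^ S N * p ^ tri (k + 1) = p ^ tri k * p ^ a) by (rewrite <- !Cpow_add_r; f_equal; lia).
  unfold theta_coef. rewrite sgn_succ, sgn_pred.
  transitivity (sgn k * p ^ tri k * ((1 + p ^ (2 * N + 1)) * gauss_coef N k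
      + p ^ b * gauss_coef N (k - 1) + p ^ a * gauss_coef N (k + 1))).
  2:{ transitivity (sgn k * ((1 + p ^ (2 * N + 1)) * p ^ tri k * gauss_coef N k
        + (p ^ tri k * p ^ b) * gauss_coef N (k - 1) + (p ^ tri k * p ^ a) * gauss_coef N (k + 1))).
      - generalize (p ^ (2 * N + 1)) (p ^ tri k) (p ^ a) (p ^ b). intros. ring.
      - rewrite <- F1, <- F2.
        generalize (p ^ (2 * N + 1)) (p ^ tri k) (p ^ N) (p ^ S N) (p ^ tri (k - 1)) (p ^ tri (k + 1)).
        intros. ring. }
  f_equal. unfold gauss_coef. clear t0 t1 t2 E1 E2 F1 F2.
  replace (2 * S N)%nat with (S (S (2 * N))) by lia.
  rewrite <- Ha, <- Hb, !inv_qfact_nat.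
  assert (n0 := qfact_nz (2 * N)).
  (* a = 0 and b = 0 are the extreme exponents k = -(N+1) and k = N+1, where a single term survives
     on the right. *)
  destruct a as [|a]; [|destruct b as [|b]].
  - replace b with (S (S (2 * N))) by lia.
    rewrite (inv_qfact_neg (Z.of_nat N + k)), (inv_qfact_neg (Z.of_nat N + (k - 1))) by lia.
    replace (Z.of_nat N + (k + 1))%Z with (Z.of_nat 0) by lia.
    replace (Z.of_nat N - (k + 1))%Z with (Z.of_nat (2 * N)) by lia.
    rewrite !inv_qfact_nat. assert (n1 := qfact_nz (S (S (2 * N)))).
    change (qfact 0) with (RtoC 1). change (p ^ 0) with (RtoC 1). field. auto using C1_neq_0.
  - replace (S a) with (S (S (2 * N))) by lia.
    rewrite (inv_qfact_neg (Z.of_nat N - k)), (inv_qfact_neg (Z.of_nat N - (k + 1))) by lia.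
    replace (Z.of_nat N - (k - 1))%Z with (Z.of_nat 0) by lia.
    replace (Z.of_nat N + (k - 1))%Z with (Z.of_nat (2 * N)) by lia.
    rewrite !inv_qfact_nat. assert (n1 := qfact_nz (S (S (2 * N)))).
    change (qfact 0) with (RtoC 1). change (p ^ 0) with (RtoC 1). field. auto using C1_neq_0.
  - replace (Z.of_nat N + k)%Z with (Z.of_nat a) by lia.
    replace (Z.of_nat N - k)%Z with (Z.of_nat b) by lia.
    replace (Z.of_nat N - (k - 1))%Z with (Z.of_nat (S b)) by lia.
    replace (Z.of_nat N + (k + 1))%Z with (Z.of_nat (S a)) by lia.
    rewrite !inv_qfact_nat.
    assert (HA : inv_qfact (Z.of_nat N + (k - 1)) = (1 - p ^ a) * / qfact a).
    { destruct a as [|a].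
      - rewrite inv_qfact_neg by lia. simpl. ring.
      - replace (Z.of_nat N + (k - 1))%Z with (Z.of_nat a) by lia. rewrite inv_qfact_nat.
        unfold qfact at 2. cbn [Cprod]. fold (qfact a). field.
        split; [apply one_minus_pow | apply qfact_nz]. }
    assert (HB : inv_qfact (Z.of_nat N - (k + 1)) = (1 - p ^ b) * / qfact b).
    { destruct b as [|b].
      - rewrite inv_qfact_neg by lia. simpl. ring.
      - replace (Z.of_nat N - (k + 1))%Z with (Z.of_nat b) by lia. rewrite inv_qfact_nat.
        unfold qfact at 2. cbn [Cprod]. fold (qfact b). field.
        split; [apply one_minus_pow | apply qfact_nz]. }
    rewrite HA, HB.
    assert (EAB : p ^ (2 * N) = p ^ a * p ^ b) by (rewrite <- Cpow_add_r; f_equal; lia).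
    assert (Sx : forall m, qfact (S m) = qfact m * (1 - p * p ^ m)) by reflexivity.
    rewrite !Sx.
    assert (na := qfact_nz a). assert (nb := qfact_nz b).
    assert (ma := one_minus_pow a). assert (mb := one_minus_pow b). simpl in ma, mb.
    replace (p ^ (2 * N + 1)) with (p * (p ^ a * p ^ b))
      by (rewrite <- EAB, Nat.add_1_r; reflexivity).
    change (p ^ S (2 * N)) with (p * p ^ (2 * N)).
    change (p ^ S a) with (p * p ^ a). change (p ^ S b) with (p * p ^ b).
    rewrite EAB.
    revert na nb ma mb n0.
    generalize (qfact a) (qfact b) (p ^ a) (p ^ b) (qfact (2 * N)). intros.
    field. auto.
Qed.

Lemma triple_product (N : nat) (x : C) : x <> 0 ->
  Eprod N x p = symsum (fun k => theta_coef N k * Cpowz x k) N.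
Proof.
  intros Hx. induction N as [|N IH].
  - unfold theta_coef, gauss_coef, sgn, tri, inv_qfact, qfact. simpl. field.
  - set (f := fun k => theta_coef N k * Cpowz x k) in *.
    assert (Hf : supported f N). { intros k Hk. unfold f. rewrite theta_coef_supp by auto. ring. }
    transitivity (symsum (fun k => (1 + p ^ (2 * N + 1)) * f k
       + ((- (p ^ N * x)) * f (k + -1)%Z + (- (p ^ S N / x)) * f (k + 1)%Z)) (S N)).
    + rewrite symsum_Isum, !Zsum_plus, !Zsum_scal, !Zsum_shift.
      rewrite !(Zsum_supp f N) by (auto; lia). rewrite <- IH. simpl Eprod.
      replace (p ^ (2 * N + 1)) with (p ^ N * p ^ S N) by (rewrite <- Cpow_add_r; f_equal; lia).
      simpl. field. auto.
    + apply symsum_ext. intros k _. rewrite theta_coef_rec. unfold f.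
      change (k + -1)%Z with (k - 1)%Z.
      rewrite Cpowz_succ, Cpowz_pred by auto. field. auto.
Qed.

Lemma Cprod_qfact_near (k : nat) : Cmod (1 - p ^ S k - 1) <= 1 * Cmod p ^ k.
Proof.
  replace (1 - p ^ S k - 1) with (- p ^ S k) by ring. rewrite Cmod_opp, Cmod_pow.
  assert (G := Cmod_ge_0 p). assert (K := pow_le (Cmod p) k G). simpl. nra.
Qed.

Lemma Ccv_bounded (u : nat -> C) (l : C) : Ccv u l -> exists K, 0 <= K /\ forall n, Cmod (u n) <= K.
Proof.
  rewrite Ccv_Cmod. intros H. destruct (H 1%R ltac:(lra)) as [N HN].
  assert (F : exists K, 0 <= K /\ forall n, (n < N)%nat -> Cmod (u n) <= K).
  { clear HN. induction N as [|N (K & K0 & IH)].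
    - exists 0%R. split; [lra | intros; lia].
    - exists (Rmax K (Cmod (u N))). split.
      + eapply Rle_trans; [exact K0 | apply Rmax_l].
      + intros n Hn. destruct (Nat.eq_dec n N) as [->|E]; [apply Rmax_r|].
        eapply Rle_trans; [apply IH; lia | apply Rmax_l]. }
  destruct F as (K & K0 & HK). exists (K + (Cmod l + 1))%R.
  assert (L0 := Cmod_ge_0 l). split; [lra|].
  intros n. destruct (Nat.lt_ge_cases n N) as [L|L].
  - specialize (HK n L). lra.
  - specialize (HN n L). assert (T := Cmod_triangle (u n - l) l).
    replace (u n - l + l) with (u n) in T by ring. lra.
Qed.

Lemma Ccv_shift (u : nat -> C) (l : C) (v : nat -> nat) (N : nat) :
  (forall n, (N <= n)%nat -> (n - N <= v n)%nat) -> Ccv u l -> Ccv (fun n => u (v n)) l.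
Proof.
  rewrite !Ccv_Cmod. intros Hv H eps He. destruct (H eps He) as [M HM].
  exists (N + M)%nat. intros n Hn. apply HM. specialize (Hv n). lia.
Qed.

(** The limit is 1 / (p;p)_infinity for every k; the common bound becomes the majorant in
    [tannery2]. *)
Lemma gauss_coef_limit : exists (K : R) (c : C), 0 <= K /\
  (forall N k, Cmod (gauss_coef N k) <= K) /\ (forall k, Ccv (fun N => gauss_coef N k) c).
Proof.
  destruct (Cprod_cv (fun i => 1 - p ^ S i) 1 (Cmod p)) as [l Hl].
  { split; auto using Cmod_ge_0. } { lra. } { apply Cprod_qfact_near. }
  assert (l0 : l <> 0).
  { apply (Cprod_lim_neq0 (fun i => 1 - p ^ S i) 1 (Cmod p)); auto using one_minus_pow, Cprod_qfact_near.
    split; auto using Cmod_ge_0. lra. }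
  change (Ccv qfact l) in Hl.
  assert (Hi := Ccv_inv _ _ l0 Hl).
  destruct (Ccv_bounded _ _ Hl) as (K1 & K10 & HK1).
  destruct (Ccv_bounded _ _ Hi) as (K2 & K20 & HK2).
  assert (Hpin : forall z, Cmod (inv_qfact z) <= K2).
  { intros z. unfold inv_qfact. destruct (z <? 0)%Z; auto. now rewrite Cmod_0. }
  exists (K1 * K2 * K2)%R, (l * / l * / l). split; [|split].
  - repeat apply Rmult_le_pos; auto.
  - intros N k. unfold gauss_coef. rewrite !Cmod_mult.
    repeat apply Rmult_le_compat; auto using Cmod_ge_0, Rmult_le_pos.
  - intros k. unfold gauss_coef. apply Ccv_mult; [apply Ccv_mult|].
    + apply (Ccv_shift qfact l _ 0); auto. intros; lia.
    + apply (Ccv_ext (fun N => / qfact (Z.to_nat (Z.of_nat N + k))) _ _ (Z.abs_nat k)).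
      * intros n Hn. rewrite <- inv_qfact_nat, Z2Nat.id by lia. reflexivity.
      * apply (Ccv_shift (fun n => / qfact n) _ _ (Z.abs_nat k)); auto. intros; lia.
    + apply (Ccv_ext (fun N => / qfact (Z.to_nat (Z.of_nat N - k))) _ _ (Z.abs_nat k)).
      * intros n Hn. rewrite <- inv_qfact_nat, Z2Nat.id by lia. reflexivity.
      * apply (Ccv_shift (fun n => / qfact n) _ _ (Z.abs_nat k)); auto. intros; lia.
Qed.

Lemma gauss_bound (r T : R) : 0 <= r < 1 -> 0 <= T ->
  exists B, 0 <= B /\ forall n, r ^ (n * (n - 1)) * T ^ n <= B.
Proof.
  intros Hr HT.
  set (w := fun n => (r ^ (n * (n - 1)) * T ^ n)%R).
  assert (w0 : forall n, 0 <= w n).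
  { intros n. unfold w. apply Rmult_le_pos; apply pow_le; lra. }
  (* Consecutive values have quotient r^(2n) T, which is at most 1 once r^n < 1 / (T + 1). *)
  destruct (pow_lt_1_zero r ltac:(rewrite Rabs_right; lra) (/ (T + 1))) as [N HN].
  { apply Rinv_0_lt_compat. lra. }
  assert (step : forall n, (N <= n)%nat -> w (S n) <= w n).
  { intros n Hn. unfold w.
    replace (S n * (S n - 1))%nat with (n * (n - 1) + (n + n))%nat by (destruct n; simpl; lia).
    rewrite !pow_add. simpl.
    assert (A := HN n Hn). rewrite Rabs_right in A by (apply Rle_ge, pow_le; lra).
    assert (Q0 := pow_le r n ltac:(lra)).
    assert (Q1 : r ^ n <= 1) by (rewrite <- (pow1 n); apply pow_incr; lra).
    assert (Q2 : r ^ n * r ^ n * T <= 1).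
    { assert (A' : r ^ n * (T + 1) <= 1).
      { apply Rle_trans with (/ (T + 1) * (T + 1))%R; [apply Rmult_le_compat_r; lra|].
        right. field. lra. }
      apply Rle_trans with (1 * (r ^ n * T))%R; [|nra].
      rewrite Rmult_assoc. apply Rmult_le_compat_r; auto. now apply Rmult_le_pos. }
    assert (P0 := pow_le r (n * (n - 1)) ltac:(lra)). assert (P1 := pow_le T n HT).
    replace (r ^ (n * (n - 1)) * (r ^ n * r ^ n) * (T * T ^ n))%R with
      ((r ^ n * r ^ n * T) * (r ^ (n * (n - 1)) * T ^ n))%R by ring.
    assert (0 <= r ^ (n * (n - 1)) * T ^ n) by now apply Rmult_le_pos. nra. }
  assert (F : exists K, 0 <= K /\ forall n, (n <= N)%nat -> w n <= K).
  { clear step HN. induction N as [|N (K & K0 & IH)].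
    - exists (w 0%nat). split; auto. intros n Hn. replace n with 0%nat by lia. lra.
    - exists (Rmax K (w (S N))). split.
      + eapply Rle_trans; [exact K0 | apply Rmax_l].
      + intros n Hn. destruct (Nat.eq_dec n (S N)) as [->|E]; [apply Rmax_r|].
        eapply Rle_trans; [apply IH; lia | apply Rmax_l]. }
  destruct F as (K & K0 & HK). exists K. split; auto.
  assert (G : forall d, w (N + d)%nat <= K).
  { induction d as [|d IH]; [rewrite Nat.add_0_r; auto|].
    rewrite Nat.add_succ_r. eapply Rle_trans; [apply step; lia | exact IH]. }
  intros n. fold (w n). destruct (Nat.le_ge_cases n N); auto.
  replace n with (N + (n - N))%nat by lia. apply G.
Qed.

(** * Theta series and the rank-two expansion of E(xy) E(x/y) *)

Definition theta_term (e : Z -> nat) (X : C) (u : Z) : C := p ^ e u * Cpowz X u.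
Definition theta_series (e : Z -> nat) (X : C) : C :=
  @lim C_CompleteNormedModule (filtermap (symsum (theta_term e X)) eventually).

Lemma Cpowz_bound (X : C) (u : Z) : X <> 0 ->
  Cmod (Cpowz X u) <= (Cmod X + Cmod (/ X)) ^ Z.abs_nat u.
Proof.
  intros HX. assert (X0 := Cmod_ge_0 X). assert (Y0 := Cmod_ge_0 (/ X)).
  destruct (Z_nat_cases u) as [n [-> | ->]].
  - rewrite Cpowz_nat, Zabs2Nat.id, Cmod_pow. apply pow_incr. lra.
  - rewrite Cpowz_neg. replace (Z.abs_nat (- Z.of_nat (S n))) with (S n) by lia.
    rewrite <- Cpow_inv by auto. rewrite Cmod_pow. apply pow_incr. lra.
Qed.

(** One B serves all three exponents u^2 - u, u^2, u^2 + u, each being at least |u| (|u| - 1); the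
    factor 2^|u| is absorbed by the Gaussian decay. *)
Lemma theta_term_bound (X : C) : X <> 0 -> exists B, 0 <= B /\
  forall e : Z -> nat, (forall u, (Z.abs u * (Z.abs u - 1) <= Z.of_nat (e u))%Z) ->
  forall u, Cmod (theta_term e X u) <= B / 2 ^ Z.abs_nat u.
Proof.
  intros HX. set (T := (Cmod X + Cmod (/ X))%R).
  assert (X0 := Cmod_ge_0 X). assert (Y0 := Cmod_ge_0 (/ X)). assert (P0 := Cmod_ge_0 p).
  destruct (gauss_bound (Cmod p) (2 * T)) as (B & B0 & HB); [lra | unfold T; lra |].
  exists B. split; auto. intros e He u. unfold theta_term.
  rewrite Cmod_mult, Cmod_pow.
  set (n := Z.abs_nat u). assert (HBn := HB n).
  assert (Hn : (n * (n - 1) <= e u)%nat) by (specialize (He u); unfold n; nia).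
  assert (D : 0 < 2 ^ n) by (apply pow_lt; lra).
  apply Rmult_le_reg_r with (2 ^ n)%R; auto.
  replace (B / 2 ^ n * 2 ^ n)%R with B by (field; lra).
  eapply Rle_trans; [|exact HBn].
  rewrite Rpow_mult_distr, Rmult_assoc, (Rmult_comm (2 ^ n)).
  apply Rmult_le_compat.
  - now apply pow_le.
  - apply Rmult_le_pos; [apply Cmod_ge_0 | lra].
  - replace (e u) with (n * (n - 1) + (e u - n * (n - 1)))%nat by lia. rewrite pow_add.
    rewrite <- (Rmult_1_r (Cmod p ^ (n * (n - 1)))) at 2. apply Rmult_le_compat_l; [now apply pow_le|].
    rewrite <- (pow1 (e u - n * (n - 1))). apply pow_incr. lra.
  - apply Rmult_le_compat_r; [lra|]. now apply Cpowz_bound.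
Qed.

Lemma theta_series_cv (e : Z -> nat) (X : C) : X <> 0 ->
  (forall u, (Z.abs u * (Z.abs u - 1) <= Z.of_nat (e u))%Z) -> Ccv (symsum (theta_term e X)) (theta_series e X).
Proof.
  intros HX He. destruct (theta_term_bound X HX) as (B & B0 & HB).
  destruct (symsum_cv B B0 (theta_term e X) (HB e He)) as [l Hl].
  unfold theta_series. now rewrite (Ccv_lim _ _ Hl).
Qed.

Definition e_minus (u : Z) : nat := Z.to_nat (u * u - u).
Definition e_sq (u : Z) : nat := Z.to_nat (u * u).
Definition e_plus (u : Z) : nat := Z.to_nat (u * u + u).

(* Multiply the two triple products and rotate the lattice of summation: the quadratic exponents decouple. *)
Lemma Eth_bilinear : exists c : C, forall x y : C, x <> 0 -> y <> 0 ->
  Eth (x * y) p * Eth (x / y) p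
  = c * (theta_series e_minus (x * x) * theta_series e_sq (y * y))
    - c * (x * y * (theta_series e_sq (x * x) * theta_series e_plus (y * y))).
Proof.
  destruct gauss_coef_limit as (K & c & K0 & HK & Hc). exists (c * c). intros x y Hx Hy.
  assert (Hxy : x * y <> 0) by now apply Cmult_neq_0.
  assert (Hxy' : x / y <> 0).
  { intros E. apply Hx. transitivity (x / y * y); [now field | rewrite E; ring]. }
  assert (Hxx : x * x <> 0) by now apply Cmult_neq_0.
  assert (Hyy : y * y <> 0) by now apply Cmult_neq_0.
  assert (L := Ccv_mult _ _ _ _ (Eth_cv (x * y) p Hp) (Eth_cv (x / y) p Hp)).
  apply (Ccv_unique _ _ _ L). clear L.
  set (h := fun N m n => theta_coef N m * Cpowz (x * y) m * (theta_coef N n * Cpowz (x / y) n)).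
  apply (Ccv_ext (fun N => symsum (fun u => symsum (fun v => h N (u + v)%Z (u - v)%Z) N) N
                       + symsum (fun u => symsum (fun v => h N (u + v + 1)%Z (u - v)%Z) N) N) _ _ 0).
  { intros N _. rewrite <- symsum_rotate.
    - rewrite !triple_product by auto. rewrite Cmult_comm, <- symsum_scal. apply symsum_ext. intros m _.
      rewrite Cmult_comm, <- symsum_scal. apply symsum_ext. intros n _. unfold h. ring.
    - intros m n [H|H]; unfold h; rewrite (theta_coef_supp _ _ H); ring. }
  assert (HKK : forall N a b, Cmod (gauss_coef N a * gauss_coef N b) <= K * K).
  { intros. rewrite Cmod_mult. apply Rmult_le_compat; auto using Cmod_ge_0. }
  destruct (theta_term_bound (x * x) Hxx) as (B1 & B10 & HB1).
  destruct (theta_term_bound (y * y) Hyy) as (B2 & B20 & HB2).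
  assert (up : forall B' B'' t n, B' <= B'' -> t <= B' / 2 ^ n -> t <= B'' / 2 ^ n).
  { intros B' B'' t n HB Ht. eapply Rle_trans; [exact Ht|]. apply Rmult_le_compat_r; auto.
    left. apply Rinv_0_lt_compat, pow_lt. lra. }
  assert (em : forall u, (Z.abs u * (Z.abs u - 1) <= Z.of_nat (e_minus u))%Z)
    by (intros; unfold e_minus; rewrite Z2Nat.id; nia).
  assert (es : forall u, (Z.abs u * (Z.abs u - 1) <= Z.of_nat (e_sq u))%Z)
    by (intros; unfold e_sq; rewrite Z2Nat.id; nia).
  assert (ep : forall u, (Z.abs u * (Z.abs u - 1) <= Z.of_nat (e_plus u))%Z)
    by (intros; unfold e_plus; rewrite Z2Nat.id; nia).
  assert (M1 := Rmax_l B1 B2). assert (M2 := Rmax_r B1 B2).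
  apply Ccv_plus.
  - apply (Ccv_ext (fun N => symsum (fun u => symsum (fun v => (gauss_coef N (u + v) * gauss_coef N (u - v))
       * (theta_term e_minus (x * x) u * theta_term e_sq (y * y) v)) N) N) _ _ 0).
    { intros N _. apply symsum_ext; intros u _. apply symsum_ext; intros v _. unfold h, theta_coef, theta_term.
      (* On this coset the exponents of p add up to (u^2 - u) + v^2. *)
      assert (S1 : sgn (u + v) * sgn (u - v) = 1).
      { unfold sgn. rewrite Z.even_add, Z.even_sub. destruct (Z.even u), (Z.even v); simpl; ring. }
      assert (T1 : p ^ tri (u + v) * p ^ tri (u - v) = p ^ e_minus u * p ^ e_sq v).
      { rewrite <- !Cpow_add_r. f_equal. assert (t1 := tri_spec (u + v)). assert (t2 := tri_spec (u - v)).
        unfold e_minus, e_sq. nia. }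
      assert (C1 : Cpowz (x * y) (u + v) * Cpowz (x / y) (u - v) = Cpowz (x * x) u * Cpowz (y * y) v).
      { replace (u - v)%Z with (u + - v)%Z by lia. rewrite Cpowz_div, !Cpowz_mul, !Cpowz_add by auto.
        assert (E0 : Cpowz y v * Cpowz y (- v) = 1) by (rewrite <- Cpowz_add, Z.add_opp_diag_r by auto; reflexivity).
        assert (E1 : Cpowz x v * Cpowz x (- v) = 1) by (rewrite <- Cpowz_add, Z.add_opp_diag_r by auto; reflexivity).
        assert (nu := Cpowz_nz y u Hy). assert (nv := Cpowz_nz y (- v) Hy).
        transitivity (Cpowz x u * Cpowz x u * Cpowz y v * (Cpowz x v * Cpowz x (- v)) / Cpowz y (- v)).
        - field. auto.
        - rewrite E1. transitivity (Cpowz x u * Cpowz x u * Cpowz y v * (Cpowz y v * Cpowz y (- v)) / Cpowz y (- v)).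
          + rewrite E0. field. auto.
          + field. auto. }
      symmetry. transitivity (gauss_coef N (u + v) * gauss_coef N (u - v) * ((p ^ e_minus u * p ^ e_sq v) * (Cpowz (x * x) u * Cpowz (y * y) v))).
      { rewrite <- T1, <- C1. revert S1.
        generalize (p ^ tri (u + v)) (p ^ tri (u - v)) (sgn (u + v)) (sgn (u - v)).
        intros a1 a2 a3 a4 S1. ring [S1]. }
      generalize (p ^ e_minus u) (p ^ e_sq v). intros; ring. }
    apply (tannery2 (K * K) (Rmax B1 B2)); auto using Rmult_le_pos, theta_series_cv.
    + eapply Rle_trans; [exact B10 | exact M1].
    + intros u v. apply Ccv_mult; auto.
    + intros u. apply (up B1); auto.
    + intros u. apply (up B2); auto.
  - replace (- (c * c * (x * y * (theta_series e_sq (x * x) * theta_series e_plus (y * y)))))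
      with (- (x * y) * (c * c * (theta_series e_sq (x * x) * theta_series e_plus (y * y)))) by ring.
    apply (Ccv_ext (fun N => - (x * y) * symsum (fun u => symsum (fun v => (gauss_coef N (u + v + 1) * gauss_coef N (u - v))
       * (theta_term e_sq (x * x) u * theta_term e_plus (y * y) v)) N) N) _ _ 0).
    { intros N _. rewrite <- symsum_scal. apply symsum_ext; intros u _. rewrite <- symsum_scal.
      apply symsum_ext; intros v _. unfold h, theta_coef, theta_term.
      (* On the other coset the sign is reversed, the exponents add up to u^2 + (v^2 + v), and a
         monomial x y is left over. *)
      assert (S1 : sgn (u + v + 1) * sgn (u - v) = - (1)).
      { rewrite sgn_succ. unfold sgn. rewrite Z.even_add, Z.even_sub. destruct (Z.even u), (Z.even v); simpl; ring. }
      assert (T1 : p ^ tri (u + v + 1) * p ^ tri (u - v) = p ^ e_sq u * p ^ e_plus v).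
      { rewrite <- !Cpow_add_r. f_equal. assert (t1 := tri_spec (u + v + 1)). assert (t2 := tri_spec (u - v)).
        unfold e_plus, e_sq. nia. }
      assert (C1 : Cpowz (x * y) (u + v + 1) * Cpowz (x / y) (u - v) = x * y * (Cpowz (x * x) u * Cpowz (y * y) v)).
      { rewrite Cpowz_succ by auto.
        replace (u - v)%Z with (u + - v)%Z by lia. rewrite Cpowz_div, !Cpowz_mul, !Cpowz_add by auto.
        assert (E0 : Cpowz y v * Cpowz y (- v) = 1) by (rewrite <- Cpowz_add, Z.add_opp_diag_r by auto; reflexivity).
        assert (E1 : Cpowz x v * Cpowz x (- v) = 1) by (rewrite <- Cpowz_add, Z.add_opp_diag_r by auto; reflexivity).
        assert (nu := Cpowz_nz y u Hy). assert (nv := Cpowz_nz y (- v) Hy).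
        transitivity (x * y * (Cpowz x u * Cpowz x u * Cpowz y v * (Cpowz x v * Cpowz x (- v)) / Cpowz y (- v))).
        - field. auto.
        - rewrite E1. transitivity (x * y * (Cpowz x u * Cpowz x u * Cpowz y v * (Cpowz y v * Cpowz y (- v)) / Cpowz y (- v))).
          + rewrite E0. field. auto.
          + field. auto. }
      symmetry. transitivity (- (1) * (gauss_coef N (u + v + 1) * gauss_coef N (u - v)) * ((p ^ e_sq u * p ^ e_plus v) * (x * y * (Cpowz (x * x) u * Cpowz (y * y) v)))).
      { rewrite <- T1, <- C1. revert S1.
        generalize (p ^ tri (u + v + 1)) (p ^ tri (u - v)) (sgn (u + v + 1)) (sgn (u - v)).
        intros a1 a2 a3 a4 S1. ring [S1]. }
      generalize (p ^ e_sq u) (p ^ e_plus v). intros; ring. }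
    apply Ccv_mult; [apply Ccv_const|].
    apply (tannery2 (K * K) (Rmax B1 B2)); auto using Rmult_le_pos, theta_series_cv.
    + eapply Rle_trans; [exact B10 | exact M1].
    + intros u v. apply Ccv_mult; auto.
    + intros u. apply (up B1); auto.
    + intros u. apply (up B2); auto.
Qed.
End Triple.

(** * The theta function in additive notation *)

Definition cexp (u : C) : C := (exp (fst u) * cos (snd u), exp (fst u) * sin (snd u))%R.

Lemma cexp_add (u v : C) : cexp (u + v) = cexp u * cexp v.
Proof.
  unfold cexp, Cmult; simpl. rewrite exp_plus, cos_plus, sin_plus.
  apply injective_projections; simpl; ring.
Qed.

Lemma cexp_0 : cexp 0 = 1.
Proof. unfold cexp; simpl. rewrite exp_0, cos_0, sin_0. apply injective_projections; simpl; ring. Qed.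

Lemma cexp_opp_l (u : C) : cexp (- u) * cexp u = 1.
Proof. rewrite <- cexp_add, <- cexp_0. f_equal. ring. Qed.

Lemma cexp_neq_0 (u : C) : cexp u <> 0.
Proof. intros E. assert (H := cexp_opp_l u). rewrite E, Cmult_0_r in H. now apply C1_neq_0. Qed.

Lemma cexp_opp (u : C) : cexp (- u) = / cexp u.
Proof.
  assert (H := cexp_opp_l u). assert (N := cexp_neq_0 u).
  transitivity (cexp (- u) * cexp u / cexp u); [now field | rewrite H; now field].
Qed.

Lemma cexp_sub (u v : C) : cexp (u - v) = cexp u / cexp v.
Proof. unfold Cminus. now rewrite cexp_add, cexp_opp. Qed.

Lemma cexp_pow (u : C) (n : nat) : cexp u ^ n = cexp (RtoC (INR n) * u).
Proof.
  induction n as [|n IH].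
  - simpl. rewrite Cmult_0_l. symmetry. apply cexp_0.
  - rewrite S_INR, RtoC_plus. simpl. rewrite IH, <- cexp_add. f_equal. ring.
Qed.

Lemma cexp_powz (u : C) (z : Z) : Cpowz (cexp u) z = cexp (RtoC (IZR z) * u).
Proof.
  destruct (Z_nat_cases z) as [n [-> | ->]].
  - now rewrite Cpowz_nat, cexp_pow, INR_IZR_INZ.
  - rewrite Cpowz_neg, cexp_pow, <- cexp_opp. f_equal.
    rewrite opp_IZR, RtoC_opp, <- INR_IZR_INZ. ring.
Qed.

Lemma cexp_real (t : R) : cexp (RtoC t) = RtoC (exp t).
Proof. unfold cexp, RtoC; simpl. rewrite cos_0, sin_0. f_equal; ring. Qed.

Lemma cexp_surj (z : C) : z <> 0 -> exists u, cexp u = z.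
Proof.
  intros Hz. assert (R0 : 0 < Cmod z) by now apply Cmod_gt_0.
  set (r := Cmod z) in *.
  assert (Hr : (fst z ^ 2 + snd z ^ 2 = r ^ 2)%R).
  { unfold r, Cmod. rewrite pow2_sqrt; nra. }
  set (x := (fst z / r)%R). set (y := (snd z / r)%R).
  assert (Hxy : (x ^ 2 + y ^ 2 = 1)%R).
  { unfold x, y. transitivity ((fst z ^ 2 + snd z ^ 2) / r ^ 2)%R; [|rewrite Hr]; field; lra. }
  assert (Hx : -1 <= x <= 1) by nra.
  assert (Hs : forall w, (w ^ 2 = y ^ 2)%R -> 0 <= w -> sqrt (1 - x²) = w).
  { intros w Hw W0. replace (1 - x²)%R with (w ^ 2)%R by (unfold Rsqr; nra).
    apply sqrt_pow2; auto. }
  assert (Hang : exists ang, cos ang = x /\ sin ang = y).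
  { destruct (Rle_lt_dec 0 y) as [Hy|Hy].
    - exists (acos x). split; [now apply cos_acos|]. rewrite sin_acos by auto. apply Hs; auto.
    - exists (- acos x)%R. rewrite cos_neg, sin_neg. split; [now apply cos_acos|].
      rewrite sin_acos by auto. rewrite (Hs (- y)%R); [ring | ring | lra]. }
  destruct Hang as (ang & H1 & H2).
  exists (ln r, ang). unfold cexp; simpl. rewrite exp_ln, H1, H2 by auto. unfold x, y.
  apply injective_projections; simpl; field; lra.
Qed.

Lemma Ccv_cexp (u : nat -> C) (l : C) : Ccv u l -> Ccv (fun n => cexp (u n)) (cexp l).
Proof.
  intros [H1 H2]. split; simpl; apply CV_mult.
  - apply (continuity_seq exp (fun n => fst (u n))); auto.
    apply derivable_continuous_pt, derivable_pt_exp.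
  - apply (continuity_seq cos (fun n => snd (u n))); auto.
    apply derivable_continuous_pt, derivable_pt_cos.
  - apply (continuity_seq exp (fun n => fst (u n))); auto.
    apply derivable_continuous_pt, derivable_pt_exp.
  - apply (continuity_seq sin (fun n => snd (u n))); auto.
    apply derivable_continuous_pt, derivable_pt_sin.
Qed.

Section SFun.
Variable p : C.
Hypothesis Hp : Cmod p < 1.

Definition sfun (u : C) : C := cexp (- u / 2) * Eth (cexp u) p.

Lemma C2_neq_0 : RtoC 2 <> 0.
Proof. intros K. apply RtoC_inj in K. lra. Qed.

Lemma Eth_sfun (u : C) : Eth (cexp u) p = cexp (u / 2) * sfun u.
Proof.
  unfold sfun. rewrite Cmult_assoc, <- cexp_add.
  replace (u / 2 + - u / 2) with (RtoC 0) by (field; apply C2_neq_0). rewrite cexp_0. ring.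
Qed.

Lemma sfun_odd (u : C) : sfun (- u) = - sfun u.
Proof.
  unfold sfun. rewrite (cexp_opp u).
  assert (H := Eth_inv p (cexp u) Hp (cexp_neq_0 u)).
  assert (N := cexp_neq_0 u).
  transitivity (cexp (- - u / 2) * (/ cexp u) * (cexp u * Eth (/ cexp u) p)); [now field|].
  rewrite H, <- cexp_opp, <- cexp_add.
  replace (- - u / 2 + - u) with (- u / 2) by (field; apply C2_neq_0). ring.
Qed.

(* [s (x+y) s (x-y)] is an antisymmetric kernel of rank two, so its Pfaffians vanish. *)
Lemma sfun_add (x y z w : C) :
  sfun (x + y) * sfun (x - y) * (sfun (z + w) * sfun (z - w))
  - sfun (x + z) * sfun (x - z) * (sfun (y + w) * sfun (y - w))
  + sfun (x + w) * sfun (x - w) * (sfun (y + z) * sfun (y - z)) = 0.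
Proof.
  destruct (Eth_bilinear p Hp) as [c Hc].
  set (G := fun x y => sfun (x + y) * sfun (x - y)).
  (* The two half-exponents combine to exp(-x), which depends on x alone, so rank two is
     preserved. *)
  assert (Hrank : exists a0 a1 b0 b1 : C -> C, forall x y, G x y = a0 x * b0 y + a1 x * b1 y).
  { exists (fun x => cexp (- x) * c * theta_series p e_minus (cexp x * cexp x)),
      (fun x => - (cexp (- x) * c * cexp x * theta_series p e_sq (cexp x * cexp x))),
      (fun y => theta_series p e_sq (cexp y * cexp y)), (fun y => cexp y * theta_series p e_plus (cexp y * cexp y)).
    intros x' y'. unfold G, sfun. rewrite cexp_sub, (cexp_add x' y').
    assert (H := Hc (cexp x') (cexp y') (cexp_neq_0 _) (cexp_neq_0 _)).
    transitivity (cexp (- (x' + y') / 2) * cexp (- (x' - y') / 2)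
      * (Eth (cexp x' * cexp y') p * Eth (cexp x' / cexp y') p)); [ring|].
    rewrite H, <- cexp_add.
    replace (- (x' + y') / 2 + - (x' - y') / 2) with (- x') by (field; apply C2_neq_0). ring. }
  destruct Hrank as (a0 & a1 & b0 & b1 & HG).
  assert (Hanti : forall x y, G y x = - G x y).
  { intros x' y'. unfold G. rewrite (Cplus_comm y').
    replace (y' - x') with (- (x' - y')) by ring. rewrite sfun_odd. ring. }
  assert (Hdiag : forall x, G x x = 0).
  { intros x'. assert (H := Hanti x' x').
    assert (K : RtoC 2 * G x' x' = 0).
    { transitivity (G x' x' + G x' x'); [ring|]. rewrite H at 1. ring. }
    destruct (Ceq_dec (G x' x') 0) as [E|E]; auto.
    exfalso. apply (Cmult_neq_0 _ _ C2_neq_0 E K). }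
  change (G x y * G z w - G x z * G y w + G x w * G y z = 0).
  set (P := G x y * G z w - G x z * G y w + G x w * G y z).
  (* P is the Pfaffian of the 4 x 4 matrix of values of G. The expression below is the determinant
     expanded along its first row: antisymmetry makes it P^2, rank two makes it 0. *)
  assert (HP : P * P = 0).
  { transitivity
     (G x x * (G y y * (G z z * G w w - G z w * G w z) - G y z * (G z y * G w w - G z w * G w y)
               + G y w * (G z y * G w z - G z z * G w y))
      - G x y * (G y x * (G z z * G w w - G z w * G w z) - G y z * (G z x * G w w - G z w * G w x)
               + G y w * (G z x * G w z - G z z * G w x))
      + G x z * (G y x * (G z y * G w w - G z w * G w y) - G y y * (G z x * G w w - G z w * G w x)
               + G y w * (G z x * G w y - G z y * G w x))
      - G x w * (G y x * (G z y * G w z - G z z * G w y) - G y y * (G z x * G w z - G z z * G w x)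
               + G y z * (G z x * G w y - G z y * G w x))).
    - rewrite !Hdiag, (Hanti x y), (Hanti x z), (Hanti x w), (Hanti y z), (Hanti y w), (Hanti z w).
      unfold P. ring.
    - rewrite !HG. ring. }
  destruct (Ceq_dec P 0) as [E|E]; auto. exfalso. now apply (Cmult_neq_0 P P).
Qed.

(** * Continuity of s and avoidance of its zeros on real lines *)

Lemma Ccv_sfun (u : nat -> C) (l : C) : Ccv u l -> Ccv (fun n => sfun (u n)) (sfun l).
Proof.
  intros H. unfold sfun. apply Ccv_mult.
  - apply Ccv_cexp. unfold Cdiv. apply Ccv_mult; [now apply Ccv_opp | apply Ccv_const].
  - apply (Ccv_Eth p (cexp l) (fun n => cexp (u n))); auto using cexp_neq_0, Ccv_cexp.
Qed.

(** Along a real line exp(u + t v) is exp((t - t0) v) times its value at t0, which is injective in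
    t; so isolation of the zeros of E in the plane gives isolation in t. *)
Lemma sfun_isolated (u : C) (v t0 : R) : v <> 0%R ->
  exists rho, 0 < rho /\ forall t, t <> t0 -> Rabs (t - t0) < rho -> sfun (u + RtoC (t * v)) <> 0.
Proof.
  intros Hv. set (x := cexp (u + RtoC (t0 * v))).
  assert (X0 : 0 < Cmod x) by (apply Cmod_gt_0, cexp_neq_0).
  destruct (Eth_isolated p x Hp (cexp_neq_0 _)) as (r & R0 & Hr).
  assert (Hc : continuity_pt exp 0) by (apply derivable_continuous_pt, derivable_pt_exp).
  destruct (Hc (r / Cmod x)%R) as (d & D0 & Hd); [now apply Rdiv_lt_0_compat|].
  assert (V0 : 0 < Rabs v) by now apply Rabs_pos_lt.
  exists (d / Rabs v)%R. split; [now apply Rdiv_lt_0_compat|].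
  intros t Ht Hlt.
  assert (Et : cexp (u + RtoC (t * v)) = x * RtoC (exp ((t - t0) * v))).
  { unfold x. rewrite <- cexp_real, <- cexp_add. f_equal.
    replace (t * v)%R with (t0 * v + (t - t0) * v)%R by ring. rewrite RtoC_plus. ring. }
  assert (Nz : ((t - t0) * v)%R <> 0%R) by (apply Rmult_integral_contrapositive; split; lra).
  unfold sfun. apply Cmult_neq_0; [apply cexp_neq_0|].
  apply Hr; [apply cexp_neq_0 | |]; rewrite Et.
  - intros E. apply Nz. apply exp_inv. rewrite exp_0. apply RtoC_inj.
    transitivity (/ x * (x * RtoC (exp ((t - t0) * v)))); [field; apply cexp_neq_0|].
    rewrite E. field. apply cexp_neq_0.
  - replace (x * RtoC (exp ((t - t0) * v)) - x) with (x * RtoC (exp ((t - t0) * v) - 1))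
      by (rewrite RtoC_minus; ring).
    rewrite Cmod_mult, Cmod_R.
    assert (L : Rabs (exp ((t - t0) * v) - 1) < r / Cmod x).
    { rewrite <- exp_0. apply (Hd ((t - t0) * v)%R). split.
      - split; [exact I | auto].
      - simpl. unfold R_dist. rewrite Rminus_0_r, Rabs_mult.
        apply Rlt_le_trans with (d / Rabs v * Rabs v)%R; [now apply Rmult_lt_compat_r|].
        right. field. lra. }
    apply Rlt_le_trans with (Cmod x * (r / Cmod x))%R; [now apply Rmult_lt_compat_l|].
    right. field. lra.
Qed.

Lemma avoid_step (u : C) (v a b : R) : a < b -> exists a' b', a <= a' /\ a' < b' /\ b' <= b /\
  forall t, a' <= t <= b' -> v <> 0%R -> sfun (u + RtoC (t * v)) <> 0.
Proof.
  intros Hab. destruct (Req_dec v 0) as [E|E].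
  - exists a, b. split; [lra|]. split; [lra|]. split; [lra|]. intros t _ K. now elim K.
  - destruct (sfun_isolated u v a E) as (r & R0 & Hr).
    (* Within distance r of a the only possible zero is a itself, so an interval strictly to the
       right of a is free of zeros. *)
    exists (a + Rmin r (b - a) / 3)%R, (a + Rmin r (b - a) / 2)%R.
    assert (M0 : 0 < Rmin r (b - a)) by (apply Rmin_pos; lra).
    assert (M1 := Rmin_l r (b - a)). assert (M2 := Rmin_r r (b - a)).
    split; [lra|]. split; [lra|]. split; [lra|].
    intros t Ht _. apply Hr; [lra|]. rewrite Rabs_right; lra.
Qed.

(* Nested intervals (a Baire argument), using that zeros are isolated on every real line. *)
Lemma avoid_countable (u : nat -> C) (v : nat -> R) (eps : R) : 0 < eps ->
  exists t, 0 < t < eps /\ forall m, v m <> 0%R -> sfun (u m + RtoC (t * v m)) <> 0.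
Proof.
  intros He.
  assert (step : forall m (I : {ab : R * R | fst ab < snd ab}),
    {J : {ab : R * R | fst ab < snd ab} |
      fst (proj1_sig I) <= fst (proj1_sig J) /\ snd (proj1_sig J) <= snd (proj1_sig I) /\
      forall t, fst (proj1_sig J) <= t <= snd (proj1_sig J) -> v m <> 0%R ->
        sfun (u m + RtoC (t * v m)) <> 0}).
  { intros m [[a b] Hab]. apply constructive_indefinite_description.
    destruct (avoid_step (u m) (v m) a b Hab) as (a' & b' & H1 & H2 & H3 & H4).
    exists (exist (fun ab => fst ab < snd ab) (a', b') H2). auto. }
  assert (H0 : fst (eps / 3, eps / 2)%R < snd (eps / 3, eps / 2)%R) by (simpl; lra).
  set (I := fix I m := match m with
     | O => exist (fun ab => fst ab < snd ab) (eps / 3, eps / 2)%R H0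
     | S m' => proj1_sig (step m' (I m')) end).
  set (lo := fun m => fst (proj1_sig (I m))). set (hi := fun m => snd (proj1_sig (I m))).
  assert (S1 : forall m, lo m <= lo (S m) /\ hi (S m) <= hi m /\
    forall t, lo (S m) <= t <= hi (S m) -> v m <> 0%R -> sfun (u m + RtoC (t * v m)) <> 0).
  { intros m. unfold lo, hi. simpl. exact (proj2_sig (step m (I m))). }
  assert (lohi : forall m, lo m < hi m) by (intros m; exact (proj2_sig (I m))).
  assert (mono : forall m d, lo m <= lo (m + d)%nat /\ hi (m + d)%nat <= hi m).
  { intros m d. induction d as [|d IH]; [rewrite Nat.add_0_r; lra|].
    rewrite Nat.add_succ_r. destruct (S1 (m + d)%nat) as (A & B & _). lra. }
  assert (cross : forall m n, lo m <= hi n).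
  { intros m n. assert (A := mono m n). assert (B := mono n m). rewrite (Nat.add_comm n m) in B.
    specialize (lohi (m + n)%nat). lra. }
  destruct (completeness (fun x => exists m, x = lo m)) as [t [U L]].
  - exists (hi 0%nat). intros x [m ->]. apply cross.
  - exists (lo 0%nat), 0%nat. reflexivity.
  - assert (T : forall m, lo m <= t <= hi m).
    { intros m. split; [apply U; now exists m|]. apply L. intros x [n ->]. apply cross. }
    exists t. split.
    + specialize (T 0%nat). unfold lo, hi in T. simpl in T. lra.
    + intros m Hm. destruct (S1 m) as (_ & _ & K). apply K; auto.
Qed.
End SFun.

(** * Very-well-poised sums over an odd function with a three-term relation *)
Lemma RtoC_INR_S (m : nat) : RtoC (INR (S m)) = RtoC (INR m) + 1.
Proof. now rewrite S_INR, RtoC_plus. Qed.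

Ltac lin_coef u x :=
  match u with
  | x => constr:(1%Z)
  | ?v + ?w => let c := lin_coef v x in let d := lin_coef w x in constr:((c + d)%Z)
  | ?v - ?w => let c := lin_coef v x in let d := lin_coef w x in constr:((c - d)%Z)
  | - ?v => let c := lin_coef v x in constr:((- c)%Z)
  | RtoC (IZR ?z) * ?v => let c := lin_coef v x in constr:((z * c)%Z)
  | _ => constr:(0%Z)
  end.

Ltac lin_vec u atoms :=
  match atoms with
  | nil => constr:(@nil Z)
  | ?x :: ?r => let c := lin_coef u x in let c := eval vm_compute in c in
                let cs := lin_vec u r in constr:(c :: cs)
  end.

Ltac lin_neg v := let w := eval vm_compute in (List.map Z.opp v) in w.

Ltac lin_sign v :=
  match v with
  | nil => constr:(true)
  | 0%Z :: ?r => lin_sign r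
  | Zpos _ :: _ => constr:(true)
  | Zneg _ :: _ => constr:(false)
  end.

Ltac lin_term v atoms :=
  match v with
  | nil => constr:(RtoC 0)
  | ?c :: ?cs => match atoms with ?x :: ?xs =>
      let r := lin_term cs xs in constr:(RtoC (IZR c) * x + r) end
  end.

(** Each argument of s becomes an integer combination of the atoms in fixed order with positive
    leading coefficient, oddness absorbing the sign. Then s(u) and s(-u) are one and the same atom
    for [field]. *)
Ltac s_norm s s_odd atoms :=
  repeat match goal with
  | |- context [s ?u] =>
      let v := lin_vec u atoms in
      let b := lin_sign v in
      match b with
      | true => let t := lin_term v atoms in
                tryif constr_eq u t then fail else
                replace (s u) with (s t) by (f_equal; ring)
      | false => let v := lin_neg v in let t := lin_term v atoms in
                 replace (s u) with (- s t) by (rewrite <- s_odd; f_equal; ring)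
      end
  end.

Section Odd.
Variable s : C -> C.
Hypothesis s_odd : forall u, s (- u) = - s u.
Hypothesis s_add : forall x y z w,
  s (x + y) * s (x - y) * (s (z + w) * s (z - w))
  - s (x + z) * s (x - z) * (s (y + w) * s (y - w))
  + s (x + w) * s (x - w) * (s (y + z) * s (y - z)) = 0.

Lemma s_0 : s 0 = 0.
Proof.
  assert (H := s_odd 0). replace (- RtoC 0) with (RtoC 0) in H by ring.
  assert (H2 : RtoC 2 * s 0 = 0).
  { transitivity (s 0 + - s 0); [rewrite <- H|]; ring. }
  destruct (Ceq_dec (s 0) 0) as [E|E]; auto.
  exfalso. apply (Cmult_neq_0 (RtoC 2) (s 0)); auto.
  intros K. apply RtoC_inj in K. lra.
Qed.

(** [s_add] at (A/2 + J, e - A/2, A/2, f - A/2). In this form e and A - e are partners as in a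
    well-poised series, and J stands for the shift by a multiple of h. *)
Lemma s_add3 (J A e f : C) :
  s (e + J) * s (A - e + J) * (s f * s (A - f))
  = s e * s (A - e) * (s (f + J) * s (A - f + J))
    + s J * s (A + J) * (s (e - f) * s (e + f - A)).
Proof.
  pose (a := A / RtoC 2).
  assert (h2 : RtoC 2 <> 0) by (intros K; apply RtoC_inj in K; lra).
  assert (hA : A = a + a) by (unfold a; field; auto).
  clearbody a. subst A.
  assert (H := s_add (a + J) (e - a) a (f - a)).
  revert H.
  s_norm s s_odd [a; J; e; f].
  intros H.
  match type of H with ?x = _ =>
    match goal with |- ?l = ?r =>
      replace l with (r + x) by ring; rewrite H; ring end end.
Qed.

(** * Shifted factorials and very-well-poised terms in additive notation *)

Fixpoint poch (x h : C) (m : nat) : C :=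
  match m with
  | O => 1
  | S m' => poch x h m' * s (x + RtoC (INR m') * h)
  end.

Definition pochs (l : list C) (h : C) (m : nat) : C :=
  fold_right (fun x acc => poch x h m * acc) (RtoC 1) l.

(** The k-th term of an omega series. The power Q^k is absent: under the balancing condition it
    cancels against the half-exponents contained in s. *)
Definition vwp (A : C) (l : list C) (h : C) (k : nat) : C :=
  s (A + RtoC 2 * (RtoC (INR k) * h)) / s A
  * pochs (A :: l) h k / pochs (h :: map (fun x => A + h - x) l) h k.

Lemma poch_l (x h : C) (m : nat) : poch x h (S m) = s x * poch (x + h) h m.
Proof.
  induction m as [|m IH].
  - simpl. replace (x + RtoC 0 * h) with x by ring. ring.
  - change (poch x h (S (S m))) with (poch x h (S m) * s (x + RtoC (INR (S m)) * h)).
    rewrite IH, RtoC_INR_S. simpl.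
    replace (x + (RtoC (INR m) + 1) * h) with (x + h + RtoC (INR m) * h) by ring. ring.
Qed.

Lemma poch_neq0 (x h : C) (m : nat) :
  (forall i : nat, (i < m)%nat -> s (x + RtoC (INR i) * h) <> 0) -> poch x h m <> 0.
Proof.
  induction m as [|m IH]; intros H; simpl.
  - intros K. apply RtoC_inj in K. lra.
  - apply Cmult_neq_0; [apply IH; intros; apply H; lia | apply H; lia].
Qed.

Definition sprod (l : list C) : C := fold_right (fun x acc => s x * acc) (RtoC 1) l.

Lemma pochs_l (l : list C) (h : C) (m : nat) :
  pochs l h (S m) = sprod l * pochs (map (fun x => x + h) l) h m.
Proof.
  unfold pochs, sprod. induction l as [|x l IH]; cbn [map fold_right]; [ring|].
  rewrite IH, poch_l. ring.
Qed.

Lemma pochs_neq0 (l : list C) (h : C) (m : nat) :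
  (forall x, In x l -> poch x h m <> 0) -> pochs l h m <> 0.
Proof.
  unfold pochs. induction l as [|x l IH]; intros H; cbn [fold_right].
  - intros K. apply RtoC_inj in K. lra.
  - apply Cmult_neq_0; [apply H; left; auto | apply IH; intros; apply H; right; auto].
Qed.

Lemma sprod_neq0 (l : list C) : (forall x, In x l -> s x <> 0) -> sprod l <> 0.
Proof.
  unfold sprod. induction l as [|x l IH]; intros H; cbn [fold_right].
  - intros K. apply RtoC_inj in K. lra.
  - apply Cmult_neq_0; [apply H; left; auto | apply IH; intros; apply H; right; auto].
Qed.

(** One condition on the whole coset x + Z h covers products of every length and is stable under the
    shifts by h made in the recursions. *)
Definition nonres (h x : C) : Prop := forall i : Z, s (x + RtoC (IZR i) * h) <> 0.

Lemma nonres_sp (h x : C) (m : nat) : nonres h x -> poch x h m <> 0.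
Proof. intros H. apply poch_neq0. intros i _. rewrite INR_IZR_INZ. apply H. Qed.

Lemma nonres_shift (h x y : C) (i : Z) : nonres h x -> y = x + RtoC (IZR i) * h -> nonres h y.
Proof.
  intros H -> j. replace (x + RtoC (IZR i) * h + RtoC (IZR j) * h)
    with (x + RtoC (IZR (i + j)) * h) by (rewrite plus_IZR, RtoC_plus; ring). apply H.
Qed.

Lemma nonres_opp (h x : C) : nonres h x -> nonres h (- x).
Proof.
  intros H i E. apply (H (- i)%Z).
  replace (x + RtoC (IZR (- i)) * h) with (- (- x + RtoC (IZR i) * h))
    by (rewrite opp_IZR, RtoC_opp; ring).
  rewrite s_odd, E. ring.
Qed.

Lemma nonres_s (h x y : C) (i : Z) : nonres h x -> y = x + RtoC (IZR i) * h -> s y <> 0.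
Proof. intros H ->. apply H. Qed.

Lemma poch_h_neq_0 (h : C) (m : nat) :
  (forall i : Z, (i <> 0)%Z -> s (RtoC (IZR i) * h) <> 0) -> poch h h m <> 0.
Proof.
  intros H. apply poch_neq0. intros i _.
  replace (h + RtoC (INR i) * h) with (RtoC (IZR (Z.of_nat (S i))) * h).
  - apply H. lia.
  - rewrite <- INR_IZR_INZ, RtoC_INR_S. ring.
Qed.

(** * The contiguous relation *)

Definition contig_coef (A h e f : C) (l : list C) : C :=
  sprod l / sprod (map (fun x => A + h - x) l)
  * (s (e - f + h) * s (e + f - h - A) * s (A + h) * s (A + 2 * h))
  / (s (A - e) * s (A + h - e) * s (A + h - f) * s (A + 2 * h - f)).

(* Both sides share all factors but two pairs, and [s_add3] relates what is left. *)
Lemma vwp_contig (A h e f : C) (l : list C) (j : nat) :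
  (forall i : Z, (i <> 0)%Z -> s (RtoC (IZR i) * h) <> 0) ->
  nonres h A -> nonres h (A - e) -> nonres h (A - f) ->
  (forall x, In x l -> nonres h (A - x)) ->
  vwp A (e + h :: f - h :: l) h (S j)
  = vwp A (e :: f :: l) h (S j)
    + contig_coef A h e f l
      * vwp (A + 2 * h) (e + h :: f :: map (fun x => x + h) l) h j.
Proof.
  intros Hh HA He Hf Hl.
  unfold vwp, contig_coef.
  cbn [map].
  assert (Eq : forall B : C, map (fun x => B + 2 * h + h - x) (map (fun x => x + h) l)
               = map (fun x => x + h) (map (fun x => B + h - x) l)).
  { intros B. rewrite !map_map. apply map_ext. intros x. ring. }
  rewrite Eq. clear Eq.
  change (forall x, In x l -> nonres h (A - x)) in Hl.
  unfold pochs. cbn [fold_right].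
  fold (pochs l h (S j)).
  fold (pochs (map (fun x => A + h - x) l) h (S j)).
  fold (pochs (map (fun x => x + h) l) h j).
  fold (pochs (map (fun x => x + h) (map (fun x => A + h - x) l)) h j).
  rewrite (pochs_l l), (pochs_l (map (fun x => A + h - x) l)).
  assert (n1 : sprod (map (fun x => A + h - x) l) <> 0).
  { apply sprod_neq0. intros y Hy. apply in_map_iff in Hy as (x & <- & Hx).
    apply (nonres_s h (A - x) _ 1 (Hl x Hx)). ring. }
  assert (n2 : pochs (map (fun x => x + h) (map (fun x => A + h - x) l)) h j <> 0).
  { apply pochs_neq0. intros y Hy. rewrite map_map in Hy.
    apply in_map_iff in Hy as (x & <- & Hx). apply nonres_sp.
    apply (nonres_shift h (A - x) _ 2 (Hl x Hx)). ring. }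
  set (L1 := sprod l). set (L2 := sprod (map _ l)) in *.
  set (P1 := pochs _ h j). set (P2 := pochs (map _ (map _ l)) h j) in *.
  clearbody L1 L2 P1 P2.
  set (J := RtoC (INR j) * h).
  assert (a1 : poch A h (S j) = s A * poch (A + h) h j) by apply poch_l.
  assert (a2 : poch (A + 2 * h) h j = poch (A + h) h j * s (A + h + J) / s (A + h)).
  { replace (A + 2 * h) with (A + h + h) by ring.
    assert (K := poch_l (A + h) h j). cbn [poch] in K. fold J in K.
    rewrite K. field. apply (nonres_s h A _ 1 HA). ring. }
  assert (a3 : poch (e + h) h (S j) = poch (e + h) h j * s (e + h + J)) by reflexivity.
  assert (a4 : poch e h (S j) = s e * poch (e + h) h j) by apply poch_l.
  assert (a5 : poch (f - h) h (S j) = s (f - h) * poch f h j).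
  { rewrite poch_l. repeat f_equal. ring. }
  assert (a6 : poch f h (S j) = poch f h j * s (f + J)) by reflexivity.
  assert (a7 : poch (A + h - (e + h)) h (S j) = s (A - e) * poch (A + h - e) h j).
  { rewrite poch_l. f_equal; f_equal; ring. }
  assert (a8 : poch (A + h - e) h (S j) = poch (A + h - e) h j * s (A + h - e + J)) by reflexivity.
  assert (a9 : poch (A + 2 * h + h - (e + h)) h j
               = poch (A + h - e) h j * s (A + h - e + J) / s (A + h - e)).
  { replace (A + 2 * h + h - (e + h)) with (A + h - e + h) by ring.
    assert (K := poch_l (A + h - e) h j). rewrite a8 in K. rewrite K.
    field. apply (nonres_s h (A - e) _ 1 He). ring. }
  assert (a10 : poch (A + h - (f - h)) h (S j)
                = poch (A + 2 * h - f) h j * s (A + 2 * h - f + J)).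
  { replace (A + h - (f - h)) with (A + 2 * h - f) by ring. reflexivity. }
  assert (a11 : poch (A + h - f) h (S j) = s (A + h - f) * poch (A + 2 * h - f) h j).
  { rewrite poch_l. do 2 f_equal. ring. }
  assert (a12 : poch (A + 2 * h + h - f) h j
                = poch (A + 2 * h - f) h j * s (A + 2 * h - f + J) / s (A + 2 * h - f)).
  { replace (A + 2 * h + h - f) with (A + 2 * h - f + h) by ring.
    assert (K := poch_l (A + 2 * h - f) h j).
    change (poch (A + 2 * h - f) h (S j)) with (poch (A + 2 * h - f) h j * s (A + 2 * h - f + J)) in K.
    rewrite K. field. apply (nonres_s h (A - f) _ 2 Hf). ring. }
  assert (a13 : poch h h (S j) = poch h h j * s (h + J)) by reflexivity.
  rewrite a1, a2, a3, a4, a5, a6, a7, a8, a9, a10, a11, a12, a13.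
  assert (m1 : poch h h j <> 0) by (apply poch_h_neq_0; auto).
  assert (m2 : poch (A + h - e) h j <> 0).
  { apply nonres_sp, (nonres_shift h (A - e) _ 1 He). ring. }
  assert (m3 : poch (A + 2 * h - f) h j <> 0).
  { apply nonres_sp, (nonres_shift h (A - f) _ 2 Hf). ring. }
  set (q1 := poch (A + h) h j). set (q2 := poch (e + h) h j). set (q3 := poch f h j).
  set (q4 := poch h h j) in *. set (q5 := poch (A + h - e) h j) in *.
  set (q6 := poch (A + 2 * h - f) h j) in *.
  clearbody q1 q2 q3 q4 q5 q6. clear a1 a2 a3 a4 a5 a6 a7 a8 a9 a10 a11 a12 a13.
  (* The shift J + h is (j + 1) h. The left side belongs to the term with e + h and f - h, the first
     product on the right to the one with e and f, and the second yields the s-values depending on e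
     and f in the numerator of [contig_coef]. *)
  assert (K := s_add3 (J + h) A e (f - h)).
  rewrite RtoC_INR_S. replace ((RtoC (INR j) + 1) * h) with (J + h) by (unfold J; ring).
  assert (b1 := HA 0%Z). assert (b2 := HA 1%Z). assert (b3 := HA 2%Z).
  assert (b4 := He 0%Z). assert (b5 := He 1%Z). assert (b6 := Hf 1%Z). assert (b7 := Hf 2%Z).
  assert (b8 : s (h + J) <> 0).
  { replace (h + J) with (RtoC (IZR (Z.of_nat (S j))) * h). apply Hh; lia.
    rewrite <- INR_IZR_INZ, RtoC_INR_S. unfold J. ring. }
  assert (b9 : s (A + h - e + J) <> 0).
  { apply (nonres_s h (A - e) _ (Z.of_nat (S j)) He).
    rewrite <- INR_IZR_INZ, RtoC_INR_S. unfold J. ring. }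
  assert (b10 : s (A + 2 * h - f + J) <> 0).
  { apply (nonres_s h (A - f) _ (Z.of_nat (S (S j))) Hf).
    rewrite <- INR_IZR_INZ, !RtoC_INR_S. unfold J. ring. }
  clearbody J.
  revert K b1 b2 b3 b4 b5 b6 b7 b8 b9 b10.
  s_norm s s_odd [A; h; e; f; J].
  repeat match goal with |- context [s ?u] => generalize (s u); intro end.

  intros K b1 b2 b3 b4 b5 b6 b7 b8 b9 b10.
  match type of K with ?x * ?y * (- ?z * ?w) = ?t =>
    assert (K' : x * y * z * w = - t) by (rewrite <- K; ring) end.
  clear K.
  field [K']. repeat split; auto.
Qed.

Lemma pochs_perm (l l' : list C) (h : C) (m : nat) :
  Permutation l l' -> pochs l h m = pochs l' h m.
Proof.
  unfold pochs. induction 1; cbn [fold_right]; try congruence; ring.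
Qed.

Lemma vwp_perm (A : C) (l l' : list C) (h : C) (k : nat) :
  Permutation l l' -> vwp A l h k = vwp A l' h k.
Proof.
  intros H. unfold vwp.
  rewrite (pochs_perm (A :: l) (A :: l')) by (constructor; auto).
  rewrite (pochs_perm (h :: map _ l) (h :: map (fun x => A + h - x) l')); [reflexivity|].
  constructor. now apply Permutation_map.
Qed.

Lemma pochs_0 (l : list C) (h : C) : pochs l h 0 = 1.
Proof. unfold pochs. induction l as [|x l IH]; cbn [fold_right]; [|rewrite IH; simpl poch]; ring. Qed.

Lemma vwp_0 (A : C) (l : list C) (h : C) : s A <> 0 -> vwp A l h 0 = 1.
Proof.
  intros H. unfold vwp. rewrite !pochs_0. simpl INR.
  replace (A + 2 * (RtoC 0 * h)) with A by ring. now field.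
Qed.

Lemma Csum_ext (N : nat) (F G : nat -> C) :
  (forall k, (k <= N)%nat -> F k = G k) -> Csum N F = Csum N G.
Proof.
  induction N as [|N IH]; intros H; simpl; [apply H; lia|].
  rewrite IH, H; auto.
Qed.

Lemma Csum_lin (N : nat) (F G : nat -> C) (B : C) :
  Csum N (fun k => F k + B * G k) = Csum N F + B * Csum N G.
Proof. induction N as [|N IH]; simpl; [ring|]. rewrite IH. ring. Qed.

Lemma Csum_S (N : nat) (F : nat -> C) :
  Csum (S N) F = F 0%nat + Csum N (fun k => F (S k)).
Proof.
  induction N as [|N IH]; [reflexivity|].
  change (Csum (S (S N)) F) with (Csum (S N) F + F (S (S N))).
  rewrite IH. simpl. ring.
Qed.

(** The terms of index 0 are both 1 and cancel; the difference at index j + 1 is the j-th term of a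
    series with leading parameter A + 2h. *)
Lemma sum_contig (A h e f : C) (l : list C) (N : nat) :
  (forall i : Z, (i <> 0)%Z -> s (RtoC (IZR i) * h) <> 0) ->
  nonres h A -> nonres h (A - e) -> nonres h (A - f) ->
  (forall x, In x l -> nonres h (A - x)) ->
  Csum (S N) (vwp A (e + h :: f - h :: l) h)
  = Csum (S N) (vwp A (e :: f :: l) h)
    + contig_coef A h e f l
      * Csum N (vwp (A + 2 * h) (e + h :: f :: map (fun x => x + h) l) h).
Proof.
  intros Hh HA He Hf Hl. rewrite !Csum_S.
  rewrite (Csum_ext _ _ _ (fun k _ => vwp_contig A h e f l k Hh HA He Hf Hl)).
  rewrite Csum_lin, !vwp_0; [ring| |]; apply (nonres_s h A _ 0 HA); ring.
Qed.

(** * Termination and the Frenkel-Turaev sum *)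

Lemma poch_vanish (x h : C) (i k : nat) :
  (i < k)%nat -> x + RtoC (INR i) * h = 0 -> poch x h k = 0.
Proof.
  intros Hik H. induction k as [|k IH]; [lia|]. simpl.
  destruct (Nat.eq_dec i k) as [->|E].
  - rewrite H, s_0. ring.
  - rewrite IH by lia. ring.
Qed.

Lemma vwp_vanish (A : C) (l : list C) (h x : C) (i k : nat) :
  In x l -> (i < k)%nat -> x + RtoC (INR i) * h = 0 -> vwp A l h k = 0.
Proof.
  intros Hx Hik H. unfold vwp.
  assert (E : pochs (A :: l) h k = 0).
  { unfold pochs. cbn [fold_right].
    assert (E : fold_right (fun x acc => poch x h k * acc) (RtoC 1) l = 0); [|rewrite E; ring].
    induction l as [|y l IH]; [easy|]. cbn [fold_right].
    destruct Hx as [->|Hx].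
    - rewrite (poch_vanish x h i k Hik H). ring.
    - rewrite IH by auto. ring. }
  rewrite E. unfold Cdiv. ring.
Qed.

(** For u = v this is the product side of the Frenkel-Turaev sum. A second base point v is allowed
    because in g_n and h_n the factors containing d carry another power of q. *)
Definition jackson (u v b c d h : C) (M : nat) : C :=
  poch u h M * poch (u - b - c) h M * poch (v - b - d) h M * poch (v - c - d) h M
  / (poch (u - b) h M * poch (u - c) h M * poch (v - d) h M * poch (v - b - c - d) h M).

Lemma poch_shift_div (x y h X : C) (m : nat) :
  y = x + h -> X = RtoC (INR m) * h -> s x <> 0 ->
  poch y h m = poch x h m * s (x + X) / s x.
Proof.
  intros -> -> H. assert (K := poch_l x h m). cbn [poch] in K. rewrite K. now field.
Qed.

(** Induction by lowering the terminating parameter -N h: both series on the right of [sum_contig]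
    are instances of the sum for N, one of them with shifted A, b, c, d, and their products combine
    by the three-term relation. The first parameter is the one dictated by balancing. *)
Lemma frenkel_turaev (h : C) (N : nat) :
  (forall i : Z, (i <> 0)%Z -> s (RtoC (IZR i) * h) <> 0) ->
  forall A b c d : C,
  nonres h A -> nonres h (A - b) -> nonres h (A - c) -> nonres h (A - d) -> nonres h (A - b - c - d) ->
  Csum N (vwp A [2 * A + RtoC (INR (S N)) * h - b - c - d; - (RtoC (INR N) * h); b; c; d] h)
  = jackson (A + h) (A + h) b c d h N.
Proof.
  intros Hh. induction N as [|N IH]; intros A b c d HA Hb Hc Hd He.
  - simpl Csum. rewrite vwp_0 by (apply (nonres_s h A _ 0 HA); ring).
    unfold jackson. cbn [poch]. field.
  - set (e := 2 * A + RtoC (INR (S N)) * h - b - c - d).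
    set (f := - (RtoC (INR N) * h)).
    replace (2 * A + RtoC (INR (S (S N))) * h - b - c - d) with (e + h)
      by (unfold e; rewrite (RtoC_INR_S (S N)); ring).
    replace (- (RtoC (INR (S N)) * h)) with (f - h)
      by (unfold f; rewrite RtoC_INR_S; ring).
    rewrite sum_contig; auto.
    2:{ apply (nonres_shift h (-(A - b - c - d)) _ (- Z.of_nat (S N))).
        - now apply nonres_opp.
        - rewrite opp_IZR, RtoC_opp, <- INR_IZR_INZ. unfold e. ring. }
    2:{ apply (nonres_shift h A _ (Z.of_nat N) HA). rewrite <- INR_IZR_INZ. unfold f. ring. }
    2:{ intros x [<-|[<-|[<-|[]]]]; auto. }
    change (Csum (S N) (vwp A [e; f; b; c; d] h)) with
      (Csum N (vwp A [e; f; b; c; d] h) + vwp A [e; f; b; c; d] h (S N)).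
    rewrite (vwp_vanish A _ h f N (S N)); [| right; left; auto | lia | unfold f; ring].
    unfold e, f at 1. rewrite (IH A b c d) by auto.
    cbn [map].
    assert (E : Csum N (vwp (A + 2 * h) [e + h; f; b + h; c + h; d + h] h)
                = jackson (A + 2 * h + h) (A + 2 * h + h) (b + h) (c + h) (d + h) h N).
    { rewrite <- IH.
      - do 3 f_equal. unfold e. ring.
      - apply (nonres_shift h A _ 2 HA); ring.
      - apply (nonres_shift h (A - b) _ 1 Hb); ring.
      - apply (nonres_shift h (A - c) _ 1 Hc); ring.
      - apply (nonres_shift h (A - d) _ 1 Hd); ring.
      - apply (nonres_shift h (A - b - c - d) _ (-1) He); ring. }
    fold e. rewrite E. clear E.
    unfold jackson, contig_coef, sprod. cbn [map fold_right].
    set (X := RtoC (INR N) * h).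
    assert (HX : X = RtoC (INR N) * h) by reflexivity.
    assert (z0 := HA 1%Z). assert (z1 := HA 2%Z).
    assert (zb := Hb 1%Z). assert (zc := Hc 1%Z). assert (zd := Hd 1%Z).
    assert (ze : s (A - b - c - d + X) <> 0).
    { apply (nonres_s h _ _ (Z.of_nat N) He). now rewrite <- INR_IZR_INZ. }
    assert (yb : s (A - b + h + X) <> 0).
    { apply (nonres_s h _ _ (Z.of_nat (S N)) Hb). rewrite <- INR_IZR_INZ, RtoC_INR_S. unfold X; ring. }
    assert (yc : s (A - c + h + X) <> 0).
    { apply (nonres_s h _ _ (Z.of_nat (S N)) Hc). rewrite <- INR_IZR_INZ, RtoC_INR_S. unfold X; ring. }
    assert (yd : s (A - d + h + X) <> 0).
    { apply (nonres_s h _ _ (Z.of_nat (S N)) Hd). rewrite <- INR_IZR_INZ, RtoC_INR_S. unfold X; ring. }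
    assert (ye : s (A - b - c - d + h + X) <> 0).
    { apply (nonres_s h _ _ (Z.of_nat (S N)) He). rewrite <- INR_IZR_INZ, RtoC_INR_S. unfold X; ring. }
    assert (ya : s (A + h + X) <> 0).
    { apply (nonres_s h _ _ (Z.of_nat (S N)) HA). rewrite <- INR_IZR_INZ, RtoC_INR_S. unfold X; ring. }
    assert (ya2 : s (A + h + h + X) <> 0).
    { apply (nonres_s h _ _ (Z.of_nat (S (S N))) HA). rewrite <- INR_IZR_INZ, !RtoC_INR_S. unfold X; ring. }
    assert (pb : poch (A + h - b) h N <> 0).
    { apply nonres_sp, (nonres_shift h _ _ 1 Hb). ring. }
    assert (pc : poch (A + h - c) h N <> 0).
    { apply nonres_sp, (nonres_shift h _ _ 1 Hc). ring. }
    assert (pd : poch (A + h - d) h N <> 0).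
    { apply nonres_sp, (nonres_shift h _ _ 1 Hd). ring. }
    assert (pe : poch (A + h - b - c - d) h N <> 0).
    { apply nonres_sp, (nonres_shift h _ _ 1 He). ring. }
    cbn [poch]. fold X.
    replace (A + 2 * h + h - (b + h) - (c + h)) with (A + h - b - c) by ring.
    replace (A + 2 * h + h - (b + h) - (d + h)) with (A + h - b - d) by ring.
    replace (A + 2 * h + h - (c + h) - (d + h)) with (A + h - c - d) by ring.
    rewrite (poch_shift_div (A + h + h) (A + 2 * h + h) h X);
      [ | ring | auto | intros K; apply z1; rewrite <- K; f_equal; ring].
    rewrite (poch_shift_div (A + h) (A + h + h) h X);
      [ | ring | auto | intros K; apply z0; rewrite <- K; f_equal; ring].
    rewrite (poch_shift_div (A + h - b) (A + 2 * h + h - (b + h)) h X);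
      [ | ring | auto | intros K; apply zb; rewrite <- K; f_equal; ring].
    rewrite (poch_shift_div (A + h - c) (A + 2 * h + h - (c + h)) h X);
      [ | ring | auto | intros K; apply zc; rewrite <- K; f_equal; ring].
    rewrite (poch_shift_div (A + h - d) (A + 2 * h + h - (d + h)) h X);
      [ | ring | auto | intros K; apply zd; rewrite <- K; f_equal; ring].
    assert (E : poch (A + h - b - c - (d + h)) h N
                = s (A - b - c - d) * poch (A + h - b - c - d) h N / s (A - b - c - d + X)).
    { rewrite (poch_shift_div (A - b - c - d) (A + h - b - c - d) h X); auto.
      - replace (A + h - b - c - (d + h)) with (A - b - c - d) by ring.
        field. split; [apply (nonres_s h _ _ 0 He); ring | auto].
      - ring.
      - apply (nonres_s h _ _ 0 He); ring. }
    rewrite E. clear E.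
    (* With Y = A + h + X this compares the new factors of numerator and denominator, s(Y) s(Y-b-c)
       s(Y-b-d) s(Y-c-d) and s(Y-b) s(Y-c) s(Y-d) s(Y-b-c-d): their difference is s(b) s(c) s(d)
       s(2Y-b-c-d). *)
    assert (K := s_add3 d (2 * (A + h + X) - b - c - 2 * d) (A + h + X - d) (A + h + X - b - d)).
    assert (zf : s (A - b - c - d) <> 0) by (apply (nonres_s h _ _ 0 He); ring).
    set (q1 := poch (A + h) h N). set (q2 := poch (A + h - b - c) h N).
    set (q3 := poch (A + h - b - d) h N). set (q4 := poch (A + h - c - d) h N).
    set (q5 := poch (A + h - b) h N) in *. set (q6 := poch (A + h - c) h N) in *.
    set (q7 := poch (A + h - d) h N) in *. set (q8 := poch (A + h - b - c - d) h N) in *.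
    clearbody q1 q2 q3 q4 q5 q6 q7 q8.
    unfold e, f. rewrite RtoC_INR_S.
    replace ((RtoC (INR N) + 1) * h) with (X + h) by (unfold X; ring).
    fold X.
    clear HA Hb Hc Hd He IH Hh HX. clearbody X.
    revert K z0 z1 zb zc zd ze yb yc yd ye ya ya2 zf.
    s_norm s s_odd [A; h; b; c; d; X].
    repeat match goal with |- context [s ?u] => generalize (s u); intro end.
    intros K z0 z1 zb zc zd ze yb yc yd ye ya ya2 zf.
    match type of K with ?x * ?y * (?z * ?w) = ?t =>
      assert (K' : x * y * z * w = t) by (rewrite <- K; ring) end.
    clear K.
    field [K']. repeat split; auto.
Qed.

(** * Cancelling pairs of parameters *)

Lemma vwp_pair (A h x y : C) (l : list C) (k : nat) :
  (forall i : Z, (i <> 0)%Z -> s (RtoC (IZR i) * h) <> 0) ->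
  (forall z, In z l -> nonres h (A - z)) ->
  A + h = x + y -> s A <> 0 -> nonres h x -> nonres h y ->
  vwp A (x :: y :: l) h k = vwp A l h k.
Proof.
  intros Hh Hl E HA Hx Hy. unfold vwp, pochs. cbn [map fold_right].
  replace (A + h - x) with y by (rewrite E; ring).
  replace (A + h - y) with x by (rewrite E; ring).
  assert (nx := nonres_sp h x k Hx). assert (ny := nonres_sp h y k Hy).
  assert (nh := poch_h_neq_0 h k Hh).
  assert (nD := pochs_neq0 (map (fun z => A + h - z) l) h k). unfold pochs in nD.
  set (D := fold_right _ _ (map _ l)) in *. set (L := fold_right _ _ l).
  field. repeat split; auto. apply nD. intros z Hz.
  apply in_map_iff in Hz as (w & <- & Hw). apply nonres_sp.
  apply (nonres_shift h (A - w) _ 1 (Hl w Hw)). ring.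
Qed.

(* When [x1 + x2 = A] the pair [x1 + h, x2] drops out by [vwp_pair], so one of the three sums of
   [sum_contig] becomes an 8-omega-7, summable by [frenkel_turaev]. *)
Lemma sum_pair (A h x1 x2 y : C) (l : list C) (N : nat) :
  (forall i : Z, (i <> 0)%Z -> s (RtoC (IZR i) * h) <> 0) ->
  A = x1 + x2 -> nonres h A -> nonres h x1 -> nonres h x2 -> nonres h (A - y) ->
  (forall x, In x l -> nonres h (A - x)) ->
  Csum (S N) (vwp A (x1 :: x2 :: y + h :: l) h)
  = Csum (S N) (vwp A (y :: l) h)
    - contig_coef A h x1 (y + h) (x2 :: l)
      * Csum N (vwp (A + 2 * h)
                 (x1 + h :: x2 + h :: y + h :: map (fun x => x + h) l) h).
Proof.
  intros Hh HA nA n1 n2 ny Hl.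
  assert (K := sum_contig A h x1 (y + h) (x2 :: l) N Hh nA).
  rewrite (Csum_ext (S N) (vwp A (x1 :: x2 :: y + h :: l) h)
             (vwp A (x1 :: y + h :: x2 :: l) h)).
  2:{ intros k _. apply vwp_perm. constructor. constructor. }
  assert (E : Csum (S N) (vwp A (y :: l) h)
              = Csum (S N) (vwp A (x1 + h :: y + h - h :: x2 :: l) h)).
  { apply Csum_ext. intros k _. symmetry.
    replace (y + h - h) with y by ring.
    rewrite <- (vwp_pair A h (x1 + h) x2 (y :: l)); auto.
    - apply vwp_perm. constructor. constructor.
    - intros z [<-|Hz]; auto.
    - rewrite HA. ring.
    - apply (nonres_s h A _ 0 nA). ring.
    - apply (nonres_shift h x1 _ 1 n1). ring. }
  rewrite E, K.
  - cbn [map].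
    rewrite (Csum_ext N (vwp (A + 2 * h) (x1 + h :: x2 + h :: y + h :: map (fun x => x + h) l) h)
             (vwp (A + 2 * h) (x1 + h :: y + h :: x2 + h :: map (fun x => x + h) l) h)).
    2:{ intros k _. apply vwp_perm. constructor. constructor. }
    ring.
  - replace (A - x1) with x2 by (rewrite HA; ring). auto.
  - apply (nonres_shift h (A - y) _ (-1) ny). ring.
  - intros x [<-|Hx]; auto. replace (A - x2) with x1 by (rewrite HA; ring). auto.
Qed.

(** The same factors in reverse order, each with its argument negated. *)
Lemma poch_rev (x y h : C) (m : nat) :
  y = - x - RtoC (INR m) * h + h -> poch x h m = RtoC (-1) ^ m * poch y h m.
Proof.
  revert x y. induction m as [|m IH]; intros x y ->.
  - simpl. ring.
  - rewrite (poch_l (_ + h)). cbn [poch Cpow].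
    rewrite RtoC_INR_S.
    replace (- x - (RtoC (INR m) + 1) * h + h) with (- (x + RtoC (INR m) * h)) by ring.
    rewrite s_odd. rewrite (IH x _ eq_refl).
    replace (- (x + RtoC (INR m) * h) + h) with (- x - RtoC (INR m) * h + h) by ring.
    generalize (RtoC (-1) ^ m). intros w. ring.
Qed.

Lemma m1_pow_neq0 (m : nat) : RtoC (-1) ^ m <> 0.
Proof. apply Cpow_nz. intros K. apply RtoC_inj in K. lra. Qed.

(** * Generic parameters *)

(* [al], [be], [de], [ka] are logarithms of a, b, d, q. *)
Definition gen (al be de ka : C) : Prop :=
  forall i j k l : Z, (i <> 0 \/ j <> 0 \/ k <> 0 \/ l <> 0)%Z ->
  s (RtoC (IZR i) * al + (RtoC (IZR j) * be + (RtoC (IZR k) * de + (RtoC (IZR l) * ka + 0)))) <> 0.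

(** The shift acts on the integer coefficients by a unimodular map, so nontrivial combinations stay
    nontrivial; the recursions therefore remain among generic parameters. *)
Lemma gen_shift (al be de ka : C) (a b d : Z) :
  gen al be de ka ->
  gen (al + RtoC (IZR a) * ka) (be + RtoC (IZR b) * ka) (de + RtoC (IZR d) * ka) ka.
Proof.
  intros H i j k l Hn.
  assert (K := H i j k (i * a + j * b + k * d + l)%Z).
  rewrite !plus_IZR, !mult_IZR, !RtoC_plus, !RtoC_mult in K.
  intros E. apply K.
  - destruct (Z.eq_dec i 0) as [->|]; [|auto]. destruct (Z.eq_dec j 0) as [->|]; [|auto].
    destruct (Z.eq_dec k 0) as [->|]; [|auto]. lia.
  - etransitivity; [|exact E]. f_equal. ring.
Qed.

Lemma gen_h (al be de ka : C) (i : Z) :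
  gen al be de ka -> (i <> 0)%Z -> s (RtoC (IZR i) * (3 * ka)) <> 0.
Proof.
  intros H Hi E. apply (H 0 0 0 (i * 3))%Z; [lia|].
  etransitivity; [|exact E]. rewrite mult_IZR, RtoC_mult. f_equal. ring.
Qed.

(** Stated in the normal form produced by [s_norm], final + 0 included, with N * (3 ka) as a fifth
    atom. A nonzero coefficient is asked of [al], [be] or [de] because the last two atoms may cancel
    each other. *)
Lemma gen_neq_0 (al be de ka : C) (N : nat) (i j k l m : Z) :
  gen al be de ka -> (i <> 0 \/ j <> 0 \/ k <> 0)%Z ->
  s (RtoC (IZR i) * al + (RtoC (IZR j) * be + (RtoC (IZR k) * de + (RtoC (IZR l) * ka
     + (RtoC (IZR m) * (RtoC (INR N) * (3 * ka)) + 0))))) <> 0.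
Proof.
  intros H Hi E. apply (H i j k (l + m * Z.of_nat N * 3))%Z; [lia|].
  etransitivity; [|exact E]. rewrite plus_IZR, !mult_IZR, <- INR_IZR_INZ, RtoC_plus, !RtoC_mult. f_equal. ring.
Qed.

Lemma gen_nonres (al be de ka x : C) (i j k l : Z) :
  gen al be de ka -> (i <> 0 \/ j <> 0 \/ k <> 0)%Z ->
  x = RtoC (IZR i) * al + (RtoC (IZR j) * be + (RtoC (IZR k) * de + (RtoC (IZR l) * ka + 0))) ->
  nonres (3 * ka) x.
Proof.
  intros H Hi -> m E. apply (H i j k (l + m * 3))%Z; [lia|].
  etransitivity; [|exact E]. rewrite plus_IZR, !mult_IZR, RtoC_plus, !RtoC_mult. f_equal. ring.
Qed.

Lemma gen_nonres_X (al be de ka x : C) (N : nat) (i j k l m : Z) :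
  gen al be de ka -> (i <> 0 \/ j <> 0 \/ k <> 0)%Z ->
  x = RtoC (IZR i) * al + (RtoC (IZR j) * be + (RtoC (IZR k) * de + (RtoC (IZR l) * ka
     + (RtoC (IZR m) * (RtoC (INR N) * (3 * ka)) + 0)))) ->
  nonres (3 * ka) x.
Proof.
  intros H Hi ->. apply (gen_nonres al be de ka _ i j k (l + m * Z.of_nat N * 3)); auto.
  rewrite plus_IZR, !mult_IZR, <- INR_IZR_INZ, RtoC_plus, !RtoC_mult. ring.
Qed.

(** * Reversal and shifts of the prefactor products *)

(** Reversed, each product of the second quotient is up to (-1)^M one on the opposite side of the
    first, and the four signs above cancel the four below. This is how a prefactor times its
    8-omega-7 becomes 1. *)
Lemma jackson_inv (u v b c d w b' c' d' h : C) (M : nat) :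
  v - b - c - d = - w - RtoC (INR M) * h + h ->
  v - d = - (w - b' - c') - RtoC (INR M) * h + h ->
  u - c = - (w - b' - d') - RtoC (INR M) * h + h ->
  u - b = - (w - c' - d') - RtoC (INR M) * h + h ->
  v - c - d = - (w - b') - RtoC (INR M) * h + h ->
  v - b - d = - (w - c') - RtoC (INR M) * h + h ->
  u - b - c = - (w - d') - RtoC (INR M) * h + h ->
  u = - (w - b' - c' - d') - RtoC (INR M) * h + h ->
  nonres h u -> nonres h (u - b - c) -> nonres h (v - b - d) -> nonres h (v - c - d) ->
  nonres h (u - b) -> nonres h (u - c) -> nonres h (v - d) -> nonres h (v - b - c - d) ->
  jackson u v b c d h M * jackson w w b' c' d' h M = 1.
Proof.
  intros E1 E2 E3 E4 E5 E6 E7 E8 n1 n2 n3 n4 n5 n6 n7 n8.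
  unfold jackson.
  rewrite (poch_rev w _ h M E1), (poch_rev (w - b' - c') _ h M E2), (poch_rev (w - b' - d') _ h M E3),
    (poch_rev (w - c' - d') _ h M E4), (poch_rev (w - b') _ h M E5), (poch_rev (w - c') _ h M E6),
    (poch_rev (w - d') _ h M E7), (poch_rev (w - b' - c' - d') _ h M E8).
  assert (H := m1_pow_neq0 M). revert H.
  generalize (RtoC (-1) ^ M). intros w1 H.
  field. repeat split; auto using nonres_sp.
Qed.

Lemma poch_up (x y h X : C) (m : nat) :
  nonres h x -> X = RtoC (INR m) * h -> y = x + h ->
  poch y h m = poch x h m * (s (x + X) / s x).
Proof.
  intros n E ->. rewrite (poch_shift_div x (x + h) h X m); auto.
  - unfold Cdiv; ring.
  - apply (nonres_s h x _ 0 n); ring.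
Qed.

Lemma nonres_X (h x y : C) (i : Z) (m : nat) :
  nonres h x -> y = x + RtoC (IZR i) * h + RtoC (INR m) * h -> s y <> 0.
Proof.
  intros n ->. replace (x + RtoC (IZR i) * h + RtoC (INR m) * h)
    with (x + RtoC (IZR (i + Z.of_nat m)) * h). apply n.
  rewrite plus_IZR, <- INR_IZR_INZ, RtoC_plus. ring.
Qed.

Lemma poch_down (x y h X : C) (m : nat) :
  nonres h x -> X = RtoC (INR m) * h -> y = x - h ->
  poch y h m = poch x h m * (s y / s (y + X)).
Proof.
  intros n E Ey. assert (ny : nonres h y) by (apply (nonres_shift h x _ (-1) n); rewrite Ey; ring).
  rewrite (poch_up y x h X m ny E).
  - assert (s y <> 0) by (apply (nonres_s h y _ 0 ny); ring).
    assert (s (y + X) <> 0) by (apply (nonres_X h y _ 0 m ny); rewrite E; ring).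
    field. auto.
  - rewrite Ey; ring.
Qed.

(** The three [jackson_pat] lemmas compare prefactors before and after a change of parameters. Only
    the eight arguments of the products enter, so the hypotheses prescribe how these move by
    multiples of h, and boundary factors are all that remains. Here the length M is unchanged, as
    from n to n - 1 for n not congruent to 1 mod 3. *)
Lemma jackson_pat0 (u v b c d u' v' b' c' d' h X : C) (M : nat) :
  X = RtoC (INR M) * h ->
  u' = u + h -> u' - b' - c' = u - b - c - h -> v' - b' - d' = v - b - d - h ->
  v' - c' - d' = v - c - d - h -> u' - b' = u - b -> u' - c' = u - c -> v' - d' = v - d ->
  v' - b' - c' - d' = v - b - c - d - h - h ->
  nonres h u -> nonres h (u - b - c) -> nonres h (v - b - d) -> nonres h (v - c - d) ->
  nonres h (u - b) -> nonres h (u - c) -> nonres h (v - d) -> nonres h (v - b - c - d) ->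
  jackson u' v' b' c' d' h M
  = jackson u v b c d h M
    * (s (u + X) / s u
       * (s (u - b - c - h) / s (u - b - c - h + X))
       * (s (v - b - d - h) / s (v - b - d - h + X))
       * (s (v - c - d - h) / s (v - c - d - h + X))
       * (s (v - b - c - d - h + X) * s (v - b - c - d - h - h + X)
          / (s (v - b - c - d - h) * s (v - b - c - d - h - h)))).
Proof.
  intros HX E1 E2 E3 E4 E5 E6 E7 E8 n1 n2 n3 n4 n5 n6 n7 n8.
  unfold jackson. rewrite E2, E3, E4, E5, E6, E7, E8.
  assert (n9 : nonres h (v - b - c - d - h)) by (apply (nonres_shift h _ _ (-1) n8); ring).
  rewrite (poch_up u u' h X M), (poch_down (u - b - c) (u - b - c - h) h X M),
   (poch_down (v - b - d) (v - b - d - h) h X M), (poch_down (v - c - d) (v - c - d - h) h X M),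
   (poch_down (v - b - c - d - h) (v - b - c - d - h - h) h X M),
   (poch_down (v - b - c - d) (v - b - c - d - h) h X M); auto.
  assert (a1 : s u <> 0) by (apply (nonres_s h _ _ 0 n1); ring).
  assert (a2 : s (u - b - c - h + X) <> 0) by (apply (nonres_X h _ _ (-1) M n2); rewrite HX; ring).
  assert (a3 : s (v - b - d - h + X) <> 0) by (apply (nonres_X h _ _ (-1) M n3); rewrite HX; ring).
  assert (a4 : s (v - c - d - h + X) <> 0) by (apply (nonres_X h _ _ (-1) M n4); rewrite HX; ring).
  assert (a5 : s (v - b - c - d - h + X) <> 0) by (apply (nonres_X h _ _ (-1) M n8); rewrite HX; ring).
  assert (a6 : s (v - b - c - d - h - h + X) <> 0) by (apply (nonres_X h _ _ (-2) M n8); rewrite HX; ring).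
  assert (a7 : s (v - b - c - d - h) <> 0) by (apply (nonres_s h _ _ (-1) n8); ring).
  assert (a8 : s (v - b - c - d - h - h) <> 0) by (apply (nonres_s h _ _ (-2) n8); ring).
  field. repeat split; auto using nonres_sp.
Qed.

Lemma poch_SX (x h X : C) (M : nat) :
  X = RtoC (INR M) * h -> poch x h (S M) = poch x h M * s (x + X).
Proof. intros ->. reflexivity. Qed.

(** For n = 3N + 1, where passing to n - 1 shortens each product by one factor. *)
Lemma jackson_pat1 (u v b c d u' v' b' c' d' h X : C) (M : nat) :
  X = RtoC (INR M) * h ->
  u' = u + h + h -> u' - b' - c' = u - b - c -> v' - b' - d' = v - b - d ->
  v' - c' - d' = v - c - d -> u' - b' = u - b + h -> u' - c' = u - c + h -> v' - d' = v - d + h ->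
  v' - b' - c' - d' = v - b - c - d - h ->
  nonres h u -> nonres h (u - b - c) -> nonres h (v - b - d) -> nonres h (v - c - d) ->
  nonres h (u - b) -> nonres h (u - c) -> nonres h (v - d) -> nonres h (v - b - c - d) ->
  jackson u' v' b' c' d' h M
  = jackson u v b c d h (S M)
    * (s (u + h + X) / (s u * s (u + h))
       * (s (u - b) * s (u - c) * s (v - d)
          / (s (u - b - c + X) * s (v - b - d + X) * s (v - c - d + X)))
       * (s (v - b - c - d - h + X) * s (v - b - c - d + X) / s (v - b - c - d - h))).
Proof.
  intros HX E1 E2 E3 E4 E5 E6 E7 E8 n1 n2 n3 n4 n5 n6 n7 n8.
  unfold jackson. rewrite E2, E3, E4, E5, E6, E7, E8.
  assert (n9 : nonres h (u + h)) by (apply (nonres_shift h _ _ 1 n1); ring).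
  rewrite (poch_up (u + h) u' h X M n9), (poch_up u (u + h) h X M), (poch_up (u - b) (u - b + h) h X M),
   (poch_up (u - c) (u - c + h) h X M), (poch_up (v - d) (v - d + h) h X M),
   (poch_down (v - b - c - d) (v - b - c - d - h) h X M), !(poch_SX _ h X M HX); auto.
  assert (a1 : s u <> 0) by (apply (nonres_s h _ _ 0 n1); ring).
  assert (a2 : s (u + h) <> 0) by (apply (nonres_s h _ _ 1 n1); ring).
  assert (a3 : s (u + X) <> 0) by (apply (nonres_X h _ _ 0 M n1); rewrite HX; ring).
  assert (a4 : s (u - b + X) <> 0) by (apply (nonres_X h _ _ 0 M n5); rewrite HX; ring).
  assert (a5 : s (u - c + X) <> 0) by (apply (nonres_X h _ _ 0 M n6); rewrite HX; ring).
  assert (a6 : s (v - d + X) <> 0) by (apply (nonres_X h _ _ 0 M n7); rewrite HX; ring).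
  assert (a7 : s (u - b - c + X) <> 0) by (apply (nonres_X h _ _ 0 M n2); rewrite HX; ring).
  assert (a8 : s (v - b - d + X) <> 0) by (apply (nonres_X h _ _ 0 M n3); rewrite HX; ring).
  assert (a9 : s (v - c - d + X) <> 0) by (apply (nonres_X h _ _ 0 M n4); rewrite HX; ring).
  assert (a10 : s (v - b - c - d + X) <> 0) by (apply (nonres_X h _ _ 0 M n8); rewrite HX; ring).
  assert (a11 : s (v - b - c - d - h + X) <> 0) by (apply (nonres_X h _ _ (-1) M n8); rewrite HX; ring).
  assert (a12 : s (v - b - c - d - h) <> 0) by (apply (nonres_s h _ _ (-1) n8); ring).
  assert (a13 : s (u - b) <> 0) by (apply (nonres_s h _ _ 0 n5); ring).
  assert (a14 : s (u - c) <> 0) by (apply (nonres_s h _ _ 0 n6); ring).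
  assert (a15 : s (v - d) <> 0) by (apply (nonres_s h _ _ 0 n7); ring).
  field. repeat split; auto using nonres_sp.
Qed.

(** For the step from n to n - 3 with d fixed, which also shortens each product by one factor. *)
Lemma jackson_pat2 (u v b c d u' v' b' c' d' h X : C) (M : nat) :
  X = RtoC (INR M) * h ->
  u' = u + h -> u' - b' - c' = u - b - c - h -> v' - b' - d' = v - b - d ->
  v' - c' - d' = v - c - d -> u' - b' = u - b -> u' - c' = u - c -> v' - d' = v - d + h ->
  v' - b' - c' - d' = v - b - c - d - h ->
  nonres h u -> nonres h (u - b - c) -> nonres h (v - b - d) -> nonres h (v - c - d) ->
  nonres h (u - b) -> nonres h (u - c) -> nonres h (v - d) -> nonres h (v - b - c - d) ->
  jackson u' v' b' c' d' h M
  = jackson u v b c d h (S M)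
    * (/ s u * (s (u - b - c - h) / (s (u - b - c - h + X) * s (u - b - c + X)))
       * (s (u - b + X) * s (u - c + X) / (s (v - b - d + X) * s (v - c - d + X)))
       * (s (v - d) * s (v - b - c - d - h + X) * s (v - b - c - d + X) / s (v - b - c - d - h))).
Proof.
  intros HX E1 E2 E3 E4 E5 E6 E7 E8 n1 n2 n3 n4 n5 n6 n7 n8.
  unfold jackson. rewrite E2, E3, E4, E5, E6, E7, E8.
  rewrite (poch_up u u' h X M n1), (poch_down (u - b - c) (u - b - c - h) h X M),
   (poch_up (v - d) (v - d + h) h X M),
   (poch_down (v - b - c - d) (v - b - c - d - h) h X M), !(poch_SX _ h X M HX); auto.
  assert (a1 : s u <> 0) by (apply (nonres_s h _ _ 0 n1); ring).
  assert (a3 : s (u + X) <> 0) by (apply (nonres_X h _ _ 0 M n1); rewrite HX; ring).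
  assert (a4 : s (u - b + X) <> 0) by (apply (nonres_X h _ _ 0 M n5); rewrite HX; ring).
  assert (a5 : s (u - c + X) <> 0) by (apply (nonres_X h _ _ 0 M n6); rewrite HX; ring).
  assert (a6 : s (v - d + X) <> 0) by (apply (nonres_X h _ _ 0 M n7); rewrite HX; ring).
  assert (a7 : s (u - b - c + X) <> 0) by (apply (nonres_X h _ _ 0 M n2); rewrite HX; ring).
  assert (a2 : s (u - b - c - h + X) <> 0) by (apply (nonres_X h _ _ (-1) M n2); rewrite HX; ring).
  assert (a8 : s (v - b - d + X) <> 0) by (apply (nonres_X h _ _ 0 M n3); rewrite HX; ring).
  assert (a9 : s (v - c - d + X) <> 0) by (apply (nonres_X h _ _ 0 M n4); rewrite HX; ring).
  assert (a10 : s (v - b - c - d + X) <> 0) by (apply (nonres_X h _ _ 0 M n8); rewrite HX; ring).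
  assert (a11 : s (v - b - c - d - h + X) <> 0) by (apply (nonres_X h _ _ (-1) M n8); rewrite HX; ring).
  assert (a12 : s (v - b - c - d - h) <> 0) by (apply (nonres_s h _ _ (-1) n8); ring).
  assert (a15 : s (v - d) <> 0) by (apply (nonres_s h _ _ 0 n7); ring).
  field. repeat split; auto using nonres_sp.
Qed.

(** * The three series and their splittings *)

(** The logarithm of c, solved from bcd = a^2 q. *)
Definition gam (al be de ka : C) : C := 2 * al + ka - be - de.

(* [Wf], [Wg], [Wh] are the three series omega, with [nu] the logarithm of q^n; in [prefactor] and [hfactor]
   the arguments [t], [t1] are the exponents of q such as 3 - sigma. *)
Definition Wf (al be de ka nu : C) (N : nat) : C :=
  Csum N (vwp (al - nu - 2 * ka)
    [al - de - ka; de - nu - ka; be; gam al be de ka; de; ka - nu; - nu] (3 * ka)).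
Definition Wg (al be de ka nu : C) (N : nat) : C :=
  Csum N (vwp (al - nu - ka)
    [al - de; de - nu - ka; be; gam al be de ka; de + ka; 2 * ka - nu; - nu] (3 * ka)).
Definition Wh (al be de ka nu : C) (N : nat) : C :=
  Csum N (vwp (al - nu)
    [al + ka - de; de - nu - ka; be; gam al be de ka; de + 2 * ka; 2 * ka - nu; ka - nu] (3 * ka)).

Definition prefactor (al be de ka t t1 : C) (M : nat) : C :=
  jackson (al + t * ka) (al + t1 * ka) be (gam al be de ka) de (3 * ka) M.

Definition hfactor (al be de ka t : C) : C :=
  s (al + t * ka) * s (al + t * ka - be - gam al be de ka)
  * s (al + ka - be - de) * s (al + ka - gam al be de ka - de)
  / (s (al + t * ka - be) * s (al + t * ka - gam al be de ka)
     * s (al + ka - de) * s (al + ka - be - gam al be de ka - de)).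

(** The term k = 1 of S, which is the t_1 of the recursion; [ep] is the logarithm of e forced by de
    = a q^(n+1). *)
Definition first_term (al be de ka nu : C) : C :=
  let ep := al + nu + ka - de in
  s (al + 4 * ka) / s al
  * (s be * s (gam al be de ka)) / (s (al + ka - be) * s (al + ka - gam al be de ka))
  * (s de * s (de + ka)) / (s (al + ka - de) * s (al + 2 * ka - de))
  * (s ep * s (- nu)) / (s (al + 3 * ka - ep) * s (al + nu + 3 * ka)).

Lemma vwp_eq (A A' h : C) (l l' : list C) (k : nat) :
  A = A' -> l = l' -> vwp A l h k = vwp A' l' h k.
Proof. now intros -> ->. Qed.

Ltac list_eq :=
  lazymatch goal with
  | |- (_ :: _) = (_ :: _) => apply (f_equal2 (@cons C)); [unfold gam; ring | list_eq]
  | |- nil = nil => reflexivity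
  end.

Ltac perm_tac :=
  repeat (first [ apply perm_nil
                | match goal with |- Permutation (?x :: ?r) ?L =>
                    let rec go pre rest :=
                      lazymatch rest with
                      | x :: ?q => apply (Permutation_cons_app pre q x); cbn [app]
                      | ?y :: ?q => let pre' := eval cbn [app] in (pre ++ [y])%list in go pre' q
                      end in go (@nil C) L end ]).

Ltac vwp_reorder l :=
  etransitivity; [ apply (vwp_perm _ _ l); perm_tac | apply vwp_eq; [unfold gam; ring | list_eq] ].

Ltac gen_nonres_tac al be de ka N :=
  repeat match goal with H : ?nu = _ + RtoC (IZR _) * ka |- _ => is_var nu; rewrite H; clear H end;
  unfold gam;
  let X := fresh "X" in let HX := fresh "HX" in
  remember (RtoC (INR N) * (3 * ka)) as X eqn:HX;
  lazymatch goal with |- nonres _ ?x =>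
    let i := lin_coef x al in let j := lin_coef x be in let k := lin_coef x de in
    let l := lin_coef x ka in let m := lin_coef x X in
      apply (gen_nonres_X al be de ka x N i j k l m);
      [ assumption | lia
      | rewrite ?plus_IZR, ?minus_IZR, ?mult_IZR, ?opp_IZR, ?RtoC_plus, ?RtoC_minus, ?RtoC_mult, ?RtoC_opp,
          ?plus_IZR, ?minus_IZR, ?mult_IZR, ?opp_IZR, ?RtoC_plus, ?RtoC_minus, ?RtoC_mult, ?RtoC_opp;
        try rewrite HX; ring ] end.

(** [sum_pair] with q^(1-n) lowered by q^3. In the companion series q^(1-n) is the q^(-n') of n' = n
    - 1, and q^(-n) has been raised to q^(3-n) = q^(2-n'), as type g requires. [N] and [r] record
    that [nu] is an integer multiple of [ka], for the genericity conditions. *)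
Lemma f_split (al be de ka nu : C) (L : nat) (N : nat) (r : Z) :
  gen al be de ka -> nu = RtoC (INR N) * (3 * ka) + RtoC (IZR r) * ka ->
  Wf al be de ka nu (S L)
  = Csum (S L) (vwp (al - nu - 2 * ka)
      [- nu - 2 * ka; be; gam al be de ka; de; - nu] (3 * ka))
    - contig_coef (al - nu - 2 * ka) (3 * ka) (al - de - ka) (ka - nu)
        [de - nu - ka; be; gam al be de ka; de; - nu]
      * Wg (al + 4 * ka) (be + 3 * ka) (de + 2 * ka) ka (nu - ka) L.
Proof.
  intros G Hnu.
  unfold Wf, Wg.
  assert (K := sum_pair (al - nu - 2 * ka) (3 * ka) (al - de - ka) (de - nu - ka)
    (- nu - 2 * ka) [be; gam al be de ka; de; - nu] L).
  replace (- nu - 2 * ka + 3 * ka) with (ka - nu) in K by ring.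
  rewrite (Csum_ext (S L) _ (vwp (al - nu - 2 * ka)
      [al - de - ka; de - nu - ka; ka - nu; be; gam al be de ka; de; - nu] (3 * ka))).
  2:{ intros k _. vwp_reorder [al - de - ka; de - nu - ka; ka - nu; be; gam al be de ka; de; - nu]. }
  rewrite K; clear K.
  - f_equal. f_equal. apply Csum_ext. intros k _. cbn [map].
    vwp_reorder [al - de - ka + 3 * ka; de - nu - ka + 3 * ka; be + 3 * ka;
       gam al be de ka + 3 * ka; de + 3 * ka; - nu + 3 * ka; ka - nu].
  - intros i Hi. now apply (gen_h al be de ka).
  - ring.
  - gen_nonres_tac al be de ka N.
  - gen_nonres_tac al be de ka N.
  - gen_nonres_tac al be de ka N.
  - gen_nonres_tac al be de ka N.
  - intros x [<-|[<-|[<-|[<-|[]]]]]; gen_nonres_tac al be de ka N.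
Qed.

Ltac split_tac al be de ka nu L N K l1 l2 :=
  match type of K with _ -> _ -> _ -> _ -> _ -> _ -> _ -> _ = Csum _ (vwp ?A _ ?h) - _ =>
    rewrite (Csum_ext (S L) _ (vwp A l1 h));
    [ rewrite K; clear K;
      [ do 2 f_equal; apply Csum_ext; intros k _; cbn [map]; vwp_reorder l2
      | intros i Hi; now apply (gen_h al be de ka)
      | ring | gen_nonres_tac al be de ka N ..
      | let x := fresh in intros x [<-|[<-|[<-|[<-|[]]]]]; gen_nonres_tac al be de ka N ]
    | intros k _; vwp_reorder l1 ] end.

Lemma g_split (al be de ka nu : C) (L : nat) (N : nat) (r : Z) :
  gen al be de ka -> nu = RtoC (INR N) * (3 * ka) + RtoC (IZR r) * ka ->
  Wg al be de ka nu (S L)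
  = Csum (S L) (vwp (al - nu - ka)
      [- nu - ka; be; gam al be de ka; de + ka; - nu] (3 * ka))
    - contig_coef (al - nu - ka) (3 * ka) (al - de) (2 * ka - nu)
        [de - nu - ka; be; gam al be de ka; de + ka; - nu]
      * Wh (al + 4 * ka) (be + 3 * ka) (de + 2 * ka) ka (nu - ka) L.
Proof.
  intros G Hnu.
  unfold Wg, Wh.
  assert (K := sum_pair (al - nu - ka) (3 * ka) (al - de) (de - nu - ka)
    (- nu - ka) [be; gam al be de ka; de + ka; - nu] L).
  replace (- nu - ka + 3 * ka) with (2 * ka - nu) in K by ring.
  split_tac al be de ka nu L N K
    [al - de; de - nu - ka; 2 * ka - nu; be; gam al be de ka; de + ka; - nu]
    [al - de + 3 * ka; de - nu - ka + 3 * ka; be + 3 * ka;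
       gam al be de ka + 3 * ka; de + ka + 3 * ka; - nu + 3 * ka; 2 * ka - nu].
Qed.

(** Now d is the parameter lowered, so it reappears unchanged in the companion series, while both
    exponents -n and 1 - n rise by 3: the type is kept and n becomes n - 3. *)
Lemma f_split3 (al be de ka nu : C) (L : nat) (N : nat) (r : Z) :
  gen al be de ka -> nu = RtoC (INR N) * (3 * ka) + RtoC (IZR r) * ka ->
  Wf al be de ka nu (S L)
  = Csum (S L) (vwp (al - nu - 2 * ka)
      [de - 3 * ka; be; gam al be de ka; ka - nu; - nu] (3 * ka))
    - contig_coef (al - nu - 2 * ka) (3 * ka) (al - de - ka) de
        [de - nu - ka; be; gam al be de ka; ka - nu; - nu]
      * Wf (al + 3 * ka) (be + 3 * ka) de ka (nu - 3 * ka) L.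
Proof.
  intros G Hnu.
  unfold Wf.
  assert (K := sum_pair (al - nu - 2 * ka) (3 * ka) (al - de - ka) (de - nu - ka)
    (de - 3 * ka) [be; gam al be de ka; ka - nu; - nu] L).
  replace (de - 3 * ka + 3 * ka) with de in K by ring.
  split_tac al be de ka nu L N K
    [al - de - ka; de - nu - ka; de; be; gam al be de ka; ka - nu; - nu]
    [al - de - ka + 3 * ka; de - nu - ka + 3 * ka; be + 3 * ka;
       gam al be de ka + 3 * ka; de; ka - nu + 3 * ka; - nu + 3 * ka].
Qed.

Lemma g_split3 (al be de ka nu : C) (L : nat) (N : nat) (r : Z) :
  gen al be de ka -> nu = RtoC (INR N) * (3 * ka) + RtoC (IZR r) * ka ->
  Wg al be de ka nu (S L)
  = Csum (S L) (vwp (al - nu - ka)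
      [de - 2 * ka; be; gam al be de ka; 2 * ka - nu; - nu] (3 * ka))
    - contig_coef (al - nu - ka) (3 * ka) (al - de) (de + ka)
        [de - nu - ka; be; gam al be de ka; 2 * ka - nu; - nu]
      * Wg (al + 3 * ka) (be + 3 * ka) de ka (nu - 3 * ka) L.
Proof.
  intros G Hnu.
  unfold Wg.
  assert (K := sum_pair (al - nu - ka) (3 * ka) (al - de) (de - nu - ka)
    (de - 2 * ka) [be; gam al be de ka; 2 * ka - nu; - nu] L).
  replace (de - 2 * ka + 3 * ka) with (de + ka) in K by ring.
  split_tac al be de ka nu L N K
    [al - de; de - nu - ka; de + ka; be; gam al be de ka; 2 * ka - nu; - nu]
    [al - de + 3 * ka; de - nu - ka + 3 * ka; be + 3 * ka;
       gam al be de ka + 3 * ka; de + ka; 2 * ka - nu + 3 * ka; - nu + 3 * ka].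
Qed.

Lemma h_split3 (al be de ka nu : C) (L : nat) (N : nat) (r : Z) :
  gen al be de ka -> nu = RtoC (INR N) * (3 * ka) + RtoC (IZR r) * ka ->
  Wh al be de ka nu (S L)
  = Csum (S L) (vwp (al - nu)
      [de - ka; be; gam al be de ka; 2 * ka - nu; ka - nu] (3 * ka))
    - contig_coef (al - nu) (3 * ka) (al + ka - de) (de + 2 * ka)
        [de - nu - ka; be; gam al be de ka; 2 * ka - nu; ka - nu]
      * Wh (al + 3 * ka) (be + 3 * ka) de ka (nu - 3 * ka) L.
Proof.
  intros G Hnu.
  unfold Wh.
  assert (K := sum_pair (al - nu) (3 * ka) (al + ka - de) (de - nu - ka)
    (de - ka) [be; gam al be de ka; 2 * ka - nu; ka - nu] L).
  replace (de - ka + 3 * ka) with (de + 2 * ka) in K by ring.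
  split_tac al be de ka nu L N K
    [al + ka - de; de - nu - ka; de + 2 * ka; be; gam al be de ka; 2 * ka - nu; ka - nu]
    [al + ka - de + 3 * ka; de - nu - ka + 3 * ka; be + 3 * ka;
       gam al be de ka + 3 * ka; de + 2 * ka; 2 * ka - nu + 3 * ka; ka - nu + 3 * ka].
Qed.

Ltac s_field al be de ka N :=
  let X := fresh "X" in
  set (X := RtoC (INR N) * (3 * ka));
  s_norm s s_odd [al; be; de; ka; X];
  field;
  repeat split; apply (gen_neq_0 al be de ka N); first [assumption | lia].

Ltac ft_tac al be de ka N Hnu l :=
  rewrite <- frenkel_turaev;
  [ let k := fresh "k" in
    apply Csum_ext; intros k _;
    etransitivity; [apply (vwp_perm _ _ l); perm_tac|];
    rewrite Hnu, !RtoC_INR_S; apply vwp_eq; [ring | list_eq]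
  | let i := fresh in intros i ?; now apply (gen_h al be de ka)
  | gen_nonres_tac al be de ka N .. ].

Ltac solve_args Hnu := rewrite ?Hnu, ?RtoC_INR_S; unfold gam; ring.

Tactic Notation "pat_tac" constr(al) constr(be) constr(de) constr(ka) constr(N) hyp(Hnu) hyp(H) :=
  rewrite H; clear H; [| solve_args Hnu .. | | | | | | | |]; [| gen_nonres_tac al be de ka N ..].

(** The goal has the shape P (F - B W) = 1 + t P R W with F a summed 8-omega-7. It splits into P F =
    1, from [jackson_inv], and B = - t R, in which all s-values cancel once their arguments are
    normalised. *)
Ltac step_tac al be de ka nu N Hnu P1 :=
  match goal with |- ?P * (?F - ?B * _) = _ + ?t * (_ * ?R * ?W) =>
    assert (PF : P * F = 1);
    [ apply P1; clear P1; [solve_args Hnu .. | | | | | | | |]; gen_nonres_tac al be de ka N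
    | assert (EB : B = - (t * R));
      [ clear P1 PF
      | rewrite EB; transitivity (P * F + t * P * R * W); [ring | rewrite PF; ring]] ] end;
  unfold contig_coef, first_term, hfactor, gam, sprod; cbn [map fold_right];
  rewrite Hnu; clear Hnu;
  s_field al be de ka N.

(** * The step from n to n - 1 *)

(** [f_split] asks for a successor as upper limit; the added term vanishes because q^(1-n) =
    q^(-3N). *)
Lemma Wf_top (al be de ka nu : C) (N : nat) :
  nu = RtoC (INR N) * (3 * ka) + RtoC (IZR 1) * ka ->
  Wf al be de ka nu (S N) = Wf al be de ka nu N.
Proof.
  intros Hnu. unfold Wf. cbn [Csum].
  rewrite (vwp_vanish _ _ (3 * ka) (ka - nu) N (S N)); [ring | | lia | rewrite Hnu; ring].
  do 5 right. left. reflexivity.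
Qed.

Lemma Wg_top (al be de ka nu : C) (N : nat) :
  nu = RtoC (INR N) * (3 * ka) + RtoC (IZR 2) * ka ->
  Wg al be de ka nu (S N) = Wg al be de ka nu N.
Proof.
  intros Hnu. unfold Wg. cbn [Csum].
  rewrite (vwp_vanish _ _ (3 * ka) (2 * ka - nu) N (S N)); [ring | | lia | rewrite Hnu; ring].
  do 5 right. left. reflexivity.
Qed.

Lemma step_f0 (al be de ka nu : C) (N : nat) :
  gen al be de ka -> nu = RtoC (INR N) * (3 * ka) + RtoC (IZR 3) * ka ->
  prefactor al be de ka 3 3 (S N) * Wf al be de ka nu (S N)
  = 1 + first_term al be de ka nu
        * (prefactor (al + 4 * ka) (be + 3 * ka) (de + 2 * ka) ka 2 1 (S N)
           * Wg (al + 4 * ka) (be + 3 * ka) (de + 2 * ka) ka (nu - ka) N).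
Proof.
  intros G Hnu. rewrite (f_split al be de ka nu N N 3 G Hnu).
  assert (FT : Csum (S N) (vwp (al - nu - 2 * ka) [- nu - 2 * ka; be; gam al be de ka; de; - nu] (3 * ka))
    = jackson (al - nu - 2 * ka + 3 * ka) (al - nu - 2 * ka + 3 * ka) (be) (gam al be de ka) (de) (3 * ka) (S N)).
  { ft_tac al be de ka N Hnu [- nu - 2 * ka; - nu; be; gam al be de ka; de]. }
  rewrite FT. clear FT.
  assert (P1 := jackson_inv (al + 3 * ka) (al + 3 * ka) be (gam al be de ka) de
    (al - nu - 2 * ka + 3 * ka) be (gam al be de ka) (de) (3 * ka) (S N)).
  assert (P2 := jackson_pat0 (al + 3 * ka) (al + 3 * ka) be (gam al be de ka) de
    (al + 4 * ka + 2 * ka) (al + 4 * ka + 1 * ka) (be + 3 * ka)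
    (gam (al + 4 * ka) (be + 3 * ka) (de + 2 * ka) ka) (de + 2 * ka) (3 * ka)
    (RtoC (INR N) * (3 * ka) + 3 * ka) (S N)).
  unfold prefactor. set (W := Wg _ _ _ _ _ _).
  pat_tac al be de ka N Hnu P2.
  step_tac al be de ka nu N Hnu P1.
Qed.

Lemma step_f1 (al be de ka nu : C) (N : nat) :
  gen al be de ka -> nu = RtoC (INR N) * (3 * ka) + RtoC (IZR 1) * ka ->
  prefactor al be de ka 1 1 (S N) * Wf al be de ka nu N
  = 1 + first_term al be de ka nu
        * (prefactor (al + 4 * ka) (be + 3 * ka) (de + 2 * ka) ka 3 2 N
           * Wg (al + 4 * ka) (be + 3 * ka) (de + 2 * ka) ka (nu - ka) N).
Proof.
  intros G Hnu. rewrite <- Wf_top by auto.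
  rewrite (f_split al be de ka nu N N 1 G Hnu).
  assert (FT : Csum (S N) (vwp (al - nu - 2 * ka) [- nu - 2 * ka; be; gam al be de ka; de; - nu] (3 * ka))
    = jackson (al - nu - 2 * ka + 3 * ka) (al - nu - 2 * ka + 3 * ka) (be) (gam al be de ka) (de) (3 * ka) (S N)).
  { ft_tac al be de ka N Hnu [- nu; - nu - 2 * ka; be; gam al be de ka; de]. }
  rewrite FT. clear FT.
  assert (P1 := jackson_inv (al + 1 * ka) (al + 1 * ka) be (gam al be de ka) de
    (al - nu - 2 * ka + 3 * ka) be (gam al be de ka) (de) (3 * ka) (S N)).
  assert (P2 := jackson_pat1 (al + 1 * ka) (al + 1 * ka) be (gam al be de ka) de
    (al + 4 * ka + 3 * ka) (al + 4 * ka + 2 * ka) (be + 3 * ka)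
    (gam (al + 4 * ka) (be + 3 * ka) (de + 2 * ka) ka) (de + 2 * ka) (3 * ka)
    (RtoC (INR N) * (3 * ka)) N).
  unfold prefactor. set (W := Wg _ _ _ _ _ _).
  pat_tac al be de ka N Hnu P2.
  step_tac al be de ka nu N Hnu P1.
Qed.

Lemma step_g0 (al be de ka nu : C) (N : nat) :
  gen al be de ka -> nu = RtoC (INR N) * (3 * ka) + RtoC (IZR 3) * ka ->
  prefactor al be de ka 3 2 (S N) * Wg al be de ka nu (S N)
  = 1 + (first_term al be de ka nu * hfactor (al + 4 * ka) (be + 3 * ka) (de + 2 * ka) ka 1)
        * (prefactor (al + 4 * ka) (be + 3 * ka) (de + 2 * ka) ka 2 0 (S N)
           * Wh (al + 4 * ka) (be + 3 * ka) (de + 2 * ka) ka (nu - ka) N).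
Proof.
  intros G Hnu. rewrite (g_split al be de ka nu N N 3 G Hnu).
  assert (FT : Csum (S N) (vwp (al - nu - ka) [- nu - ka; be; gam al be de ka; de + ka; - nu] (3 * ka))
    = jackson (al - nu - ka + 3 * ka) (al - nu - ka + 3 * ka) (be) (gam al be de ka) (de + ka) (3 * ka) (S N)).
  { ft_tac al be de ka N Hnu [- nu - ka; - nu; be; gam al be de ka; de + ka]. }
  rewrite FT. clear FT.
  assert (P1 := jackson_inv (al + 3 * ka) (al + 2 * ka) be (gam al be de ka) de
    (al - nu - ka + 3 * ka) be (gam al be de ka) (de + ka) (3 * ka) (S N)).
  assert (P2 := jackson_pat0 (al + 3 * ka) (al + 2 * ka) be (gam al be de ka) de
    (al + 4 * ka + 2 * ka) (al + 4 * ka + 0 * ka) (be + 3 * ka)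
    (gam (al + 4 * ka) (be + 3 * ka) (de + 2 * ka) ka) (de + 2 * ka) (3 * ka)
    (RtoC (INR N) * (3 * ka) + 3 * ka) (S N)).
  unfold prefactor. set (W := Wh _ _ _ _ _ _).
  pat_tac al be de ka N Hnu P2.
  step_tac al be de ka nu N Hnu P1.
Qed.

Lemma step_g2 (al be de ka nu : C) (N : nat) :
  gen al be de ka -> nu = RtoC (INR N) * (3 * ka) + RtoC (IZR 2) * ka ->
  prefactor al be de ka 2 1 (S N) * Wg al be de ka nu N
  = 1 + (first_term al be de ka nu * hfactor (al + 4 * ka) (be + 3 * ka) (de + 2 * ka) ka 2)
        * (prefactor (al + 4 * ka) (be + 3 * ka) (de + 2 * ka) ka 1 (-1) (S N)
           * Wh (al + 4 * ka) (be + 3 * ka) (de + 2 * ka) ka (nu - ka) N).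
Proof.
  intros G Hnu. rewrite <- Wg_top by auto.
  rewrite (g_split al be de ka nu N N 2 G Hnu).
  assert (FT : Csum (S N) (vwp (al - nu - ka) [- nu - ka; be; gam al be de ka; de + ka; - nu] (3 * ka))
    = jackson (al - nu - ka + 3 * ka) (al - nu - ka + 3 * ka) (be) (gam al be de ka) (de + ka) (3 * ka) (S N)).
  { ft_tac al be de ka N Hnu [- nu; - nu - ka; be; gam al be de ka; de + ka]. }
  rewrite FT. clear FT.
  assert (P1 := jackson_inv (al + 2 * ka) (al + 1 * ka) be (gam al be de ka) de
    (al - nu - ka + 3 * ka) be (gam al be de ka) (de + ka) (3 * ka) (S N)).
  assert (P2 := jackson_pat0 (al + 2 * ka) (al + 1 * ka) be (gam al be de ka) de
    (al + 4 * ka + 1 * ka) (al + 4 * ka + RtoC (-1) * ka) (be + 3 * ka)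
    (gam (al + 4 * ka) (be + 3 * ka) (de + 2 * ka) ka) (de + 2 * ka) (3 * ka)
    (RtoC (INR N) * (3 * ka) + 3 * ka) (S N)).
  unfold prefactor. set (W := Wh _ _ _ _ _ _).
  pat_tac al be de ka N Hnu P2.
  step_tac al be de ka nu N Hnu P1.
Qed.

(** * Comparison of h with f and g *)

(** In the splittings that lower a parameter with d, the summed 8-omega-7 has one factor less per
    product than the prefactor, and the products containing d are offset by h. The result is
    therefore a quotient of boundary factors instead of 1. *)
Lemma jackson_inv2 (u v b c d w b' c' d' h X : C) (M : nat) :
  X = RtoC (INR M) * h ->
  v - b - c - d + h = - w - RtoC (INR M) * h + h ->
  v - d + h = - (w - b' - c') - RtoC (INR M) * h + h ->
  u - c = - (w - b' - d') - RtoC (INR M) * h + h ->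
  u - b = - (w - c' - d') - RtoC (INR M) * h + h ->
  v - c - d + h = - (w - b') - RtoC (INR M) * h + h ->
  v - b - d + h = - (w - c') - RtoC (INR M) * h + h ->
  u - b - c = - (w - d') - RtoC (INR M) * h + h ->
  u = - (w - b' - c' - d') - RtoC (INR M) * h + h ->
  nonres h u -> nonres h (u - b - c) -> nonres h (v - b - d) -> nonres h (v - c - d) ->
  nonres h (u - b) -> nonres h (u - c) -> nonres h (v - d) -> nonres h (v - b - c - d) ->
  jackson u v b c d h (S M) * jackson w w b' c' d' h M
  = s (u + X) * s (u - b - c + X) * s (v - b - d) * s (v - c - d)
    / (s (u - b + X) * s (u - c + X) * s (v - d) * s (v - b - c - d)).
Proof.
  intros HX E1 E2 E3 E4 E5 E6 E7 E8 n1 n2 n3 n4 n5 n6 n7 n8.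
  unfold jackson.
  rewrite (poch_rev w _ h M E1), (poch_rev (w - b' - c') _ h M E2), (poch_rev (w - b' - d') _ h M E3),
    (poch_rev (w - c' - d') _ h M E4), (poch_rev (w - b') _ h M E5), (poch_rev (w - c') _ h M E6),
    (poch_rev (w - d') _ h M E7), (poch_rev (w - b' - c' - d') _ h M E8).
  rewrite (poch_up (v - b - c - d) (v - b - c - d + h) h X M), (poch_up (v - d) (v - d + h) h X M),
    (poch_up (v - b - d) (v - b - d + h) h X M), (poch_up (v - c - d) (v - c - d + h) h X M),
    !(poch_SX _ h X M HX); auto.
  assert (H := m1_pow_neq0 M). revert H.
  generalize (RtoC (-1) ^ M). intros w1 H.
  assert (a1 : s (u - b + X) <> 0) by (apply (nonres_X h _ _ 0 M n5); rewrite HX; ring).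
  assert (a2 : s (u - c + X) <> 0) by (apply (nonres_X h _ _ 0 M n6); rewrite HX; ring).
  assert (a3 : s (v - d + X) <> 0) by (apply (nonres_X h _ _ 0 M n7); rewrite HX; ring).
  assert (a4 : s (v - b - c - d + X) <> 0) by (apply (nonres_X h _ _ 0 M n8); rewrite HX; ring).
  assert (a5 : s (v - b - d + X) <> 0) by (apply (nonres_X h _ _ 0 M n3); rewrite HX; ring).
  assert (a6 : s (v - c - d + X) <> 0) by (apply (nonres_X h _ _ 0 M n4); rewrite HX; ring).
  assert (a7 : s (v - d) <> 0) by (apply (nonres_s h _ _ 0 n7); ring).
  assert (a8 : s (v - b - c - d) <> 0) by (apply (nonres_s h _ _ 0 n8); ring).
  assert (a9 : s (v - b - d) <> 0) by (apply (nonres_s h _ _ 0 n3); ring).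
  assert (a10 : s (v - c - d) <> 0) by (apply (nonres_s h _ _ 0 n4); ring).
  field. repeat split; auto using nonres_sp.
Qed.

Lemma Cinv_neq_0 (x : C) : x <> 0 -> / x <> 0.
Proof.
  intros Hx E. apply (Cmult_neq_0 x x Hx Hx).
  transitivity (x * x * (x * / x)); [now field | rewrite E; ring].
Qed.

Lemma Copp_neq_0 (x : C) : x <> 0 -> - x <> 0.
Proof. intros Hx E. apply Hx. transitivity (- - x); [ring | rewrite E; ring]. Qed.

(** The induction step of the comparison, stripped of notation: matching inhomogeneous parts,
    matching coupling coefficients and equality at n - 3 give equality at n. *)
Lemma eq_transfer (H H' Ph Fh Bh Rh wh P F B R w : C) :
  H' * Rh <> 0 -> H * (Ph * Fh) = P * F -> H * Bh * R = B * (H' * Rh) ->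
  H' * (Ph * Rh * wh) = P * R * w ->
  H * (Ph * (Fh - Bh * wh)) = P * (F - B * w).
Proof.
  intros n E1 E2 E3.
  transitivity (H * (Ph * Fh) - H * Bh * (H' * (Ph * Rh * wh)) / (H' * Rh)).
  { field. split; intros K; apply n; rewrite K; ring. }
  rewrite E1, E3.
  transitivity (P * F - H * Bh * R * (P * w) / (H' * Rh)); [unfold Cdiv; ring|].
  rewrite E2. field. split; intros K; apply n; rewrite K; ring.
Qed.

Ltac nz_tac al be de ka N :=
  let X := fresh "X" in
  set (X := RtoC (INR N) * (3 * ka));
  s_norm s s_odd [al; be; de; ka; X];
  repeat (first [apply Cmult_neq_0 | apply Cinv_neq_0 | apply Copp_neq_0]);
  apply (gen_neq_0 al be de ka N); first [assumption | lia].

(* The two sides satisfy the same first-order recursion n -> n - 3, (a, b, c, d) -> (a q^3, b q^3, c q^3, d). *)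
Lemma h_eq_f (N : nat) : forall al be de ka nu : C,
  gen al be de ka -> nu = RtoC (INR N) * (3 * ka) + RtoC (IZR 1) * ka ->
  hfactor al be de ka 2 * (prefactor al be de ka 1 (-1) (S N) * Wh al be de ka nu N)
  = prefactor al be de ka 1 1 (S N) * Wf al be de ka nu N.
Proof.
  induction N as [|N IH]; intros al be de ka nu G Hnu.
  (* Both series are 1, and the remaining factors cancel in pairs because bcd = a^2 q. *)
  - unfold Wf, Wh. cbn [Csum].
    rewrite !vwp_0.
    2: apply (nonres_s (3 * ka) (al - nu - 2 * ka) _ 0); [gen_nonres_tac al be de ka 0%nat | ring].
    2: apply (nonres_s (3 * ka) (al - nu) _ 0); [gen_nonres_tac al be de ka 0%nat | ring].
    unfold prefactor, hfactor, jackson, gam. cbn [poch INR].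
    s_field al be de ka 0%nat.
  (* The exponent 3 (N + 1) + 1 is written as 3N + 4, so that N * (3 ka) remains the only large
     atom. *)
  - assert (Hnu' : nu = RtoC (INR N) * (3 * ka) + RtoC (IZR 4) * ka).
    { rewrite Hnu, RtoC_INR_S. replace (IZR 4) with (IZR 1 + 3)%R by lra.
      rewrite RtoC_plus. ring. }
    clear Hnu. rename Hnu' into Hnu.
    rewrite (h_split3 al be de ka nu N N 4 G Hnu), (f_split3 al be de ka nu N N 4 G Hnu).
    assert (FTf : Csum (S N) (vwp (al - nu - 2 * ka) [de - 3 * ka; be; gam al be de ka; ka - nu; - nu] (3 * ka))
      = jackson (al - nu - 2 * ka + 3 * ka) (al - nu - 2 * ka + 3 * ka) be (gam al be de ka) (de - 3 * ka) (3 * ka) (S N)).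
    { ft_tac al be de ka N Hnu [- nu; ka - nu; be; gam al be de ka; de - 3 * ka]. }
    assert (FTh : Csum (S N) (vwp (al - nu) [de - ka; be; gam al be de ka; 2 * ka - nu; ka - nu] (3 * ka))
      = jackson (al - nu + 3 * ka) (al - nu + 3 * ka) be (gam al be de ka) (de - ka) (3 * ka) (S N)).
    { ft_tac al be de ka N Hnu [2 * ka - nu; ka - nu; be; gam al be de ka; de - ka]. }
    rewrite FTf, FTh. clear FTf FTh.
    assert (IH' := IH (al + 3 * ka) (be + 3 * ka) de ka (nu - 3 * ka)).
    assert (G' : gen (al + 3 * ka) (be + 3 * ka) de ka).
    { replace de with (de + RtoC (IZR 0) * ka) by ring. apply (gen_shift al be de ka 3 3 0 G). }
    specialize (IH' G').
    assert (Hnu' : nu - 3 * ka = RtoC (INR N) * (3 * ka) + RtoC (IZR 1) * ka).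
    { rewrite Hnu. replace (IZR 4) with (IZR 1 + 3)%R by lra. rewrite RtoC_plus. ring. }
    specialize (IH' Hnu'). clear Hnu' IH G'.
    set (wh := Wh _ _ _ _ _ _) in *. set (wf := Wf _ _ _ _ _ _) in *. clearbody wh wf.
    assert (P1 := jackson_inv2 (al + 1 * ka) (al + 1 * ka) be (gam al be de ka) de
      (al - nu - 2 * ka + 3 * ka) be (gam al be de ka) (de - 3 * ka) (3 * ka) (RtoC (INR N) * (3 * ka) + 3 * ka) (S N)).
    assert (Q1 := jackson_inv2 (al + 1 * ka) (al + (-1) * ka) be (gam al be de ka) de
      (al - nu + 3 * ka) be (gam al be de ka) (de - ka) (3 * ka) (RtoC (INR N) * (3 * ka) + 3 * ka) (S N)).
    assert (P2 := jackson_pat2 (al + 1 * ka) (al + 1 * ka) be (gam al be de ka) de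
      (al + 3 * ka + 1 * ka) (al + 3 * ka + 1 * ka) (be + 3 * ka)
      (gam (al + 3 * ka) (be + 3 * ka) de ka) de (3 * ka)
      (RtoC (INR N) * (3 * ka) + 3 * ka) (S N)).
    assert (Q2 := jackson_pat2 (al + 1 * ka) (al + (-1) * ka) be (gam al be de ka) de
      (al + 3 * ka + 1 * ka) (al + 3 * ka + (-1) * ka) (be + 3 * ka)
      (gam (al + 3 * ka) (be + 3 * ka) de ka) de (3 * ka)
      (RtoC (INR N) * (3 * ka) + 3 * ka) (S N)).
    revert IH'. unfold prefactor.
    pat_tac al be de ka N Hnu P2. pat_tac al be de ka N Hnu Q2.
    apply eq_transfer.
    + clear P1 Q1. unfold hfactor, gam. nz_tac al be de ka N.
    + pat_tac al be de ka N Hnu P1. pat_tac al be de ka N Hnu Q1.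
      unfold hfactor, gam. s_field al be de ka N.
    + clear P1 Q1. unfold hfactor, contig_coef, gam, sprod. cbn [map fold_right].
      rewrite Hnu. clear Hnu. s_field al be de ka N.
Qed.

Lemma h_eq_g (N : nat) : forall al be de ka nu : C,
  gen al be de ka -> nu = RtoC (INR N) * (3 * ka) + RtoC (IZR 2) * ka ->
  hfactor al be de ka 1 * (prefactor al be de ka 2 (0) (S N) * Wh al be de ka nu N)
  = prefactor al be de ka 2 1 (S N) * Wg al be de ka nu N.
Proof.
  induction N as [|N IH]; intros al be de ka nu G Hnu.
  - unfold Wg, Wh. cbn [Csum].
    rewrite !vwp_0.
    2: apply (nonres_s (3 * ka) (al - nu - ka) _ 0); [gen_nonres_tac al be de ka 0%nat | ring].
    2: apply (nonres_s (3 * ka) (al - nu) _ 0); [gen_nonres_tac al be de ka 0%nat | ring].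
    unfold prefactor, hfactor, jackson, gam. cbn [poch INR].
    s_field al be de ka 0%nat.
  - assert (Hnu' : nu = RtoC (INR N) * (3 * ka) + RtoC (IZR 5) * ka).
    { rewrite Hnu, RtoC_INR_S. replace (IZR 5) with (IZR 2 + 3)%R by lra.
      rewrite RtoC_plus. ring. }
    clear Hnu. rename Hnu' into Hnu.
    rewrite (h_split3 al be de ka nu N N 5 G Hnu), (g_split3 al be de ka nu N N 5 G Hnu).
    assert (FTf : Csum (S N) (vwp (al - nu - ka) [de - 2 * ka; be; gam al be de ka; 2 * ka - nu; - nu] (3 * ka))
      = jackson (al - nu - ka + 3 * ka) (al - nu - ka + 3 * ka) be (gam al be de ka) (de - 2 * ka) (3 * ka) (S N)).
    { ft_tac al be de ka N Hnu [- nu; 2 * ka - nu; be; gam al be de ka; de - 2 * ka]. }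
    assert (FTh : Csum (S N) (vwp (al - nu) [de - ka; be; gam al be de ka; 2 * ka - nu; ka - nu] (3 * ka))
      = jackson (al - nu + 3 * ka) (al - nu + 3 * ka) be (gam al be de ka) (de - ka) (3 * ka) (S N)).
    { ft_tac al be de ka N Hnu [ka - nu; 2 * ka - nu; be; gam al be de ka; de - ka]. }
    rewrite FTf, FTh. clear FTf FTh.
    assert (IH' := IH (al + 3 * ka) (be + 3 * ka) de ka (nu - 3 * ka)).
    assert (G' : gen (al + 3 * ka) (be + 3 * ka) de ka).
    { replace de with (de + RtoC (IZR 0) * ka) by ring. apply (gen_shift al be de ka 3 3 0 G). }
    specialize (IH' G').
    assert (Hnu' : nu - 3 * ka = RtoC (INR N) * (3 * ka) + RtoC (IZR 2) * ka).
    { rewrite Hnu. replace (IZR 5) with (IZR 2 + 3)%R by lra. rewrite RtoC_plus. ring. }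
    specialize (IH' Hnu'). clear Hnu' IH G'.
    set (wh := Wh _ _ _ _ _ _) in *. set (wf := Wg _ _ _ _ _ _) in *. clearbody wh wf.
    assert (P1 := jackson_inv2 (al + 2 * ka) (al + 1 * ka) be (gam al be de ka) de
      (al - nu - ka + 3 * ka) be (gam al be de ka) (de - 2 * ka) (3 * ka) (RtoC (INR N) * (3 * ka) + 3 * ka) (S N)).
    assert (Q1 := jackson_inv2 (al + 2 * ka) (al + (0) * ka) be (gam al be de ka) de
      (al - nu + 3 * ka) be (gam al be de ka) (de - ka) (3 * ka) (RtoC (INR N) * (3 * ka) + 3 * ka) (S N)).
    assert (P2 := jackson_pat2 (al + 2 * ka) (al + 1 * ka) be (gam al be de ka) de
      (al + 3 * ka + 2 * ka) (al + 3 * ka + 1 * ka) (be + 3 * ka)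
      (gam (al + 3 * ka) (be + 3 * ka) de ka) de (3 * ka)
      (RtoC (INR N) * (3 * ka) + 3 * ka) (S N)).
    assert (Q2 := jackson_pat2 (al + 2 * ka) (al + (0) * ka) be (gam al be de ka) de
      (al + 3 * ka + 2 * ka) (al + 3 * ka + (0) * ka) (be + 3 * ka)
      (gam (al + 3 * ka) (be + 3 * ka) de ka) de (3 * ka)
      (RtoC (INR N) * (3 * ka) + 3 * ka) (S N)).
    revert IH'. unfold prefactor.
    pat_tac al be de ka N Hnu P2. pat_tac al be de ka N Hnu Q2.
    apply eq_transfer.
    + clear P1 Q1. unfold hfactor, gam. nz_tac al be de ka N.
    + pat_tac al be de ka N Hnu P1. pat_tac al be de ka N Hnu Q1.
      unfold hfactor, gam. s_field al be de ka N.
    + clear P1 Q1. unfold hfactor, contig_coef, gam, sprod. cbn [map fold_right].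
      rewrite Hnu. clear Hnu. s_field al be de ka N.
Qed.

(** * The sum S and its recursion *)

Lemma Cinv_0 : / (RtoC 0) = 0.
Proof. unfold Cinv, RtoC; simpl. apply injective_projections; simpl; unfold Rdiv; ring. Qed.

(** Holds at zero too by the convention / 0 = 0, so quotients can be rearranged without knowing
    their denominators to be nonzero. *)
Lemma Cinv_mul (x y : C) : / (x * y) = / x * / y.
Proof.
  destruct (Ceq_dec x 0) as [->|Hx]; [rewrite Cmult_0_l, Cinv_0; ring|].
  destruct (Ceq_dec y 0) as [->|Hy]; [rewrite Cmult_0_r, Cinv_0; ring|].
  now field.
Qed.

Definition Sterm (al be de ka nu : C) (k : nat) : C :=
  let ep := al + nu + ka - de in
  s (al + 4 * (RtoC (INR k) * ka)) / s al
  * (poch be (3 * ka) k * poch (gam al be de ka) (3 * ka) k)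
  / (poch (al + ka - be) ka k * poch (al + ka - gam al be de ka) ka k)
  * poch de ka (2 * k) / poch (al + ka - de) ka (2 * k)
  * (poch ep ka k * poch (- nu) ka k)
  / (poch (al + 3 * ka - ep) (3 * ka) k * poch (al + nu + 3 * ka) (3 * ka) k).

(* The sum starts at k = 0 without a vanishing factor, so shifting k yields an inhomogeneous first-order recursion. *)
Lemma Sterm_S (al be de ka nu : C) (k : nat) :
  gen al be de ka ->
  Sterm al be de ka nu (S k)
  = first_term al be de ka nu * Sterm (al + 4 * ka) (be + 3 * ka) (de + 2 * ka) ka (nu - ka) k.
Proof.
  intros G. unfold Sterm, first_term.
  replace (2 * S k)%nat with (S (S (2 * k))) by lia.
  rewrite !poch_l.
  replace (gam (al + 4 * ka) (be + 3 * ka) (de + 2 * ka) ka) with (gam al be de ka + 3 * ka)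
    by (unfold gam; ring).
  replace (al + 4 * ka + ka - (be + 3 * ka)) with (al + ka - be + ka) by ring.
  replace (al + 4 * ka + ka - (gam al be de ka + 3 * ka)) with (al + ka - gam al be de ka + ka) by ring.
  replace (al + 4 * ka + ka - (de + 2 * ka)) with (al + ka - de + ka + ka) by ring.
  replace (al + 4 * ka + (nu - ka) + ka - (de + 2 * ka)) with (al + nu + ka - de + ka) by ring.
  replace (al + 4 * ka + 3 * ka - (al + nu + ka - de + ka)) with
    (al + 3 * ka - (al + nu + ka - de) + 3 * ka) by ring.
  replace (al + 4 * ka + (nu - ka) + 3 * ka) with (al + nu + 3 * ka + 3 * ka) by ring.
  replace (- (nu - ka)) with (- nu + ka) by ring.
  replace (de + 2 * ka) with (de + ka + ka) by ring.
  replace (al + 2 * ka - de) with (al + ka - de + ka) by ring.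
  rewrite RtoC_INR_S.
  replace (al + 4 * ((RtoC (INR k) + 1) * ka)) with (al + 4 * ka + 4 * (RtoC (INR k) * ka)) by ring.
  assert (n1 : s (al + 4 * ka) <> 0).
  { replace (al + 4 * ka) with (RtoC (IZR 1) * al + (RtoC (IZR 0) * be + (RtoC (IZR 0) * de + (RtoC (IZR 4) * ka + 0)))) by ring.
    apply G. lia. }
  (* The only cancellation is that of s(al + 4 ka), on top in [first_term] and below in the shifted
     term; all other inverses are independent atoms. *)
  assert (n2 := Cinv_l _ n1).
  unfold Cdiv. rewrite !Cinv_mul.
  revert n2. generalize (/ s (al + 4 * ka)) (s (al + 4 * ka)).
  repeat match goal with |- context [/ ?x] => generalize (/ x); intro end.
  intros i x n2. ring [n2].
Qed.

Definition Ssum (al be de ka nu : C) (n : nat) : C := Csum n (Sterm al be de ka nu).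

Lemma Ssum_0 (al be de ka nu : C) : gen al be de ka -> Ssum al be de ka nu 0 = 1.
Proof.
  intros G. unfold Ssum, Sterm. cbn [Csum poch INR].
  replace (al + 4 * (RtoC 0 * ka)) with al by ring.
  change (2 * 0)%nat with 0%nat. cbn [poch]. field.
  replace al with (RtoC (IZR 1) * al + (RtoC (IZR 0) * be + (RtoC (IZR 0) * de + (RtoC (IZR 0) * ka + 0)))) by ring.
  apply G. lia.
Qed.

Lemma Ssum_S (al be de ka nu : C) (n : nat) :
  gen al be de ka ->
  Ssum al be de ka nu (S n)
  = 1 + first_term al be de ka nu * Ssum (al + 4 * ka) (be + 3 * ka) (de + 2 * ka) ka (nu - ka) n.
Proof.
  intros G. unfold Ssum. rewrite Csum_S.
  assert (E := Ssum_0 al be de ka nu G). unfold Ssum in E. cbn [Csum] in E. rewrite E.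
  rewrite (Csum_ext n _ (fun k => 0 + first_term al be de ka nu
     * Sterm (al + 4 * ka) (be + 3 * ka) (de + 2 * ka) ka (nu - ka) k)).
  - rewrite Csum_lin. f_equal.
    assert (Z0 : forall m, Csum m (fun _ => RtoC 0) = 0).
    { induction m as [|m IH]; simpl; [reflexivity | rewrite IH; ring]. }
    rewrite Z0. ring.
  - intros k _. rewrite Sterm_S by auto. ring.
Qed.

Lemma gen_next (al be de ka : C) :
  gen al be de ka -> gen (al + 4 * ka) (be + 3 * ka) (de + 2 * ka) ka.
Proof. apply (gen_shift al be de ka 4 3 2). Qed.

Lemma prefactor_0 (al be de ka t t1 : C) : prefactor al be de ka t t1 0 = 1.
Proof. unfold prefactor, jackson. cbn [poch]. field. Qed.

Lemma W_0 (al be de ka nu : C) (r : Z) :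
  gen al be de ka -> nu = RtoC (IZR r) * ka ->
  Wf al be de ka nu 0 = 1 /\ Wg al be de ka nu 0 = 1.
Proof.
  intros G Hnu. unfold Wf, Wg. cbn [Csum].
  assert (K : forall l : Z, s (al + RtoC (IZR l) * ka) <> 0).
  { intros l. replace (al + RtoC (IZR l) * ka) with
      (RtoC (IZR 1) * al + (RtoC (IZR 0) * be + (RtoC (IZR 0) * de + (RtoC (IZR l) * ka + 0)))) by ring.
    apply G. lia. }
  split; apply vwp_0.
  - replace (al - nu - 2 * ka) with (al + RtoC (IZR (- r - 2)) * ka); [apply K|].
    rewrite Hnu, minus_IZR, opp_IZR, RtoC_minus, RtoC_opp. ring.
  - replace (al - nu - ka) with (al + RtoC (IZR (- r - 1)) * ka); [apply K|].
    rewrite Hnu, minus_IZR, opp_IZR, RtoC_minus, RtoC_opp. ring.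
Qed.

(** * Induction through the residue classes modulo 3 *)

(** The cases n = 3N, 3N + 1, 3N + 2, each with the two series that terminate there. Formula f at n
    draws on g at n - 1, g at n on h at n - 1, and h on f or g at the same n. *)
Definition sum0 (N : nat) : Prop := forall al be de ka nu : C, gen al be de ka ->
  nu = RtoC (INR N) * (3 * ka) ->
  Ssum al be de ka nu (3 * N) = prefactor al be de ka 3 3 N * Wf al be de ka nu N /\
  Ssum al be de ka nu (3 * N) = prefactor al be de ka 3 2 N * Wg al be de ka nu N.
Definition sum1 (N : nat) : Prop := forall al be de ka nu : C, gen al be de ka ->
  nu = RtoC (INR N) * (3 * ka) + RtoC (IZR 1) * ka ->
  Ssum al be de ka nu (S (3 * N)) = prefactor al be de ka 1 1 (S N) * Wf al be de ka nu N /\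
  Ssum al be de ka nu (S (3 * N))
  = hfactor al be de ka 2 * (prefactor al be de ka 1 (-1) (S N) * Wh al be de ka nu N).
Definition sum2 (N : nat) : Prop := forall al be de ka nu : C, gen al be de ka ->
  nu = RtoC (INR N) * (3 * ka) + RtoC (IZR 2) * ka ->
  Ssum al be de ka nu (S (S (3 * N))) = prefactor al be de ka 2 1 (S N) * Wg al be de ka nu N /\
  Ssum al be de ka nu (S (S (3 * N)))
  = hfactor al be de ka 1 * (prefactor al be de ka 2 0 (S N) * Wh al be de ka nu N).

Lemma sum0_sum1 (N : nat) : sum0 N -> sum1 N.
Proof.
  intros H al be de ka nu G Hnu. rewrite (h_eq_f N al be de ka nu G Hnu).
  enough (E : Ssum al be de ka nu (S (3 * N)) = prefactor al be de ka 1 1 (S N) * Wf al be de ka nu N)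
    by auto.
  rewrite Ssum_S, (step_f1 al be de ka nu N G Hnu) by auto.
  edestruct (H _ _ _ _ (nu - ka) (gen_next _ _ _ _ G)) as [_ E]; [rewrite Hnu; ring|].
  rewrite E. reflexivity.
Qed.

Lemma sum1_sum2 (N : nat) : sum1 N -> sum2 N.
Proof.
  intros H al be de ka nu G Hnu. rewrite (h_eq_g N al be de ka nu G Hnu).
  enough (E : Ssum al be de ka nu (S (S (3 * N))) = prefactor al be de ka 2 1 (S N) * Wg al be de ka nu N)
    by auto.
  rewrite Ssum_S, (step_g2 al be de ka nu N G Hnu) by auto.
  edestruct (H _ _ _ _ (nu - ka) (gen_next _ _ _ _ G)) as [_ E]; [rewrite Hnu; ring|].
  rewrite E. ring.
Qed.

Lemma sum2_sum0 (N : nat) : sum2 N -> sum0 (S N).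
Proof.
  intros H al be de ka nu G Hnu.
  assert (Hnu' : nu = RtoC (INR N) * (3 * ka) + RtoC (IZR 3) * ka)
    by (rewrite Hnu, RtoC_INR_S; ring).
  rewrite (step_f0 al be de ka nu N G Hnu'), (step_g0 al be de ka nu N G Hnu').
  replace (3 * S N)%nat with (S (S (S (3 * N)))) by lia.
  rewrite Ssum_S by auto.
  edestruct (H _ _ _ _ (nu - ka) (gen_next _ _ _ _ G)) as [E1 E2]; [rewrite Hnu'; ring|].
  split; [rewrite E1 | rewrite E2]; ring.
Qed.

Lemma sum_all (N : nat) : sum0 N /\ sum1 N /\ sum2 N.
Proof.
  assert (H : sum0 N).
  { induction N as [|N IH].
    - intros al be de ka nu G Hnu.
      destruct (W_0 al be de ka nu 0 G) as [-> ->]; [rewrite Hnu; cbn [INR]; ring|].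
      change (3 * 0)%nat with 0%nat. rewrite !prefactor_0, (Ssum_0 al be de ka nu G). split; ring.
    - now apply sum2_sum0, sum1_sum2, sum0_sum1. }
  auto using sum0_sum1, sum1_sum2.
Qed.
End Odd.

(** * Removing genericity and returning to multiplicative notation *)

Definition enum_Z (n : nat) : Z :=
  (Z.of_nat (fst (Cantor.of_nat n)) - Z.of_nat (snd (Cantor.of_nat n)))%Z.

Lemma enum_Z_surj (z : Z) : exists n, enum_Z n = z.
Proof.
  exists (Cantor.to_nat (Z.to_nat z, Z.to_nat (- z))). unfold enum_Z.
  rewrite Cantor.cancel_of_to. simpl. lia.
Qed.

Definition enum_Z4 (n : nat) : Z * Z * (Z * Z) :=
  let (m1, m2) := Cantor.of_nat n in
  let (i, j) := Cantor.of_nat m1 in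
  let (k, l) := Cantor.of_nat m2 in
  (enum_Z i, enum_Z j, (enum_Z k, enum_Z l)).

Lemma enum_Z4_surj (i j k l : Z) : exists n, enum_Z4 n = (i, j, (k, l)).
Proof.
  destruct (enum_Z_surj i) as [i' <-]. destruct (enum_Z_surj j) as [j' <-].
  destruct (enum_Z_surj k) as [k' <-]. destruct (enum_Z_surj l) as [l' <-].
  exists (Cantor.to_nat (Cantor.to_nat (i', j'), Cantor.to_nat (k', l'))).
  unfold enum_Z4. now rewrite !Cantor.cancel_of_to.
Qed.

Section Final.
Variable p : C.
Hypothesis Hp : Cmod p < 1.
Notation s := (sfun p).
Notation gen := (gen s). Notation poch := (poch s). Notation pochs := (pochs s). Notation vwp := (vwp s).
Notation Sterm := (Sterm s). Notation jackson := (jackson s). Notation Ssum := (Ssum s). Notation prefactor := (prefactor s).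
Notation Wf := (Wf s). Notation Wg := (Wg s). Notation Wh := (Wh s). Notation hfactor := (hfactor s).
Notation sum_all := (sum_all s (sfun_odd p Hp) (sfun_add p Hp)).

Lemma avoid_Z4 (u : Z -> Z -> Z -> Z -> C) (v : Z -> Z -> Z -> Z -> Z) (eps : R) : 0 < eps ->
  exists t : R, 0 < t < eps /\ forall i j k l, v i j k l <> 0%Z ->
    s (u i j k l + RtoC (IZR (v i j k l)) * RtoC t) <> 0.
Proof.
  intros He.
  destruct (avoid_countable p Hp
    (fun n => let '(i, j, (k, l)) := enum_Z4 n in u i j k l)
    (fun n => let '(i, j, (k, l)) := enum_Z4 n in IZR (v i j k l)) eps He) as (t & Ht & H).
  exists t. split; auto. intros i j k l Hv.
  destruct (enum_Z4_surj i j k l) as [n Hn]. specialize (H n). rewrite Hn in H.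
  rewrite RtoC_mult, Cmult_comm in H. apply H. intros E. apply Hv. now apply eq_IZR.
Qed.

Lemma gen_dense (al be de ka : C) (eps : R) : 0 < eps ->
  exists t : R * R * (R * R), let '(t1, t2, (t3, t4)) := t in
    0 < t1 < eps /\ 0 < t2 < eps /\ 0 < t3 < eps /\ 0 < t4 < eps /\
    gen (al + RtoC t1) (be + RtoC t2) (de + RtoC t3) (ka + RtoC t4).
Proof.
  intros He.
  (* [ka] is perturbed first, [al] last. Each choice settles the combinations whose first nonzero
     coefficient is that of the variable being perturbed, later variables being already fixed. *)
  destruct (avoid_Z4 (fun i j k l => RtoC (IZR l) * ka) (fun i j k l => l) eps He) as (t4 & B4 & H4).
  destruct (avoid_Z4 (fun i j k l => RtoC (IZR k) * de + RtoC (IZR l) * (ka + RtoC t4))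
     (fun i j k l => k) eps He) as (t3 & B3 & H3).
  destruct (avoid_Z4 (fun i j k l => RtoC (IZR j) * be + (RtoC (IZR k) * (de + RtoC t3)
     + RtoC (IZR l) * (ka + RtoC t4))) (fun i j k l => j) eps He) as (t2 & B2 & H2).
  destruct (avoid_Z4 (fun i j k l => RtoC (IZR i) * al + (RtoC (IZR j) * (be + RtoC t2)
     + (RtoC (IZR k) * (de + RtoC t3) + RtoC (IZR l) * (ka + RtoC t4))))
     (fun i j k l => i) eps He) as (t1 & B1 & H1).
  exists (t1, t2, (t3, t4)). repeat split; try lra.
  intros i j k l Hn E.
  destruct (Z.eq_dec i 0) as [->|Hi].
  2:{ apply (H1 i j k l Hi). etransitivity; [|exact E]. f_equal. ring. }
  destruct (Z.eq_dec j 0) as [->|Hj].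
  2:{ apply (H2 0%Z j k l Hj). etransitivity; [|exact E]. f_equal. ring. }
  destruct (Z.eq_dec k 0) as [->|Hk].
  2:{ apply (H3 0%Z 0%Z k l Hk). etransitivity; [|exact E]. f_equal. ring. }
  apply (H4 0%Z 0%Z 0%Z l). { lia. } etransitivity; [|exact E]. f_equal. ring.
Qed.

Lemma Ccv_perturb (x : C) (t : nat -> R) :
  (forall n, 0 < t n < / (INR n + 1)) -> Ccv (fun n => x + RtoC (t n)) x.
Proof.
  intros H. apply Ccv_Cmod. intros eps He.
  destruct (archimed_cor1 eps He) as (N & HN & N0).
  exists N. intros n Hn. replace (x + RtoC (t n) - x) with (RtoC (t n)) by ring.
  rewrite Cmod_R. specialize (H n). rewrite Rabs_right by lra.
  apply Rlt_trans with (/ (INR n + 1))%R; [lra|].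
  apply Rlt_trans with (/ INR N)%R; auto.
  apply Rinv_lt_contravar.
  - apply Rmult_lt_0_compat; [apply lt_0_INR; lia|]. assert (L := pos_INR n). lra.
  - apply le_INR in Hn. lra.
Qed.

Lemma gen_seq (al be de ka : C) : exists A B D K : nat -> C,
  Ccv A al /\ Ccv B be /\ Ccv D de /\ Ccv K ka /\ forall n, gen (A n) (B n) (D n) (K n).
Proof.
  assert (P : forall n, 0 < / (INR n + 1)).
  { intros n. apply Rinv_0_lt_compat. assert (L := pos_INR n). lra. }
  set (f := fun n => proj1_sig (constructive_indefinite_description _
     (gen_dense al be de ka (/ (INR n + 1)) (P n)))).
  assert (Hf : forall n, let '(t1, t2, (t3, t4)) := f n in
    0 < t1 < / (INR n + 1) /\ 0 < t2 < / (INR n + 1) /\ 0 < t3 < / (INR n + 1) /\ 0 < t4 < / (INR n + 1) /\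
    gen (al + RtoC t1) (be + RtoC t2) (de + RtoC t3) (ka + RtoC t4)).
  { intros n. unfold f. exact (proj2_sig (constructive_indefinite_description _
     (gen_dense al be de ka (/ (INR n + 1)) (P n)))). }
  exists (fun n => al + RtoC (fst (fst (f n)))), (fun n => be + RtoC (snd (fst (f n)))),
    (fun n => de + RtoC (fst (snd (f n)))), (fun n => ka + RtoC (snd (snd (f n)))).
  split; [|split; [|split; [|split]]].
  1-4: apply Ccv_perturb; intros n; specialize (Hf n); destruct (f n) as [[t1 t2] [t3 t4]]; simpl; tauto.
  intros n. specialize (Hf n). destruct (f n) as [[t1 t2] [t3 t4]]; simpl. tauto.
Qed.

(** * Continuity of products, terms and sums *)

Lemma Ccv_poch (X H : nat -> C) (x h : C) (m : nat) :
  Ccv X x -> Ccv H h -> Ccv (fun n => poch (X n) (H n) m) (poch x h m).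
Proof.
  intros HX HH. induction m as [|m IH]; cbn [poch]; [apply Ccv_const|].
  apply Ccv_mult; auto. apply Ccv_sfun; auto.
  apply Ccv_plus; auto. apply Ccv_mult; auto using Ccv_const.
Qed.

Lemma Ccv_pochs (U : list (nat -> C)) (l : list C) (H : nat -> C) (h : C) (m : nat) :
  Forall2 Ccv U l -> Ccv H h ->
  Ccv (fun n => pochs (map (fun u => u n) U) (H n) m) (pochs l h m).
Proof.
  intros HU HH. unfold pochs. induction HU as [|u x U l Hu HU IH]; cbn [map fold_right].
  - apply Ccv_const.
  - apply Ccv_mult; auto using Ccv_poch.
Qed.

Lemma Ccv_vwp (A H : nat -> C) (a h : C) (U : list (nat -> C)) (l : list C) (k : nat) :
  Ccv A a -> Ccv H h -> Forall2 Ccv U l -> s a <> 0 ->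
  pochs (h :: map (fun x => a + h - x) l) h k <> 0 ->
  Ccv (fun n => vwp (A n) (map (fun u => u n) U) (H n) k) (vwp a l h k).
Proof.
  intros HA HH HU n1 n2. unfold vwp.
  apply Ccv_div; auto; [apply Ccv_mult; [apply Ccv_div; auto |] |].
  - apply Ccv_sfun; auto. apply Ccv_plus; auto. apply Ccv_mult; [apply Ccv_const|].
    apply Ccv_mult; auto using Ccv_const.
  - apply Ccv_sfun; auto.
  - apply (Ccv_pochs (A :: U) (a :: l)); auto.
  - apply (Ccv_ext (fun n => pochs (map (fun u => u n)
       (H :: map (fun u => fun n => A n + H n - u n) U)) (H n) k) _ _ 0).
    { intros n _. cbn [map]. now rewrite !map_map. }
    apply Ccv_pochs; auto. constructor; auto. clear n2.
    induction HU as [|u x U l Hu HU IH]; cbn [map]; constructor; auto.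
    apply Ccv_minus; auto. now apply Ccv_plus.
Qed.

Lemma Ccv_Csum (F : nat -> nat -> C) (G : nat -> C) (N : nat) :
  (forall k, (k <= N)%nat -> Ccv (fun n => F n k) (G k)) ->
  Ccv (fun n => Csum N (F n)) (Csum N G).
Proof.
  intros H. induction N as [|N IH]; cbn [Csum]; [apply H; lia|].
  apply Ccv_plus; [apply IH; intros; apply H; lia | apply H; lia].
Qed.

(** * Passage from E to s *)

Definition falling2 (m : nat) : C := RtoC (INR m) * (RtoC (INR m) - 1).

(** Each E contributes exp of half its argument, and the arguments x + i h for i < m add up to m x +
    m (m - 1) h / 2. *)
Lemma Eprod_shift_s (x h : C) (m : nat) :
  Eprod_shift m (cexp x) (cexp h) p = cexp ((RtoC (INR m) * x + falling2 m / 2 * h) / 2) * poch x h m.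
Proof.
  assert (n2 := C2_neq_0).
  induction m as [|m IH].
  - unfold falling2. simpl. replace ((0 * x + 0 * (0 - 1) / 2 * h) / 2) with (RtoC 0) by (field; auto).
    rewrite cexp_0. ring.
  - cbn [Eprod_shift poch]. rewrite IH, cexp_pow, <- cexp_add, Eth_sfun.
    transitivity (cexp ((RtoC (INR m) * x + falling2 m / 2 * h) / 2) * cexp ((x + RtoC (INR m) * h) / 2)
      * (poch x h m * s (x + RtoC (INR m) * h))); [ring|].
    rewrite <- cexp_add. f_equal. f_equal. unfold falling2. rewrite RtoC_INR_S. field; auto.
Qed.

Lemma qpoch_nat (a Q : C) (m : nat) : qpoch a Q p (Z.of_nat m) = Eprod_shift m a Q p.
Proof.
  destruct m as [|m]; [reflexivity|].
  change (qpoch a Q p (Z.of_nat (S m))) with (Eprod_shift (Pos.to_nat (Pos.of_succ_nat m)) a Q p).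
  now rewrite SuccNat2Pos.id_succ.
Qed.

Lemma qpoch_s (x h : C) (m : nat) :
  qpoch (cexp x) (cexp h) p (Z.of_nat m)
  = cexp ((RtoC (INR m) * x + falling2 m / 2 * h) / 2) * poch x h m.
Proof. rewrite qpoch_nat. apply Eprod_shift_s. Qed.

Definition lsum (l : list C) : C := fold_right Cplus (RtoC 0) l.

Lemma qpochs_s (l : list C) (h : C) (m : nat) :
  qpochs (map cexp l) (cexp h) p (Z.of_nat m)
  = cexp ((RtoC (INR m) * lsum l + RtoC (INR (length l)) * (falling2 m / 2 * h)) / 2) * pochs l h m.
Proof.
  assert (n2 := C2_neq_0).
  unfold qpochs, lsum, pochs. induction l as [|x l IH].
  - cbn [map fold_right length INR].
    replace ((RtoC (INR m) * 0 + 0 * (falling2 m / 2 * h)) / 2) with (RtoC 0) by (field; auto).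
    rewrite cexp_0. ring.
  - cbn [map fold_right length]. rewrite IH, qpoch_s.
    set (S1 := fold_right Cplus _ _). set (P := fold_right _ _ l).
    transitivity (cexp ((RtoC (INR m) * x + falling2 m / 2 * h) / 2)
      * cexp ((RtoC (INR m) * S1 + RtoC (INR (length l)) * (falling2 m / 2 * h)) / 2) * (poch x h m * P)); [ring|].
    rewrite <- cexp_add. f_equal. f_equal. rewrite RtoC_INR_S. field; auto.
Qed.

(** The exponential factor depends on a list only through its length and sum. *)
Lemma qpochs_ratio (l1 l2 : list C) (h : C) (m : nat) :
  length l1 = length l2 -> lsum l1 = lsum l2 ->
  qpochs (map cexp l1) (cexp h) p (Z.of_nat m) / qpochs (map cexp l2) (cexp h) p (Z.of_nat m)
  = pochs l1 h m / pochs l2 h m.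
Proof.
  intros E1 E2. rewrite !qpochs_s, E1, E2.
  unfold Cdiv. rewrite Cinv_mul. set (c := cexp _).
  transitivity (c * / c * (pochs l1 h m * / pochs l2 h m)); [ring|].
  replace (c * / c) with (RtoC 1); [ring|]. symmetry. apply Cinv_r. apply cexp_neq_0.
Qed.

Lemma qpochs_neq_0 (l : list C) (h : C) (m : nat) :
  qpochs (map cexp l) (cexp h) p (Z.of_nat m) <> 0 -> pochs l h m <> 0.
Proof. intros H E. apply H. rewrite qpochs_s, E. ring. Qed.

Lemma lsum_map_sub (B : C) (l : list C) :
  lsum (map (fun x => B - x) l) = RtoC (INR (length l)) * B - lsum l.
Proof.
  unfold lsum. induction l as [|x l IH].
  - cbn [map fold_right length INR]. ring.
  - cbn [map fold_right length]. rewrite IH, RtoC_INR_S. ring.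
Qed.

Lemma map_cexp_sub (A h : C) (l : list C) :
  map (fun ai => cexp A * cexp h / ai) (map cexp l) = map cexp (map (fun x => A + h - x) l).
Proof.
  rewrite !map_map. apply map_ext. intros x. now rewrite cexp_sub, cexp_add.
Qed.

(* The balancing condition makes every exponential factor cancel. *)
Lemma omega_s (N : nat) (A h : C) (l : list C) :
  length l = 7%nat -> lsum l = 3 * A + 2 * h ->
  omega N (cexp A) (map cexp l) (cexp h) p = Csum N (vwp A l h).
Proof.
  intros E1 E2. assert (n2 := C2_neq_0). unfold omega. apply Csum_ext. intros k _.
  unfold omega_term, vwp. rewrite map_cexp_sub.
  change (cexp A :: map cexp l) with (map cexp (A :: l)).
  change (cexp h :: map cexp (map (fun x => A + h - x) l))
    with (map cexp (h :: map (fun x => A + h - x) l)).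
  rewrite !qpochs_s, !cexp_pow, <- cexp_add, !Eth_sfun.
  cbn [length]. rewrite length_map, E1.
  set (P1 := pochs (A :: l) h k). set (P2 := pochs _ h k).
  change (lsum (A :: l)) with (A + lsum l).
  change (lsum (h :: map (fun x => A + h - x) l)) with (h + lsum (map (fun x => A + h - x) l)).
  rewrite lsum_map_sub, E1, E2.
  set (k1 := INR k). rewrite mult_INR. fold k1. rewrite RtoC_mult.
  replace (RtoC (INR 2) * RtoC k1 * h) with (2 * (RtoC k1 * h)) by (simpl INR; rewrite ?RtoC_plus; ring).
  unfold Cdiv. rewrite !Cinv_mul.
  set (e1 := cexp ((A + 2 * (RtoC k1 * h)) * / 2)). set (e2 := cexp (A * / 2)).
  set (e3 := cexp ((RtoC k1 * (A + (3 * A + 2 * h)) + _) * / 2)).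
  set (e4 := cexp (RtoC k1 * h)). set (e5 := cexp ((RtoC k1 * (h + _) + _) * / 2)).
  assert (Z : e1 * / e2 * e3 * e4 * / e5 = 1).
  { unfold e1, e2, e3, e4, e5. rewrite <- !cexp_opp, <- !cexp_add, <- cexp_0. f_equal.
    replace (INR 8) with 8%R by (simpl; ring). replace (INR 7) with 7%R by (simpl; ring).
    field; auto. }
  transitivity (e1 * / e2 * e3 * e4 * / e5 * (s (A + 2 * (RtoC k1 * h)) * / s A * P1 * / P2)); [ring|].
  rewrite Z. ring.
Qed.

(** * The generic identities for a given n *)

Section Cases.
Variable n : nat.
Let t (i : Z) : C := RtoC (IZR (i - Z.of_nat (sigma3 n))).

Lemma mod3_cases : exists N, (n / 3 = N)%nat /\
  ((n = 3 * N /\ n mod 3 = 0 /\ sigma3 n = 0 /\ M3 n = N) \/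
   (n = S (3 * N) /\ n mod 3 = 1 /\ sigma3 n = 2 /\ M3 n = S N) \/
   (n = S (S (3 * N)) /\ n mod 3 = 2 /\ sigma3 n = 1 /\ M3 n = S N))%nat.
Proof.
  exists (n / 3)%nat. split; auto. set (N := (n / 3)%nat).
  assert (D := Nat.div_mod_eq n 3). fold N in D.
  assert (L := Nat.mod_upper_bound n 3 ltac:(lia)).
  unfold M3, sigma3.
  assert (C : (n mod 3 = 0 \/ n mod 3 = 1 \/ n mod 3 = 2)%nat) by lia.
  destruct C as [E|[E|E]]; rewrite E in *; [left | right; left | right; right];
    [ change ((3 - 0) mod 3)%nat with 0%nat | change ((3 - 1) mod 3)%nat with 2%nat
    | change ((3 - 2) mod 3)%nat with 1%nat ];
    clearbody N; (split; [lia|]); (split; [lia|]); (split; [lia|]);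
    symmetry; apply (Nat.div_unique _ _ _ 0); lia.
Qed.

Lemma generic_f (al be de ka : C) : (n mod 3 <> 2)%nat -> gen al be de ka ->
  Ssum al be de ka (RtoC (INR n) * ka) n
  = prefactor al be de ka (t 3) (t 3) (M3 n) * Wf al be de ka (RtoC (INR n) * ka) (n / 3).
Proof.
  intros Hn G. unfold t.
  destruct mod3_cases as (N & -> & [(En & Em & Es & EM)|[(En & Em & Es & EM)|(En & Em & Es & EM)]]); try lia;
    rewrite Es, EM; destruct (sum_all N) as (H0 & H1 & H2).
  - assert (Hnu : RtoC (INR n) * ka = RtoC (INR N) * (3 * ka)).
    { rewrite En, mult_INR, RtoC_mult. replace (INR 3) with 3%R by (simpl; ring). ring. }
    destruct (H0 al be de ka _ G Hnu) as [E _]. rewrite En at 2. exact E.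
  - assert (Hnu : RtoC (INR n) * ka = RtoC (INR N) * (3 * ka) + RtoC (IZR 1) * ka).
    { rewrite En, RtoC_INR_S, mult_INR, RtoC_mult. replace (INR 3) with 3%R by (simpl; ring). ring. }
    destruct (H1 al be de ka _ G Hnu) as [E _]. rewrite En at 2. exact E.
Qed.

Lemma generic_g (al be de ka : C) : (n mod 3 <> 1)%nat -> gen al be de ka ->
  Ssum al be de ka (RtoC (INR n) * ka) n
  = prefactor al be de ka (t 3) (t 2) (M3 n) * Wg al be de ka (RtoC (INR n) * ka) (n / 3).
Proof.
  intros Hn G. unfold t.
  destruct mod3_cases as (N & -> & [(En & Em & Es & EM)|[(En & Em & Es & EM)|(En & Em & Es & EM)]]); try lia;
    rewrite Es, EM; destruct (sum_all N) as (H0 & H1 & H2).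
  - assert (Hnu : RtoC (INR n) * ka = RtoC (INR N) * (3 * ka)).
    { rewrite En, mult_INR, RtoC_mult. replace (INR 3) with 3%R by (simpl; ring). ring. }
    destruct (H0 al be de ka _ G Hnu) as [_ E]. rewrite En at 2. exact E.
  - assert (Hnu : RtoC (INR n) * ka = RtoC (INR N) * (3 * ka) + RtoC (IZR 2) * ka).
    { rewrite En, !RtoC_INR_S, mult_INR, RtoC_mult. replace (INR 3) with 3%R by (simpl; ring). ring. }
    destruct (H2 al be de ka _ G Hnu) as [E _]. rewrite En at 2. exact E.
Qed.

Lemma generic_h (al be de ka : C) : (n mod 3 <> 0)%nat -> gen al be de ka ->
  Ssum al be de ka (RtoC (INR n) * ka) n
  = hfactor al be de ka (RtoC (IZR (Z.of_nat (sigma3 n))))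
    * (prefactor al be de ka (t 3) (t 1) (M3 n) * Wh al be de ka (RtoC (INR n) * ka) (n / 3)).
Proof.
  intros Hn G. unfold t.
  destruct mod3_cases as (N & -> & [(En & Em & Es & EM)|[(En & Em & Es & EM)|(En & Em & Es & EM)]]); try lia;
    rewrite Es, EM; destruct (sum_all N) as (H0 & H1 & H2).
  - assert (Hnu : RtoC (INR n) * ka = RtoC (INR N) * (3 * ka) + RtoC (IZR 1) * ka).
    { rewrite En, RtoC_INR_S, mult_INR, RtoC_mult. replace (INR 3) with 3%R by (simpl; ring). ring. }
    destruct (H1 al be de ka _ G Hnu) as [_ E]. rewrite En at 2. exact E.
  - assert (Hnu : RtoC (INR n) * ka = RtoC (INR N) * (3 * ka) + RtoC (IZR 2) * ka).
    { rewrite En, !RtoC_INR_S, mult_INR, RtoC_mult. replace (INR 3) with 3%R by (simpl; ring). ring. }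
    destruct (H2 al be de ka _ G Hnu) as [_ E]. rewrite En at 2. exact E.
Qed.

(** * Limits of the sum, the prefactors and the series *)

Ltac cv := repeat first
  [ assumption | apply Ccv_const | apply Ccv_plus | apply Ccv_minus | apply Ccv_opp
  | apply Ccv_mult ].

Lemma Ccv_Ssum (A B D K : nat -> C) (al be de ka : C) :
  Ccv A al -> Ccv B be -> Ccv D de -> Ccv K ka -> s al <> 0 ->
  let nu := RtoC (INR n) * ka in
  (forall k, (k <= n)%nat ->
     poch (al + ka - be) ka k * poch (al + ka - gam al be de ka) ka k <> 0 /\
     poch (al + ka - de) ka (2 * k) <> 0 /\
     poch (al + 3 * ka - (al + nu + ka - de)) (3 * ka) k * poch (al + nu + 3 * ka) (3 * ka) k <> 0) ->
  Ccv (fun m => Ssum (A m) (B m) (D m) (K m) (RtoC (INR n) * K m) n) (Ssum al be de ka nu n).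
Proof.
  intros HA HB HD HK n0 nu Hd. unfold Ssum. apply Ccv_Csum. intros k Hk.
  destruct (Hd k Hk) as (d1 & d2 & d3). unfold Sterm, gam in *.
  repeat first [ apply Ccv_sfun | apply Ccv_poch | apply Ccv_div; [assumption | | ] | apply Ccv_mult ];
    unfold nu; cv.
Qed.

Lemma Ccv_prefactor (A B D K : nat -> C) (al be de ka t1 t2 : C) (M : nat) :
  Ccv A al -> Ccv B be -> Ccv D de -> Ccv K ka ->
  pochs [al + t1 * ka - be; al + t1 * ka - gam al be de ka; al + t2 * ka - de;
       al + t2 * ka - be - gam al be de ka - de] (3 * ka) M <> 0 ->
  Ccv (fun m => prefactor (A m) (B m) (D m) (K m) t1 t2 M) (prefactor al be de ka t1 t2 M).
Proof.
  intros HA HB HD HK Hd. unfold prefactor, jackson, gam in *.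
  apply Ccv_div.
  - intros E. apply Hd. unfold pochs. cbn [fold_right]. etransitivity; [|exact E]. ring.
  - repeat first [apply Ccv_poch | apply Ccv_mult]; cv.
  - repeat first [apply Ccv_poch | apply Ccv_mult]; cv.
Qed.

Lemma Ccv_Wf (A B D K : nat -> C) (al be de ka : C) (N : nat) :
  Ccv A al -> Ccv B be -> Ccv D de -> Ccv K ka ->
  let nu := RtoC (INR n) * ka in
  s (al - nu - 2 * ka) <> 0 ->
  (forall k, (k <= N)%nat -> pochs (3 * ka :: map (fun x => al - nu - 2 * ka + 3 * ka - x)
    [al - de - ka; de - nu - ka; be; gam al be de ka; de; ka - nu; - nu]) (3 * ka) k <> 0) ->
  Ccv (fun m => Wf (A m) (B m) (D m) (K m) (RtoC (INR n) * K m) N) (Wf al be de ka nu N).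
Proof.
  intros HA HB HD HK nu n0 Hd. unfold Wf. apply Ccv_Csum. intros k Hk.
  apply (Ccv_vwp (fun m => A m - RtoC (INR n) * K m - 2 * K m) (fun m => 3 * K m) _ _
    [fun m => A m - D m - K m; fun m => D m - RtoC (INR n) * K m - K m; B;
     fun m => gam (A m) (B m) (D m) (K m); D; fun m => K m - RtoC (INR n) * K m;
     fun m => - (RtoC (INR n) * K m)]); auto.
  - unfold nu; cv.
  - cv.
  - unfold nu, gam. repeat apply Forall2_cons; try apply Forall2_nil; cv.
Qed.

Lemma Ccv_Wg (A B D K : nat -> C) (al be de ka : C) (N : nat) :
  Ccv A al -> Ccv B be -> Ccv D de -> Ccv K ka ->
  let nu := RtoC (INR n) * ka in
  s (al - nu - ka) <> 0 ->
  (forall k, (k <= N)%nat -> pochs (3 * ka :: map (fun x => al - nu - ka + 3 * ka - x)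
    [al - de; de - nu - ka; be; gam al be de ka; de + ka; 2 * ka - nu; - nu]) (3 * ka) k <> 0) ->
  Ccv (fun m => Wg (A m) (B m) (D m) (K m) (RtoC (INR n) * K m) N) (Wg al be de ka nu N).
Proof.
  intros HA HB HD HK nu n0 Hd. unfold Wg. apply Ccv_Csum. intros k Hk.
  apply (Ccv_vwp (fun m => A m - RtoC (INR n) * K m - K m) (fun m => 3 * K m) _ _
    [fun m => A m - D m; fun m => D m - RtoC (INR n) * K m - K m; B;
     fun m => gam (A m) (B m) (D m) (K m); fun m => D m + K m; fun m => 2 * K m - RtoC (INR n) * K m;
     fun m => - (RtoC (INR n) * K m)]); auto.
  - unfold nu; cv.
  - cv.
  - unfold nu, gam. repeat apply Forall2_cons; try apply Forall2_nil; cv.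
Qed.

Lemma Ccv_Wh (A B D K : nat -> C) (al be de ka : C) (N : nat) :
  Ccv A al -> Ccv B be -> Ccv D de -> Ccv K ka ->
  let nu := RtoC (INR n) * ka in
  s (al - nu) <> 0 ->
  (forall k, (k <= N)%nat -> pochs (3 * ka :: map (fun x => al - nu + 3 * ka - x)
    [al + ka - de; de - nu - ka; be; gam al be de ka; de + 2 * ka; 2 * ka - nu; ka - nu]) (3 * ka) k <> 0) ->
  Ccv (fun m => Wh (A m) (B m) (D m) (K m) (RtoC (INR n) * K m) N) (Wh al be de ka nu N).
Proof.
  intros HA HB HD HK nu n0 Hd. unfold Wh. apply Ccv_Csum. intros k Hk.
  apply (Ccv_vwp (fun m => A m - RtoC (INR n) * K m) (fun m => 3 * K m) _ _
    [fun m => A m + K m - D m; fun m => D m - RtoC (INR n) * K m - K m; B;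
     fun m => gam (A m) (B m) (D m) (K m); fun m => D m + 2 * K m; fun m => 2 * K m - RtoC (INR n) * K m;
     fun m => K m - RtoC (INR n) * K m]); auto.
  - unfold nu; cv.
  - cv.
  - unfold nu, gam. repeat apply Forall2_cons; try apply Forall2_nil; cv.
Qed.

Lemma Ccv_hfactor (A B D K : nat -> C) (al be de ka t1 : C) :
  Ccv A al -> Ccv B be -> Ccv D de -> Ccv K ka ->
  s (al + t1 * ka - be) * s (al + t1 * ka - gam al be de ka)
     * s (al + ka - de) * s (al + ka - be - gam al be de ka - de) <> 0 ->
  Ccv (fun m => hfactor (A m) (B m) (D m) (K m) t1) (hfactor al be de ka t1).
Proof.
  intros HA HB HD HK Hd. unfold hfactor, gam in *.
  apply Ccv_div; auto; repeat first [apply Ccv_sfun | apply Ccv_mult]; cv.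
Qed.

(** * Translation of the statement into logarithms *)

Variables al be de ka : C.
Let q := cexp ka.
Let a := cexp al.
Let b := cexp be.
Let c := cexp (gam al be de ka).
Let d := cexp de.
Let nu := RtoC (INR n) * ka.
Let e := cexp (al + nu + ka - de).

Ltac collect :=
  unfold q, a, b, c, d, e;
  rewrite ?cexp_powz, ?cexp_pow;
  repeat first [rewrite <- cexp_add | rewrite <- cexp_sub];
  f_equal;
  rewrite ?plus_IZR, ?minus_IZR, ?opp_IZR, <- ?INR_IZR_INZ, ?RtoC_plus, ?RtoC_minus, ?RtoC_opp;
  unfold nu, gam; try replace (INR 3) with 3%R by (simpl; ring);
  try replace (INR 2) with 2%R by (simpl; ring); ring.

Ltac map_list :=
  cbn [map];
  lazymatch goal with
  | |- (_ :: _) = (_ :: _) => apply (f_equal2 (@cons C)); [collect | map_list]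
  | |- nil = nil => reflexivity
  end.

Lemma q3_eq : q ^ 3 = cexp (3 * ka).
Proof. collect. Qed.

Lemma den_lists :
  [a * q / b; a * q / c] = map cexp [al + ka - be; al + ka - gam al be de ka] /\
  a * q / d = cexp (al + ka - de) /\
  [a * Cpowz q 3 / e; a * Cpowz q (Z.of_nat n + 3)]
  = map cexp [al + 3 * ka - (al + nu + ka - de); al + nu + 3 * ka].
Proof. split; [map_list|]. split; [collect | map_list]. Qed.

Lemma S_term_s (k : nat) : S_term p q a b c d e n k = Sterm al be de ka nu k.
Proof.
  assert (n2 := C2_neq_0).
  unfold S_term, Sterm. cbv zeta.
  destruct den_lists as (-> & -> & ->).
  assert (E1 : [b; c] = map cexp [be; gam al be de ka]) by reflexivity.
  assert (E2 : [e; Cpowz q (- Z.of_nat n)] = map cexp [al + nu + ka - de; - nu]).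
  { map_list. }
  rewrite E1, E2, q3_eq. unfold q, a, d.
  rewrite !qpochs_s, !qpoch_s, !cexp_pow, <- cexp_add, !Eth_sfun.
  unfold pochs, lsum. cbn [fold_right length].
  rewrite !Cmult_1_r, !mult_INR, !RtoC_mult.
  replace (RtoC (INR 4) * RtoC (INR k) * ka) with (4 * (RtoC (INR k) * ka))
    by (replace (INR 4) with 4%R by (simpl; ring); ring).
  (* c1 to c8 are the exponentials split off from the theta functions and c9 is q^k; the relations
     built into [gam] and the logarithm of e make their signed product 1. *)
  match goal with |- ?c1 * _ / (?c2 * _) * (?c3 * _) / (?c4 * _) * (?c5 * _) / (?c6 * _)
      * (?c7 * _) / (?c8 * _) * ?c9 = ?R =>
    assert (Z : c1 * / c2 * c3 * / c4 * c5 * / c6 * c7 * / c8 * c9 = 1);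
    [ rewrite <- !cexp_opp, <- !cexp_add, <- cexp_0; f_equal;
      unfold falling2, gam; replace (INR 2) with 2%R by (simpl; ring); field; auto
    | transitivity (c1 * / c2 * c3 * / c4 * c5 * / c6 * c7 * / c8 * c9 * R);
      [ unfold Cdiv; rewrite !Cinv_mul; ring | rewrite Z; ring ] ] end.
Qed.

Lemma S_sum_s : S_sum p q a b c d e n = Ssum al be de ka nu n.
Proof. unfold S_sum, Ssum. apply Csum_ext. intros k _. apply S_term_s. Qed.

Lemma S_den_s (k : nat) : S_den p q a b c d e n k <> 0 ->
  s al <> 0 /\
  poch (al + ka - be) ka k * poch (al + ka - gam al be de ka) ka k <> 0 /\
  poch (al + ka - de) ka (2 * k) <> 0 /\
  poch (al + 3 * ka - (al + nu + ka - de)) (3 * ka) k * poch (al + nu + 3 * ka) (3 * ka) k <> 0.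
Proof.
  unfold S_den. cbv zeta. destruct den_lists as (-> & -> & ->). rewrite q3_eq. unfold q, a.
  rewrite !qpochs_s, !qpoch_s, !Eth_sfun.
  unfold pochs. cbn [fold_right]. intros H.
  repeat split; intros E; apply H.
  - rewrite E. ring.
  - rewrite !Cmult_1_r, E. ring.
  - rewrite E. ring.
  - rewrite !Cmult_1_r, E. ring.
Qed.

Lemma jackson_s (z1 z2 : Z) (M : nat) :
  let u := a * Cpowz q z1 in let v := a * Cpowz q z2 in
  let den := [u / b; u / c; v / d; v / (b * c * d)] in
  (qpochs den (q ^ 3) p (Z.of_nat M) <> 0 ->
   pochs [al + RtoC (IZR z1) * ka - be; al + RtoC (IZR z1) * ka - gam al be de ka;
        al + RtoC (IZR z2) * ka - de;
        al + RtoC (IZR z2) * ka - be - gam al be de ka - de] (3 * ka) M <> 0) /\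
  qpochs [u; u / (b * c); v / (b * d); v / (c * d)] (q ^ 3) p (Z.of_nat M)
    / qpochs den (q ^ 3) p (Z.of_nat M)
  = prefactor al be de ka (RtoC (IZR z1)) (RtoC (IZR z2)) M.
Proof.
  cbv zeta. rewrite q3_eq.
  set (l1 := [al + RtoC (IZR z1) * ka; al + RtoC (IZR z1) * ka - be - gam al be de ka;
        al + RtoC (IZR z2) * ka - be - de; al + RtoC (IZR z2) * ka - gam al be de ka - de]).
  set (l2 := [al + RtoC (IZR z1) * ka - be; al + RtoC (IZR z1) * ka - gam al be de ka;
        al + RtoC (IZR z2) * ka - de;
        al + RtoC (IZR z2) * ka - be - gam al be de ka - de]).
  replace [a * Cpowz q z1; _; _; _] with (map cexp l1) by (unfold l1; symmetry; map_list).
  replace [a * Cpowz q z1 / b; _; _; _] with (map cexp l2) by (unfold l2; symmetry; map_list).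
  split; [apply qpochs_neq_0|].
  rewrite qpochs_ratio.
  - unfold l1, l2, prefactor, jackson, pochs. cbn [fold_right]. f_equal; ring.
  - reflexivity.
  - unfold l1, l2, lsum. cbn [fold_right]. ring.
Qed.

(** The condition on [lsum] is the balancing (a_4 ... a_10)^2 = a_1^6 Q^4, with the square root
    taken in logarithms. *)
Lemma omega_all (N : nat) (a1 : C) (l : list C) (A : C) (L : list C) :
  a1 = cexp A -> l = map cexp L -> length L = 7%nat -> lsum L = 3 * A + 2 * (3 * ka) ->
  omega_den_ok N a1 l (q ^ 3) p ->
  omega N a1 l (q ^ 3) p = Csum N (vwp A L (3 * ka)) /\ s A <> 0 /\
  forall k, (k <= N)%nat -> pochs (3 * ka :: map (fun x => A + 3 * ka - x) L) (3 * ka) k <> 0.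
Proof.
  intros -> -> E1 E2 [H1 H2]. rewrite q3_eq in *. split; [now apply omega_s|]. split.
  - intros E. apply H1. rewrite Eth_sfun, E. ring.
  - intros k Hk. apply qpochs_neq_0. cbn [map]. rewrite <- map_cexp_sub. now apply H2.
Qed.

(** * The three identities by continuity *)

Lemma limit_eq (F G : nat -> C) (x y : C) : (forall m, F m = G m) -> Ccv F x -> Ccv G y -> x = y.
Proof.
  intros E HF HG. apply (Ccv_unique G); auto. apply (Ccv_ext F G x 0); auto.
Qed.

Hypothesis HS : forall k : nat, (k <= n)%nat -> S_den p q a b c d e n k <> 0.

Lemma part_f : (n mod 3 <> 2)%nat ->
  f_den p q a b c d n <> 0 ->
  omega_den_ok (n / 3) (omega_f_a1 q a d e) (omega_f_l q a b c d e n) (q ^ 3) p ->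
  S_sum p q a b c d e n
  = f_n p q a b c d n * omega (n / 3) (omega_f_a1 q a d e) (omega_f_l q a b c d e n) (q ^ 3) p.
Proof.
  intros Hn Hf Ho. rewrite S_sum_s.
  destruct (jackson_s (3 - Z.of_nat (sigma3 n)) (3 - Z.of_nat (sigma3 n)) (M3 n)) as [Hd Hpr].
  unfold f_n, f_num, f_den in *. cbv zeta in *. rewrite Hpr. apply Hd in Hf. clear Hd Hpr.
  destruct (omega_all (n / 3) (omega_f_a1 q a d e) (omega_f_l q a b c d e n) (al - nu - 2 * ka)
    [al - de - ka; de - nu - ka; be; gam al be de ka; de; ka - nu; - nu]) as (-> & HA & HL); auto.
  { unfold omega_f_a1. collect. }
  { unfold omega_f_l. map_list. }
  { unfold lsum, gam. cbn [fold_right]. ring. }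
  (* Along the sequence c and e follow a, b, d, q, so both relations persist. The hypotheses make
     each denominator nonzero at the limit point, hence both sides converge. *)
  destruct (gen_seq al be de ka) as (A & B & D & K & cA & cB & cD & cK & G).
  apply (limit_eq (fun m => Ssum (A m) (B m) (D m) (K m) (RtoC (INR n) * K m) n)
    (fun m => prefactor (A m) (B m) (D m) (K m) (t 3) (t 3) (M3 n)
              * Wf (A m) (B m) (D m) (K m) (RtoC (INR n) * K m) (n / 3))).
  - intros m. now apply generic_f.
  - apply Ccv_Ssum; auto.
    + apply (S_den_s 0 (HS 0%nat (Nat.le_0_l n))).
    + intros k Hk. apply (S_den_s k (HS k Hk)).
  - apply Ccv_mult; [now apply Ccv_prefactor | now apply Ccv_Wf].
Qed.

Lemma part_g : (n mod 3 <> 1)%nat ->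
  g_den p q a b c d n <> 0 ->
  omega_den_ok (n / 3) (omega_g_a1 a d e) (omega_g_l q a b c d e n) (q ^ 3) p ->
  S_sum p q a b c d e n
  = g_n p q a b c d n * omega (n / 3) (omega_g_a1 a d e) (omega_g_l q a b c d e n) (q ^ 3) p.
Proof.
  intros Hn Hf Ho. rewrite S_sum_s.
  destruct (jackson_s (3 - Z.of_nat (sigma3 n)) (2 - Z.of_nat (sigma3 n)) (M3 n)) as [Hd Hpr].
  unfold g_n, g_num, g_den in *. cbv zeta in *. rewrite Hpr. apply Hd in Hf. clear Hd Hpr.
  destruct (omega_all (n / 3) (omega_g_a1 a d e) (omega_g_l q a b c d e n) (al - nu - ka)
    [al - de; de - nu - ka; be; gam al be de ka; de + ka; 2 * ka - nu; - nu]) as (-> & HA & HL); auto.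
  { unfold omega_g_a1. collect. }
  { unfold omega_g_l. map_list. }
  { unfold lsum, gam. cbn [fold_right]. ring. }
  destruct (gen_seq al be de ka) as (A & B & D & K & cA & cB & cD & cK & G).
  apply (limit_eq (fun m => Ssum (A m) (B m) (D m) (K m) (RtoC (INR n) * K m) n)
    (fun m => prefactor (A m) (B m) (D m) (K m) (t 3) (t 2) (M3 n)
              * Wg (A m) (B m) (D m) (K m) (RtoC (INR n) * K m) (n / 3))).
  - intros m. now apply generic_g.
  - apply Ccv_Ssum; auto.
    + apply (S_den_s 0 (HS 0%nat (Nat.le_0_l n))).
    + intros k Hk. apply (S_den_s k (HS k Hk)).
  - apply Ccv_mult; [now apply Ccv_prefactor | now apply Ccv_Wg].
Qed.

Lemma hfactor_s (z : Z) :
  let u := a * Cpowz q z in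
  let den := Eth (u / b) p * Eth (u / c) p * Eth (a * q / d) p * Eth (a * q / (b * c * d)) p in
  let t1 := RtoC (IZR z) in
  (den <> 0 -> s (al + t1 * ka - be) * s (al + t1 * ka - gam al be de ka)
     * s (al + ka - de) * s (al + ka - be - gam al be de ka - de) <> 0) /\
  Eth u p * Eth (u / (b * c)) p * Eth (a * q / (b * d)) p * Eth (a * q / (c * d)) p / den
  = hfactor al be de ka t1.
Proof.
  assert (n2 := C2_neq_0). cbv zeta.
  replace (a * Cpowz q z / b) with (cexp (al + RtoC (IZR z) * ka - be)) by (symmetry; collect).
  replace (a * Cpowz q z / c) with (cexp (al + RtoC (IZR z) * ka - gam al be de ka)) by (symmetry; collect).
  replace (a * q / d) with (cexp (al + ka - de)) by (symmetry; collect).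
  replace (a * q / (b * c * d)) with (cexp (al + ka - be - gam al be de ka - de)) by (symmetry; collect).
  replace (a * Cpowz q z / (b * c)) with (cexp (al + RtoC (IZR z) * ka - be - gam al be de ka)) by (symmetry; collect).
  replace (a * q / (b * d)) with (cexp (al + ka - be - de)) by (symmetry; collect).
  replace (a * q / (c * d)) with (cexp (al + ka - gam al be de ka - de)) by (symmetry; collect).
  replace (a * Cpowz q z) with (cexp (al + RtoC (IZR z) * ka)) by (symmetry; collect).
  rewrite !Eth_sfun. split.
  - intros H E. apply H.
    match type of E with ?x * ?y * ?z * ?w = _ =>
      match goal with |- ?c1 * _ * (?c2 * _) * (?c3 * _) * (?c4 * _) = _ =>
        transitivity (c1 * c2 * c3 * c4 * (x * y * z * w)); [ring | rewrite E; ring] end end.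
  - unfold hfactor.
    match goal with |- ?c1 * _ * (?c2 * _) * (?c3 * _) * (?c4 * _)
       / (?c5 * _ * (?c6 * _) * (?c7 * _) * (?c8 * _)) = ?R =>
      assert (Z : c1 * c2 * c3 * c4 * (/ c5 * / c6 * / c7 * / c8) = 1);
      [ rewrite <- !cexp_opp, <- !cexp_add, <- cexp_0; f_equal; field; auto
      | transitivity (c1 * c2 * c3 * c4 * (/ c5 * / c6 * / c7 * / c8) * R);
        [ unfold Cdiv; rewrite !Cinv_mul; ring | rewrite Z; ring ] ] end.
Qed.

Lemma part_h : (n mod 3 <> 0)%nat ->
  h_Eden p q a b c d n <> 0 -> h_den p q a b c d n <> 0 ->
  omega_den_ok (n / 3) (omega_h_a1 q a d e) (omega_h_l q a b c d e n) (q ^ 3) p ->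
  S_sum p q a b c d e n
  = h_n p q a b c d n * omega (n / 3) (omega_h_a1 q a d e) (omega_h_l q a b c d e n) (q ^ 3) p.
Proof.
  intros Hn HE Hf Ho. rewrite S_sum_s.
  destruct (jackson_s (3 - Z.of_nat (sigma3 n)) (1 - Z.of_nat (sigma3 n)) (M3 n)) as [Hd Hpr].
  destruct (hfactor_s (Z.of_nat (sigma3 n))) as [Hd' Hh].
  unfold h_n, h_Enum, h_Eden, h_num, h_den in *. cbv zeta in *. rewrite Hpr, Hh.
  apply Hd in Hf. apply Hd' in HE. clear Hd Hpr Hd' Hh.
  destruct (omega_all (n / 3) (omega_h_a1 q a d e) (omega_h_l q a b c d e n) (al - nu)
    [al + ka - de; de - nu - ka; be; gam al be de ka; de + 2 * ka; 2 * ka - nu; ka - nu])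
    as (-> & HA & HL); auto.
  { unfold omega_h_a1. collect. }
  { unfold omega_h_l. map_list. }
  { unfold lsum, gam. cbn [fold_right]. ring. }
  destruct (gen_seq al be de ka) as (A & B & D & K & cA & cB & cD & cK & G).
  apply (limit_eq (fun m => Ssum (A m) (B m) (D m) (K m) (RtoC (INR n) * K m) n)
    (fun m => hfactor (A m) (B m) (D m) (K m) (RtoC (IZR (Z.of_nat (sigma3 n))))
       * prefactor (A m) (B m) (D m) (K m) (t 3) (t 1) (M3 n)
              * Wh (A m) (B m) (D m) (K m) (RtoC (INR n) * K m) (n / 3))).
  - intros m. rewrite <- Cmult_assoc. now apply generic_h.
  - apply Ccv_Ssum; auto.
    + apply (S_den_s 0 (HS 0%nat (Nat.le_0_l n))).
    + intros k Hk. apply (S_den_s k (HS k Hk)).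
  - apply Ccv_mult; [apply Ccv_mult; [now apply Ccv_hfactor | now apply Ccv_prefactor] | now apply Ccv_Wh].
Qed.
End Cases.
End Final.

Theorem theorem4p9 (p q a b c d e : C) (n : nat) :
  Cmod p < 1 ->
  q <> RtoC 0 -> a <> RtoC 0 -> b <> RtoC 0 -> c <> RtoC 0 ->
  d <> RtoC 0 -> e <> RtoC 0 ->
  b * c * d = a * a * q ->
  d * e = a * Cpow q (S n) ->
  (* genericity: the denominators of S do not vanish *)
  (forall k : nat, (k <= n)%nat -> S_den p q a b c d e n k <> RtoC 0) ->
  ((n mod 3 <> 2)%nat ->
     f_den p q a b c d n <> RtoC 0 ->
     omega_den_ok (n / 3) (omega_f_a1 q a d e) (omega_f_l q a b c d e n) (Cpow q 3) p ->
     S_sum p q a b c d e n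
     = f_n p q a b c d n
       * omega (n / 3) (omega_f_a1 q a d e) (omega_f_l q a b c d e n) (Cpow q 3) p) /\
  ((n mod 3 <> 1)%nat ->
     g_den p q a b c d n <> RtoC 0 ->
     omega_den_ok (n / 3) (omega_g_a1 a d e) (omega_g_l q a b c d e n) (Cpow q 3) p ->
     S_sum p q a b c d e n
     = g_n p q a b c d n
       * omega (n / 3) (omega_g_a1 a d e) (omega_g_l q a b c d e n) (Cpow q 3) p) /\
  ((n mod 3 <> 0)%nat ->
     h_Eden p q a b c d n <> RtoC 0 ->
     h_den p q a b c d n <> RtoC 0 ->
     omega_den_ok (n / 3) (omega_h_a1 q a d e) (omega_h_l q a b c d e n) (Cpow q 3) p ->
     S_sum p q a b c d e n
     = h_n p q a b c d n
       * omega (n / 3) (omega_h_a1 q a d e) (omega_h_l q a b c d e n) (Cpow q 3) p).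
Proof.
  intros Hp Hq Ha Hb Hc Hd He E1 E2.
  destruct (cexp_surj q Hq) as [ka <-]. destruct (cexp_surj a Ha) as [al <-].
  destruct (cexp_surj b Hb) as [be <-]. destruct (cexp_surj d Hd) as [de <-].
  (* The logarithms of c and e are solved from the relations rather than chosen, so no multiple of 2
     pi i intervenes. *)
  assert (Ec : c = cexp (gam al be de ka)).
  { transitivity (cexp be * c * cexp de / (cexp be * cexp de)); [now field|].
    rewrite E1, <- !cexp_add, <- cexp_sub. f_equal. unfold gam. ring. }
  assert (Ee : e = cexp (al + RtoC (INR n) * ka + ka - de)).
  { transitivity (cexp de * e / cexp de); [now field|].
    rewrite E2, cexp_pow, <- !cexp_add, <- cexp_sub, RtoC_INR_S. f_equal. ring. }
  subst c e. intros HS.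
  split; [|split].
  - now apply part_f.
  - now apply part_g.
  - now apply part_h.
Qed.
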